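(* Let $d=2$. Assume (G1) and (G2) (see context). For any $\varepsilon\in(0,\frac12]$, the equation $-\Delta u=f(u)$ in $\mathbb{R}^2$ has a radial singular solution $U_\infty$ satisfying $$ \begin{aligned} g(U_\infty(r))={}&-2\log r-2\log(-2\log r)+\log\Big[\frac{g}{g'}\big(g^{-1}(-2\log r)\big)\Big]+\log 4-\log q\\ &+\log\big(q\,H(g^{-1}(-2\log r))\big)+o\big((-\log r)^{-1+\varepsilon}\big)\qquad\text{as } r\to0. \end{aligned} $$ In addition, $U_\infty$ has a zero at some $r=r_0$.
   Context: Throughout, the nonlinearity $f$ satisfies $f\in C^1[0,\infty)$ and $f>0$ on $[0,\infty)$. Put $g(s):=\log f(s)$ and $H(s):=\frac{g(s)g''(s)}{(g'(s))^2}$. (G1): the function $g>0$ satisfies $\int_s^\infty\frac{du}{g(u)}<\infty$ for all $s$ large, and there exists $\frac1q=\lim_{s\to\infty}H(s)$. (G2): there exist $C>0$ and $s_0>0$ such that $g\in C^5(s_0,\infty)$ and $|H^{(k)}(s)|<C\big(\frac{g'}{g}\big)^k(s)$ for any $k\in\{1,2,3\}$ and $s>s_0$. Under (G1) and (G2), $g$ is strictly increasing for large $s$ with $g(s)\to\infty$ as $s\to\infty$; $g^{-1}$ denotes the inverse function of $g$ (for large arguments). A radial singular solution of $-\Delta u=f(u)$ in $\mathbb{R}^2$ is a function $U(x)=U(r)$, $r=|x|$, with $U\in C^2(0,\infty)$, which satisfies the equation except for $x=0$ and is such that $U(r)\to\infty$ as $r\to0$. *)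

(* Defs.v *)
From Stdlib Require Import Reals.
From Coquelicot Require Import Coquelicot.
Open Scope R_scope.

(** [f] is of class C^1 on [[0,+oo)], with one-sided derivative at [0]; the
    values of [f] on negative arguments are irrelevant. *)
Definition C1_nonneg (f : R -> R) : Prop :=
  exists df : R -> R, forall x, 0 <= x ->
    filterlim (fun y => (f y - f x) / (y - x))
      (within (fun y => 0 <= y /\ y <> x) (locally x)) (locally (df x)) /\
    filterlim df (within (fun y => 0 <= y) (locally x)) (locally (df x)).

(** [h] is of class C^k on [(a,+oo)].  All orders [j <= k] are listed because
    [Derive_n] is total, so that [ex_derive_n h k] alone does not give the
    lower orders. *)
Definition Ck_beyond (a : R) (k : nat) (h : R -> R) : Prop :=
  forall (j : nat) (x : R), (j <= k)%nat -> a < x ->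
    ex_derive_n h j x /\ continuous (Derive_n h j) x.

Definition logf (f : R -> R) (s : R) : R := ln (f s).

Definition Hfun (g : R -> R) (s : R) : R :=
  g s * Derive_n g 2 s / (Derive g s) ^ 2.

Definition G1 (g : R -> R) (q : R) : Prop :=
  Rbar_locally p_infty (fun s =>
    0 < g s /\
    ex_RInt_gen (fun u => / g u) (at_point s) (Rbar_locally p_infty)) /\
  q <> 0 /\ is_lim (Hfun g) p_infty (1 / q).

Definition G2 (g : R -> R) : Prop :=
  exists C s0 : R, 0 < C /\ 0 < s0 /\ Ck_beyond s0 5 g /\
    forall (k : nat) (s : R), (1 <= k <= 3)%nat -> s0 < s ->
      Rabs (Derive_n (Hfun g) k s) < C * (Derive g s / g s) ^ k.

(** The unique [s >= 0] with [g s = y].  Under [G1] and [G2] (with [g]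
    continuous on [[0,+oo)]) it exists and is unique for all large [y], since
    [g] is bounded on compact sets and increases to [+oo] at infinity. *)
Definition ginv (g : R -> R) (y : R) : R :=
  iota (T := R_CompleteSpace) (fun s : R => 0 <= s /\ g s = y).

Definition laplacian2 (u : R -> R -> R) (x y : R) : R :=
  Derive_n (fun t => u t y) 2 x + Derive_n (fun t => u x t) 2 y.

Definition radial (U : R -> R) (x y : R) : R := U (sqrt (x ^ 2 + y ^ 2)).

(** A nonlinearity given on [[0,+oo)] only, continued by [f 0] to negative
    arguments: a radial solution decreases below [0] after its zero, where
    [f] itself is not defined. *)
Definition ext0 (f : R -> R) (s : R) : R := f (Rmax 0 s).

Definition radial_singular_solution (f U : R -> R) : Prop :=
  Ck_beyond 0 2 U /\
  (forall x y : R, (x, y) <> (0, 0) ->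
     - laplacian2 (radial U) x y = ext0 f (radial U x y)) /\
  filterlim U (at_right 0) (Rbar_locally p_infty).

Definition expansion (g : R -> R) (q r : R) : R :=
  let s := ginv g (- 2 * ln r) in
  - 2 * ln r - 2 * ln (- 2 * ln r) + ln (g s / Derive g s)
  + ln 4 - ln q + ln (q * Hfun g s).

(* Main.v *)
(** Put [t = - 2 ln r]; a radial solution then solves
    [u'' + (1/4) e^(-t) f(u) = 0].  Write [g = ln f], [v = g s], [D = d/dv] and
    [g - correction = theta].  The function [u0 = theta^(-1)] is the first iterate
    of [e^(g(u) - t) = - 4 u''] started at [g^(-1)], except that the correction is
    evaluated at [u0] itself instead of at [g^(-1)(t)].  (G2) says that [H] is a
    symbol of order 0 in [v] with three derivatives, so that the residual of [u0]
    relative to the linearised frequency [Q = H / g] is [J B] with [J = 1 / g'],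
    [B = O(1/v)] and [DB = O(1/v^2)].

    The linearisation at [u0] is [z'' + Q z = ...] with [Q] of order [1/t].
    Backwards in [t], the energy [z'^2 + Q z^2] grows at most like [t^(-2)], because
    [v DH -> 0] by interpolation between [H] and [D^2 H], while the residual is
    small enough to beat this growth.  Hence the solutions that agree with [u0] at
    [t = n] to first order satisfy [|u_n - u0| <= A J / g(u0)] on a fixed half-line
    up to [n] and form a Cauchy sequence.  Their limit [u] has
    [g(u) = g(u0) + O(1/t)], and replacing [u0] by [g^(-1)(t)] in the correction
    costs [O(ln t / t)], which gives the expansion.

    As [u] is concave and tends to infinity, it is increasing; backwards it stays
    below its tangent, so it extends to all [t] and vanishes somewhere. *)

Require Import Defs.
From Stdlib Require Import Reals Lra Lia ClassicalEpsilon.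
From Coquelicot Require Import Coquelicot.
Open Scope R_scope.

(** * Calculus on half-lines *)

(** The constants form a numerical budget. The thresholds [1 / 10] give [G' >= 9/10], and the
    smallness of [v DH] gives [|Q'| G <= 17/10 Q]. Since [2 * 9/10] exceeds [17/10], the weighted
    energy [G^2 X] of a difference of solutions is nondecreasing in [t], and the slack absorbs the
    nonlinear remainder. If [v DH] were merely bounded, the growth exponent would be uncontrolled,
    whereas the discrepancy at [n] has energy of order [G^(-3)]: an exponent below [3] is required,
    and [2] leaves the factor [1 / G n]. The source changes by a fixed factor when [u] moves by
    about [J = 1 / g'], so linearising makes sense only at distances small against [J]; hence errors
    are measured in units of [J], a slowly varying nonincreasing scale. The linearised equation is
    oscillatory, so no decaying mode can be selected at infinity. Solutions are therefore launched
    backwards from finite [n]; concavity keeps them below their final value, where the source is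
    Lipschitz. *)

Lemma increment_le (f f' : R -> R) (a b c : R) :
  a <= b ->
  (forall x, a <= x <= b -> is_derive f x (f' x)) ->
  (forall x, a <= x <= b -> c <= f' x) ->
  c * (b - a) <= f b - f a.
Proof.
  intros hab hd hc.
  destruct (MVT_gen f a b f') as [x [hx heq]].
  - intros x hx; apply hd; rewrite Rmin_left, Rmax_right in hx; lra.
  - intros x hx; rewrite Rmin_left, Rmax_right in hx by lra.
    apply continuity_pt_filterlim, (ex_derive_continuous f).
    exists (f' x); now apply hd.
  - rewrite heq; rewrite Rmin_left, Rmax_right in hx by lra.
    apply Rmult_le_compat_r; [lra | now apply hc].
Qed.

Lemma increment_ge (f f' : R -> R) (a b c : R) :
  a <= b ->
  (forall x, a <= x <= b -> is_derive f x (f' x)) ->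
  (forall x, a <= x <= b -> f' x <= c) ->
  f b - f a <= c * (b - a).
Proof.
  intros hab hd hc.
  assert (h := increment_le (fun x => - f x) (fun x => - f' x) a b (- c) hab).
  enough (- c * (b - a) <= - f b - - f a) by lra.
  apply h.
  - intros x hx; apply (is_derive_opp f), hd, hx.
  - intros x hx; specialize (hc x hx); lra.
Qed.

Lemma increment_abs (f f' : R -> R) (a b c : R) :
  (forall x, Rmin a b <= x <= Rmax a b -> is_derive f x (f' x)) ->
  (forall x, Rmin a b <= x <= Rmax a b -> Rabs (f' x) <= c) ->
  Rabs (f b - f a) <= c * Rabs (b - a).
Proof.
  intros hd hc.
  destruct (MVT_gen f a b f') as [x [hx heq]].
  - intros x hx; apply hd; lra.
  - intros x hx; apply continuity_pt_filterlim, (ex_derive_continuous f).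
    exists (f' x); now apply hd.
  - rewrite heq, Rabs_mult.
    apply Rmult_le_compat_r; [apply Rabs_pos | now apply hc].
Qed.

Lemma Rabs_prod_le (x y a b : R) :
  Rabs x <= a -> Rabs y <= b -> Rabs (x * y) <= a * b.
Proof.
  intros hx hy; rewrite Rabs_mult.
  apply Rmult_le_compat; auto using Rabs_pos.
Qed.

Lemma Rabs_sum_le (x y a b : R) :
  Rabs x <= a -> Rabs y <= b -> Rabs (x + y) <= a + b.
Proof.
  intros hx hy; apply Rle_trans with (1 := Rabs_triang x y); lra.
Qed.

Definition ev (P : R -> Prop) : Prop := Rbar_locally p_infty P.

Lemma ev_imp (P Q : R -> Prop) : ev P -> (forall x, P x -> Q x) -> ev Q.
Proof. intros hP h; exact (@filter_imp _ (Rbar_locally p_infty) _ P Q h hP). Qed.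

Lemma ev_and (P Q : R -> Prop) : ev P -> ev Q -> ev (fun x => P x /\ Q x).
Proof. intros hP hQ; exact (@filter_and _ (Rbar_locally p_infty) _ P Q hP hQ). Qed.

Lemma ev_imp2 (P Q S : R -> Prop) :
  ev P -> ev Q -> (forall x, P x -> Q x -> S x) -> ev S.
Proof.
  intros hP hQ h; apply (ev_imp _ _ (ev_and _ _ hP hQ)).
  intros x [h1 h2]; auto.
Qed.

Lemma ev_beyond (M : R) : ev (fun x => M < x).
Proof. exists M; auto. Qed.

Lemma ev_locally (P : R -> Prop) : ev P -> ev (fun x => locally x P).
Proof.
  intros [M h]; exists M; intros x hx.
  apply (filter_imp (fun y => M < y)); [exact h |].
  now apply open_gt.
Qed.

Lemma ev_choose (P : R -> Prop) (M : R) :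
  ev P -> exists s, M < s /\ forall x, s <= x -> P x.
Proof.
  intros [N h]; exists (Rmax M N + 1).
  pose proof (Rmax_l M N); pose proof (Rmax_r M N).
  split; [lra | intros x hx; apply h; lra].
Qed.

Lemma IVT_value (f : R -> R) (a b c : R) :
  a < b -> (forall x, a <= x <= b -> continuous f x) ->
  f a < c < f b -> exists x, a < x < b /\ f x = c.
Proof.
  intros hab hc [h1 h2].
  destruct (Ranalysis5.IVT_interv (fun x => f x - c) a b) as [x [hx heq]];
    try lra.
  - intros x hx; apply continuity_pt_filterlim.
    apply (continuous_minus f (fun _ => c)); [now apply hc |].
    apply continuous_const.
  - exists x; split; [| lra].
    destruct (Req_dec x a) as [-> | ]; [lra |].
    destruct (Req_dec x b) as [-> | ]; lra.
Qed.

(** Values of [inv] are chosen by the intermediate value theorem. Strict monotonicity makes [inv]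
    continuous, and this continuity is what allows the difference quotient of [F] at [inv t] to be
    inverted. *)
Lemma inverse_beyond (F F' : R -> R) (s0 : R) :
  (forall s, s0 <= s -> is_derive F s (F' s)) ->
  (forall s, s0 <= s -> 0 < F' s) ->
  (forall M, ev (fun s => M < F s)) ->
  exists inv : R -> R, forall t, F s0 < t ->
    s0 < inv t /\ F (inv t) = t /\ is_derive inv t (/ F' (inv t)).
Proof.
  intros hd hpos hlim.
  assert (hinc : forall a b, s0 <= a -> a < b -> F a < F b).
  { intros a b ha hab.
    destruct (MVT_gen F a b F') as [x [hx heq]].
    - intros x hx; apply hd; rewrite Rmin_left in hx; lra.
    - intros x hx; apply continuity_pt_filterlim, (ex_derive_continuous F).
      exists (F' x); apply hd; rewrite Rmin_left in hx; lra.
    - rewrite Rmin_left in hx by lra.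
      assert (0 < F' x) by (apply hpos; lra).
      assert (0 < F' x * (b - a)) by (apply Rmult_lt_0_compat; lra).
      lra. }
  assert (hex : forall t, exists s, F s0 < t -> s0 < s /\ F s = t).
  { intros t; destruct (Rlt_dec (F s0) t) as [ht | ht]; [| exists 0; lra].
    destruct (ev_choose _ s0 (hlim t)) as [s1 [hs1 ht1]].
    specialize (ht1 s1 (Rle_refl _)).
    destruct (IVT_value F s0 s1 t hs1) as [x [hx hFx]].
    - intros x hx; apply (ex_derive_continuous F); exists (F' x); apply hd; lra.
    - lra.
    - exists x; intros _; split; [lra | assumption]. }
  assert (hch : exists inv, forall t, F s0 < t -> s0 < inv t /\ F (inv t) = t).
  { exists (fun t => proj1_sig (constructive_indefinite_description _ (hex t))).
    intros t; now destruct (constructive_indefinite_description _ (hex t)). }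
  destruct hch as [inv hinv]; exists inv; intros t ht.
  destruct (hinv t ht) as [h1 h2]; split; [assumption |]; split; [assumption |].
  assert (hlt : forall a b, s0 <= a -> s0 <= b -> F a < F b -> a < b).
  { intros a b ha hb hab; destruct (Rlt_le_dec a b) as [| hba]; [assumption |].
    destruct hba as [hba | ->]; [| lra].
    specialize (hinc b a hb hba); lra. }
  assert (hcont : forall eps, 0 < eps ->
    locally t (fun y => F s0 < y /\ Rabs (inv y - inv t) < eps)).
  { intros eps heps.
    set (a := Rmax ((s0 + inv t) / 2) (inv t - eps / 2)).
    assert (ha : s0 < a < inv t /\ inv t - a < eps).
    { unfold a; pose proof (Rmax_l ((s0 + inv t) / 2) (inv t - eps / 2)).
      pose proof (Rmax_r ((s0 + inv t) / 2) (inv t - eps / 2)).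
      split; [split; [lra | apply Rmax_lub_lt; lra] | lra]. }
    assert (hFa : F a < t) by (rewrite <- h2; apply hinc; lra).
    assert (hFb : t < F (inv t + eps / 2)) by (rewrite <- h2 at 1; apply hinc; lra).
    assert (F s0 < F a) by (apply hinc; lra).
    apply (filter_imp (fun y => F a < y /\ y < F (inv t + eps / 2))).
    - intros y [hy1 hy2].
      destruct (hinv y) as [h3 h4]; [lra |].
      split; [lra |].
      rewrite <- h4 in hy1, hy2.
      apply hlt in hy1; [| lra | lra]; apply hlt in hy2; [| lra | lra].
      apply Rabs_def1; lra.
    - apply filter_and; [now apply open_gt | now apply open_lt]. }
  set (d := F' (inv t)).
  assert (hdpos : 0 < d) by (apply hpos; lra).
  assert (hder : is_derive F (inv t) d) by (apply hd; lra).
  split; [apply is_linear_scal_l |].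
  intros x hx; rewrite <- (is_filter_lim_locally_unique (V := R_NormedModule) t x hx).
  clear x hx.
  intros eps; destruct hder as [_ hder].
  specialize (hder (inv t) (fun P h => h)).
  (* The bound [d / 2] gives [|w| <= 2 |v| / d] for the increment [w] of [inv]; the second bound
     then turns the error [e1 |w| / d] into at most [eps |v|]. *)
  set (e1 := Rmin (d / 2) (eps * d * d / 2)).
  assert (he1 : 0 < e1).
  { unfold e1; apply Rmin_glb_lt; [lra |].
    pose proof (cond_pos eps).
    assert (0 < eps * d * d) by (repeat apply Rmult_lt_0_compat; lra); lra. }
  destruct (hder (mkposreal e1 he1)) as [del hdel].
  apply (filter_imp (fun y => F s0 < y /\ Rabs (inv y - inv t) < del));
    [| apply hcont, cond_pos].
  intros y [hy1 hy2].
  specialize (hdel (inv y) hy2).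
  destruct (hinv y hy1) as [_ hFy].
  unfold norm, minus, plus, opp, scal in hdel |- *; simpl in hdel |- *.
  unfold abs, mult in hdel |- *; simpl in hdel |- *.
  unfold mult in *; simpl in *.
  rewrite hFy, h2 in hdel.
  set (w := inv y + - inv t) in *; set (v := y + - t) in *.
  assert (hw : Rabs w * (d / 2) <= Rabs v).
  { assert (h5 : Rabs (w * d) <= Rabs v + e1 * Rabs w).
    { replace (w * d) with (v - (v + - (w * d))) by ring.
      apply Rle_trans with (1 := Rabs_triang _ _); rewrite Rabs_Ropp; lra. }
    rewrite Rabs_mult, (Rabs_pos_eq d) in h5 by lra.
    assert (e1 <= d / 2) by apply Rmin_l.
    pose proof (Rabs_pos w); nra. }
  replace (w + - (v * / d)) with (- ((v + - (w * d)) / d)) by (field; lra).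
  rewrite Rabs_Ropp; unfold Rdiv; rewrite Rabs_mult, Rabs_inv, (Rabs_pos_eq d) by lra.
  apply Rmult_le_reg_r with d; [assumption |].
  rewrite Rmult_assoc, Rinv_l, Rmult_1_r by lra.
  apply Rle_trans with (1 := hdel).
  assert (he : e1 <= eps * d * d / 2) by apply Rmin_r.
  pose proof (Rabs_pos w); pose proof (cond_pos eps).
  apply Rle_trans with (eps * d * d / 2 * Rabs w); [nra |].
  replace (eps * d * d / 2 * Rabs w) with (eps * d * (Rabs w * (d / 2))) by field.
  replace (eps * Rabs v * d) with (eps * d * Rabs v) by ring.
  apply Rmult_le_compat_l; [nra | assumption].
Qed.

(** * Symbols in the variable [v = g s] *)

Definition ev_bounded (g : R -> R) (k : nat) (F : R -> R) : Prop :=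
  exists C, 0 <= C /\ ev (fun s => Rabs (F s) <= C * (/ g s) ^ k).

(** Symbols of order [-k] in the variable [v = g s], with [m] derivatives:
    [F1] is [dF/dv], and each derivative gains a factor [1 / v]. *)
Fixpoint sym (g g1 : R -> R) (m k : nat) (F : R -> R) : Prop :=
  ev_bounded g k F /\
  match m with
  | O => True
  | S m' => exists F1, ev (fun s => is_derive F s (g1 s * F1 s)) /\
                       sym g g1 m' (S k) F1
  end.

Section Symbols.

Variables g g1 : R -> R.
Hypothesis g_derive : ev (fun s => is_derive g s (g1 s)).
Hypothesis g_ge1 : ev (fun s => 1 <= g s).

Lemma sym_bounded m k F : sym g g1 m k F -> ev_bounded g k F.
Proof. destruct m; now intros [h _]. Qed.

Lemma ev_bounded_le k F1 F2 :
  ev (fun s => Rabs (F1 s) <= Rabs (F2 s)) -> ev_bounded g k F2 -> ev_bounded g k F1.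
Proof.
  intros h [C [hC hF]]; exists C; split; [assumption |].
  apply (ev_imp2 _ _ _ h hF); intros s h1 h2; lra.
Qed.

Lemma ev_bounded_mult k l F1 F2 :
  ev_bounded g k F1 -> ev_bounded g l F2 ->
  ev_bounded g (k + l) (fun s => F1 s * F2 s).
Proof.
  intros [C [hC hF]] [D [hD hG]]; exists (C * D).
  split; [now apply Rmult_le_pos |].
  apply (ev_imp2 _ _ _ hF hG); intros s h1 h2.
  rewrite pow_add.
  replace (C * D * ((/ g s) ^ k * (/ g s) ^ l))
    with ((C * (/ g s) ^ k) * (D * (/ g s) ^ l)) by ring.
  now apply Rabs_prod_le.
Qed.

Lemma ev_bounded_plus k F1 F2 :
  ev_bounded g k F1 -> ev_bounded g k F2 -> ev_bounded g k (fun s => F1 s + F2 s).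
Proof.
  intros [C [hC hF]] [D [hD hG]]; exists (C + D).
  split; [lra |].
  apply (ev_imp2 _ _ _ hF hG); intros s h1 h2.
  rewrite Rmult_plus_distr_r; now apply Rabs_sum_le.
Qed.

Lemma ev_bounded_lower k F :
  ev_bounded g (S k) F -> ev_bounded g k F.
Proof.
  intros [C [hC hF]]; exists C; split; [assumption |].
  apply (ev_imp2 _ _ _ hF g_ge1); intros s h1 h2.
  apply Rle_trans with (1 := h1); simpl.
  assert (0 < / g s <= 1).
  { split; [apply Rinv_0_lt_compat; lra |].
    rewrite <- Rinv_1; apply Rinv_le_contravar; lra. }
  assert (0 <= (/ g s) ^ k) by (apply pow_le; lra).
  apply Rmult_le_compat_l; [assumption | nra].
Qed.

Lemma ev_bounded_scale k F :
  ev_bounded g (S k) F -> ev_bounded g k (fun s => g s * F s).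
Proof.
  intros [C [hC hF]]; exists C; split; [assumption |].
  apply (ev_imp2 _ _ _ hF g_ge1); intros s h1 h2.
  rewrite Rabs_mult, (Rabs_pos_eq (g s)) by lra.
  replace (C * (/ g s) ^ k) with (g s * (C * (/ g s) ^ S k)) by (simpl; field; lra).
  apply Rmult_le_compat_l; lra.
Qed.

Lemma sym_ext m : forall k F1 F2,
  ev (fun s => F1 s = F2 s) -> sym g g1 m k F1 -> sym g g1 m k F2.
Proof.
  destruct m as [| m]; intros k F1 F2 h [hb hm].
  - split; [| exact I].
    apply (ev_bounded_le k F2 F1); [| assumption].
    apply (ev_imp _ _ h); intros s ->; apply Rle_refl.
  - destruct hm as [E [hE hs]]; split.
    + apply (ev_bounded_le k F2 F1); [| assumption].
      apply (ev_imp _ _ h); intros s ->; apply Rle_refl.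
    + exists E; split; [| assumption].
      apply (ev_imp2 _ _ _ (ev_locally _ h) hE); intros s h1 h2.
      now apply (is_derive_ext_loc F1).
Qed.

Lemma sym_weaken m : forall k F, sym g g1 (S m) k F -> sym g g1 m k F.
Proof.
  induction m as [| m IH]; intros k F [hb [E [hE hs]]]; split; auto.
  exists E; split; auto.
Qed.

Lemma sym_lower m : forall k F, sym g g1 m (S k) F -> sym g g1 m k F.
Proof.
  induction m as [| m IH]; intros k F [hb hm]; split;
    auto using ev_bounded_lower.
  destruct hm as [E [hE hs]]; exists E; auto.
Qed.

Lemma sym_const m : forall k c, c = 0 \/ k = O -> sym g g1 m k (fun _ => c).
Proof.
  assert (hb : forall k c, c = 0 \/ k = O -> ev_bounded g k (fun _ => c)).
  { intros k c hc; exists (Rabs c); split; [apply Rabs_pos |].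
    apply (ev_imp _ _ g_ge1); intros s hs.
    destruct hc as [-> | ->]; [rewrite Rabs_R0; lra | simpl; lra]. }
  induction m as [| m IH]; intros k c hc; split; auto.
  exists (fun _ => 0); split; [| apply IH; now left].
  apply (ev_imp _ _ g_ge1); intros s _.
  rewrite Rmult_0_r; apply (is_derive_const c s).
Qed.

Lemma sym_plus m : forall k F1 F2,
  sym g g1 m k F1 -> sym g g1 m k F2 -> sym g g1 m k (fun s => F1 s + F2 s).
Proof.
  induction m as [| m IH]; intros k F1 F2 [hb1 h1] [hb2 h2]; split;
    auto using ev_bounded_plus.
  destruct h1 as [E1 [hE1 hs1]], h2 as [E2 [hE2 hs2]].
  exists (fun s => E1 s + E2 s); split; [| auto].
  apply (ev_imp2 _ _ _ hE1 hE2); intros s d1 d2.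
  rewrite Rmult_plus_distr_l; now apply (is_derive_plus F1 F2).
Qed.

Lemma sym_mult m : forall k l F1 F2,
  sym g g1 m k F1 -> sym g g1 m l F2 -> sym g g1 m (k + l) (fun s => F1 s * F2 s).
Proof.
  induction m as [| m IH]; intros k l F1 F2 hF1 hF2;
    (split; [apply ev_bounded_mult; eapply sym_bounded; eassumption |]); auto.
  pose proof (sym_weaken _ _ _ hF1) as hw1; pose proof (sym_weaken _ _ _ hF2) as hw2.
  destruct hF1 as [_ [E1 [hE1 hs1]]], hF2 as [_ [E2 [hE2 hs2]]].
  exists (fun s => E1 s * F2 s + F1 s * E2 s); split.
  - apply (ev_imp2 _ _ _ hE1 hE2); intros s d1 d2.
    replace (g1 s * (E1 s * F2 s + F1 s * E2 s))
      with (g1 s * E1 s * F2 s + F1 s * (g1 s * E2 s)) by ring.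
    apply (is_derive_mult F1 F2); auto; intros; apply Rmult_comm.
  - apply sym_plus.
    + exact (IH (S k) l _ _ hs1 hw2).
    + replace (S (k + l)) with (k + S l)%nat by lia; exact (IH k (S l) _ _ hw1 hs2).
Qed.

Lemma sym_scal m k c F : sym g g1 m k F -> sym g g1 m k (fun s => c * F s).
Proof.
  intros hF; apply (sym_mult m 0 k (fun _ => c) F); [| assumption].
  apply sym_const; now right.
Qed.

Lemma sym_scale m : forall k F,
  sym g g1 m (S k) F -> sym g g1 m k (fun s => g s * F s).
Proof.
  induction m as [| m IH]; intros k F hF;
    (split; [apply ev_bounded_scale; eapply sym_bounded; eassumption |]); auto.
  pose proof (sym_weaken _ _ _ hF) as hw.
  destruct hF as [_ [E [hE hs]]].
  exists (fun s => F s + g s * E s); split.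
  - apply (ev_imp2 _ _ _ g_derive hE); intros s d1 d2.
    replace (g1 s * (F s + g s * E s)) with (g1 s * F s + g s * (g1 s * E s)) by ring.
    apply (is_derive_mult g F); auto; intros; apply Rmult_comm.
  - apply sym_plus; auto.
Qed.

Lemma sym_inv_g m : sym g g1 m 1 (fun s => / g s).
Proof.
  assert (hb : ev_bounded g 1 (fun s => / g s)).
  { exists 1; split; [lra |].
    apply (ev_imp _ _ g_ge1); intros s hs.
    rewrite Rabs_pos_eq; [lra | apply Rlt_le, Rinv_0_lt_compat; lra]. }
  induction m as [| m IH]; split; auto.
  exists (fun s => -1 * (/ g s * / g s)); split.
  - apply (ev_imp2 _ _ _ g_derive g_ge1); intros s d hs.
    replace (g1 s * (-1 * (/ g s * / g s))) with (- g1 s / g s ^ 2) by (field; lra).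
    apply is_derive_inv; [assumption | lra].
  - apply sym_scal, (sym_mult m 1 1); assumption.
Qed.

Lemma sym_inv m c F :
  0 < c -> ev (fun s => c <= F s) -> sym g g1 m 0 F -> sym g g1 m 0 (fun s => / F s).
Proof.
  intros hc hlow.
  assert (hb : ev_bounded g 0 (fun s => / F s)).
  { exists (/ c); split; [now apply Rlt_le, Rinv_0_lt_compat |].
    apply (ev_imp _ _ hlow); intros s hs; simpl.
    rewrite Rabs_pos_eq; [| apply Rlt_le, Rinv_0_lt_compat; lra].
    rewrite Rmult_1_r; apply Rinv_le_contravar; lra. }
  induction m as [| m IH]; intros hF; split; auto.
  specialize (IH (sym_weaken _ _ _ hF)).
  destruct hF as [_ [E [hE hs]]].
  exists (fun s => -1 * (E s * (/ F s * / F s))); split.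
  - apply (ev_imp2 _ _ _ hE hlow); intros s d hl.
    replace (g1 s * (-1 * (E s * (/ F s * / F s))))
      with (- (g1 s * E s) / F s ^ 2) by (field; lra).
    apply is_derive_inv; [assumption | lra].
  - apply sym_scal, (sym_mult m 1 0); [assumption |].
    now apply (sym_mult m 0 0).
Qed.

End Symbols.

(** * Consequences of (G1) and (G2) *)

(** [K1 = dH/dv] and [K2 = d^2 H/dv^2] for [v = g s].  If [K1 > d / v] at [s],
    then [K2 = O(1 / v^2)] keeps [K1 > d / (2 v)] on [v, (1 + th) v], so [H]
    would grow there by at least [d th / 2], although it converges. *)
Lemma landau_upper (g g1 H K1 K2 : R -> R) (l C : R) :
  0 <= C ->
  ev (fun s => is_derive g s (g1 s)) -> ev (fun s => 0 < g1 s) ->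
  (forall M, ev (fun s => M < g s)) ->
  is_lim H p_infty l ->
  ev (fun s => is_derive H s (g1 s * K1 s)) ->
  ev (fun s => is_derive K1 s (g1 s * K2 s)) ->
  ev (fun s => Rabs (K2 s) <= C * (/ g s) ^ 2) ->
  forall d, 0 < d -> ev (fun s => g s * K1 s <= d).
Proof.
  intros hC hg hg1 hinf hlim hH hK hb d hd.
  (* With [C * th <= d / 2], the total variation of [K1] while [g] runs from [v] to [(1 + th) v] is
     at most [C / v^2 * th v <= d / (2 v)]. *)
  set (th := d / (2 * (C + 1))).
  assert (hth : 0 < th) by (apply Rdiv_lt_0_compat; lra).
  assert (hCth : C * th <= d / 2).
  { unfold th; replace (C * (d / (2 * (C + 1)))) with (d / 2 * (C / (C + 1))) by (field; lra).
    rewrite <- (Rmult_1_r (d / 2)) at 2; apply Rmult_le_compat_l; [lra |].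
    apply Rmult_le_reg_r with (C + 1); [lra |].
    unfold Rdiv; rewrite Rmult_assoc, Rinv_l; lra. }
  assert (hdth : 0 < d * th) by now apply Rmult_lt_0_compat.
  (* Two values of [H] then differ by less than [d * th / 4], half of the growth [d * th / 2]
     obtained below. *)
  assert (hlim' : ev (fun s => Rabs (H s - l) < d * th / 8)).
  { apply is_lim_spec in hlim.
    assert (h8 : 0 < d * th / 8) by lra.
    exact (hlim (mkposreal _ h8)). }
  pose proof (ev_and _ _ (ev_and _ _ hg hg1) (ev_and _ _ (ev_and _ _ hH hK)
    (ev_and _ _ hb (ev_and _ _ hlim' (hinf 0)))))
    as [M hM].
  exists M; intros s hs.
  destruct (hM s hs) as [_ [_ [_ [hHs hgs]]]].
  destruct (Rle_dec (g s * K1 s) d) as [| hn]; [assumption | exfalso].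
  destruct (ev_choose _ s (hinf ((1 + th) * g s))) as [b [hb1 hb2]].
  specialize (hb2 b (Rle_refl _)).
  destruct (IVT_value g s b ((1 + th) * g s)) as [s2 [hs2 hgs2]]; [lra | | nra |].
  { intros x hx; apply (ex_derive_continuous g); exists (g1 x); apply hM; lra. }
  assert (hmono : forall x y, s <= x <= y -> g x <= g y).
  { intros x y hxy.
    assert (h := increment_le g g1 x y 0); enough (0 * (y - x) <= g y - g x) by lra.
    apply h; [lra | |]; intros z hz; [apply hM; lra |].
    apply Rlt_le, hM; lra. }
  set (v := g s) in *.
  set (e := C * (/ v) ^ 2).
  assert (hv2 : e * (th * v) <= d / 2 / v).
  { unfold e; replace (C * (/ v) ^ 2 * (th * v)) with (C * th / v) by (field; lra).
    apply Rmult_le_compat_r; [| assumption].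
    now apply Rlt_le, Rinv_0_lt_compat. }
  assert (he : 0 <= e).
  { apply Rmult_le_pos; [assumption | apply pow_le].
    now apply Rlt_le, Rinv_0_lt_compat. }
  assert (hd1 : d / v <= K1 s).
  { apply Rmult_le_reg_r with v; [assumption |].
    unfold Rdiv; rewrite Rmult_assoc, Rinv_l; lra. }
  assert (hKx : forall x, s <= x <= s2 -> d / 2 / v <= K1 x).
  { intros x hx.
    (* Monotonicity of [K1 + e g] expresses [dK1/dv >= - e] without changing the variable to [v];
       [H - d / (2 v) * g] is used in the same way afterwards. *)
    assert (h : 0 * (x - s) <= K1 x + e * g x - (K1 s + e * g s)).
    { apply (increment_le (fun y => K1 y + e * g y) (fun y => g1 y * K2 y + e * g1 y));
        [lra | |]; intros y hy.
      - apply (is_derive_plus K1 (fun y => e * g y)); [apply hM; lra |].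
        apply is_derive_scal; apply hM; lra.
      - destruct (hM y) as [[_ hy1] [_ [hy2 _]]]; [lra |].
        assert (hgy : v <= g y) by (apply hmono; lra).
        assert (hey : - e <= K2 y).
        { assert (Rabs (K2 y) <= e).
          { apply Rle_trans with (1 := hy2); apply Rmult_le_compat_l; [assumption |].
            apply pow_incr; split; [apply Rlt_le, Rinv_0_lt_compat; lra |].
            apply Rinv_le_contravar; lra. }
          pose proof (Rabs_maj2 (K2 y)); lra. }
        nra. }
    fold v in h.
    assert (hgx : g x <= (1 + th) * v) by (rewrite <- hgs2; apply hmono; lra).
    assert (e * (g x - v) <= e * (th * v)) by (apply Rmult_le_compat_l; lra).
    replace (d / v) with (d / 2 / v + d / 2 / v) in hd1 by (field; lra); lra. }
  assert (hHH : 0 * (s2 - s) <= (H s2 - d / 2 / v * g s2) - (H s - d / 2 / v * g s)).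
  { apply (increment_le (fun y => H y - d / 2 / v * g y)
      (fun y => g1 y * K1 y - d / 2 / v * g1 y)); [lra | |]; intros y hy.
    - apply (is_derive_minus H (fun y => d / 2 / v * g y)); [apply hM; lra |].
      apply is_derive_scal; apply hM; lra.
    - specialize (hKx y hy); destruct (hM y) as [[_ hy1] _]; [lra |]; nra. }
  rewrite hgs2 in hHH; fold v in hHH.
  replace (0 * (s2 - s)) with 0 in hHH by ring.
  replace (H s2 - d / 2 / v * ((1 + th) * v) - (H s - d / 2 / v * v))
    with (H s2 - H s - d * th / 2) in hHH by (field; lra).
  destruct (hM s2) as [_ [_ [_ [hHs2 _]]]]; [lra |].
  apply Rabs_def2 in hHs; apply Rabs_def2 in hHs2; lra.
Qed.

(** Landau interpolation in the variable [v]: convergence of [H] and the bound on the second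
    derivative force the scaled first derivative to zero. The lower bound is the upper one for
    [- H]. *)
Lemma landau (g g1 H K1 K2 : R -> R) (l C : R) :
  0 <= C ->
  ev (fun s => is_derive g s (g1 s)) -> ev (fun s => 0 < g1 s) ->
  (forall M, ev (fun s => M < g s)) ->
  is_lim H p_infty l ->
  ev (fun s => is_derive H s (g1 s * K1 s)) ->
  ev (fun s => is_derive K1 s (g1 s * K2 s)) ->
  ev (fun s => Rabs (K2 s) <= C * (/ g s) ^ 2) ->
  forall d, 0 < d -> ev (fun s => Rabs (g s * K1 s) <= d).
Proof.
  intros hC hg hg1 hinf hlim hH hK hb d hd.
  assert (h1 := landau_upper g g1 H K1 K2 l C hC hg hg1 hinf hlim hH hK hb d hd).
  assert (h2 : ev (fun s => g s * - K1 s <= d)).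
  { apply (landau_upper g g1 (fun s => - H s) _ (fun s => - K2 s) (- l) C); auto.
    - apply (is_lim_opp H p_infty l hlim).
    - apply (ev_imp _ _ hH); intros s h.
      rewrite Ropp_mult_distr_r_reverse; now apply (is_derive_opp H).
    - apply (ev_imp _ _ hK); intros s h.
      rewrite Ropp_mult_distr_r_reverse; now apply (is_derive_opp K1).
    - apply (ev_imp _ _ hb); intros s h; now rewrite Rabs_Ropp. }
  apply (ev_imp2 _ _ _ h1 h2); intros s h3 h4; apply Rabs_le; lra.
Qed.

(** Comparison with [/ (b * u)], whose primitive is logarithmic. This is how integrability in (G1)
    acts: it forbids at most linear growth of [g], which yields both [g -> +oo] and [q > 0]. *)
Lemma inv_integrable_superlinear (g : R -> R) (s b : R) :
  0 < s -> 0 < b -> (forall x, s <= x -> 0 < g x <= b * x) ->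
  ~ ex_RInt_gen (fun u => / g u) (at_point s) (Rbar_locally p_infty).
Proof.
  intros hs hb hle [l hl].
  destruct (hl (ball l 1)) as [Q S hQ [M hS] h].
  { exists (mkposreal 1 Rlt_0_1); auto. }
  (* Beyond [exp L] the comparison gives [b * I >= b * (l + 1) + 1], against [I < l + 1]. *)
  set (L := b * (l + 1) + ln s + 1).
  set (y := Rmax (M + 1) (Rmax s (exp L))).
  assert (hy1 : M + 1 <= y) by apply Rmax_l.
  assert (hy2 : s <= y) by (eapply Rle_trans; [apply Rmax_l | apply Rmax_r]).
  assert (hy3 : exp L <= y) by (eapply Rle_trans; [apply Rmax_r | apply Rmax_r]).
  destruct (h s y hQ) as [I [hI hball]]; [apply hS; lra |]; simpl in hI.
  assert (hI2 : is_RInt (fun u => / (b * u)) s y (minus (/ b * ln y) (/ b * ln s))).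
  { apply (is_RInt_derive (fun u => / b * ln u) (fun u => / (b * u))).
    - intros x hx; rewrite Rmin_left in hx by lra.
      auto_derive; [lra | field; lra].
    - intros x hx; rewrite Rmin_left in hx by lra.
      apply (ex_derive_continuous (fun u => / (b * u))); auto_derive; nra. }
  assert (hle2 : minus (/ b * ln y) (/ b * ln s) <= I).
  { apply (is_RInt_le (fun u => / (b * u)) (fun u => / g u) s y); auto.
    intros x hx; destruct (hle x) as [h1 h2]; [lra |].
    apply Rinv_le_contravar; assumption. }
  unfold minus, plus, opp in hle2; simpl in hle2.
  assert (hIl : I < l + 1).
  { unfold ball in hball; simpl in hball; unfold AbsRing_ball, abs, minus, plus, opp in hball.
    simpl in hball; apply Rabs_def2 in hball; lra. }
  assert (hlny : L <= ln y).
  { rewrite <- (ln_exp L); apply ln_le; [apply exp_pos | assumption]. }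
  assert (ln y - ln s <= b * I).
  { apply Rmult_le_compat_l with (r := b) in hle2; [| lra].
    replace (b * (/ b * ln y + - (/ b * ln s))) with (ln y - ln s) in hle2
      by (field; lra); assumption. }
  unfold L in hlny; nra.
Qed.

(** Existential derivatives make closure under products and inverses a plain induction, with no
    Leibniz formula; [smooth_derive_n] returns to [Derive_n]. *)
Fixpoint smooth (a : R) (m : nat) (F : R -> R) : Prop :=
  match m with
  | O => True
  | S m' => exists F', (forall s, a < s -> is_derive F s (F' s)) /\ smooth a m' F'
  end.

Lemma smooth_weaken a m : forall F, smooth a (S m) F -> smooth a m F.
Proof.
  induction m as [| m IH]; intros F h; [exact I |].
  destruct h as [F' [h1 h2]]; exists F'; auto.
Qed.

Lemma smooth_const a m : forall c, smooth a m (fun _ => c).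
Proof.
  induction m as [| m IH]; intros c; [exact I |].
  exists (fun _ => 0); split; [| apply IH].
  intros s _; apply (is_derive_const c s).
Qed.

Lemma smooth_plus a m : forall F1 F2,
  smooth a m F1 -> smooth a m F2 -> smooth a m (fun s => F1 s + F2 s).
Proof.
  induction m as [| m IH]; intros F1 F2; [auto |].
  intros [E1 [h1 h2]] [E2 [h3 h4]].
  exists (fun s => E1 s + E2 s); split; [| auto].
  intros s hs; apply (is_derive_plus F1 F2); auto.
Qed.

Lemma smooth_mult a m : forall F1 F2,
  smooth a m F1 -> smooth a m F2 -> smooth a m (fun s => F1 s * F2 s).
Proof.
  induction m as [| m IH]; intros F1 F2; [auto |].
  intros hF1 hF2.
  pose proof (smooth_weaken _ _ _ hF1); pose proof (smooth_weaken _ _ _ hF2).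
  destruct hF1 as [E1 [h1 h2]], hF2 as [E2 [h3 h4]].
  exists (fun s => E1 s * F2 s + F1 s * E2 s); split.
  - intros s hs; apply (is_derive_mult F1 F2); auto; intros; apply Rmult_comm.
  - apply smooth_plus; auto.
Qed.

Lemma smooth_inv a m F :
  (forall s, a < s -> F s <> 0) -> smooth a m F -> smooth a m (fun s => / F s).
Proof.
  intros hne; induction m as [| m IH]; intros hF; [exact I |].
  specialize (IH (smooth_weaken _ _ _ hF)).
  destruct hF as [E [h1 h2]].
  exists (fun s => -1 * (E s * (/ F s * / F s))); split.
  - intros s hs.
    replace (-1 * (E s * (/ F s * / F s))) with (- E s / F s ^ 2)
      by (field; now apply hne).
    apply is_derive_inv; auto.
  - auto using smooth_mult, smooth_const.
Qed.

Lemma smooth_derive_n a m : forall F k s,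
  smooth a m F -> (k < m)%nat -> a < s ->
  is_derive (Derive_n F k) s (Derive_n F (S k) s).
Proof.
  induction m as [| m IH]; intros F k s hF hk hs; [lia |].
  destruct hF as [F' [h1 h2]].
  apply Derive_correct; destruct k as [| k].
  - exists (F' s); auto.
  - assert (hloc : forall x, a < x -> Derive_n F (S k) x = Derive_n F' k x).
    { intros x hx; replace (S k) with (k + 1)%nat by lia.
      rewrite <- (Derive_n_comp F k 1).
      apply Derive_n_ext_loc.
      apply (filter_imp (fun y => a < y)); [| now apply open_gt].
      intros y hy; now apply is_derive_unique, h1. }
    apply (ex_derive_ext_loc (Derive_n F' k)).
    + apply (filter_imp (fun y => a < y)); [| now apply open_gt].
      intros y hy; now rewrite hloc.
    + exists (Derive_n F' (S k) s); apply IH; auto; lia.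
Qed.

Lemma Ck_smooth a k g : Ck_beyond a k g ->
  forall i m, (i + m <= k)%nat -> smooth a m (Derive_n g i).
Proof.
  intros h i m; revert i; induction m as [| m IH]; intros i him; [exact I |].
  exists (Derive_n g (S i)); split.
  - intros s hs; apply Derive_correct.
    apply (proj1 (h (S i) s ltac:(lia) hs)).
  - apply IH; lia.
Qed.

(** The definition of [H], read as [g'' = H / g * g'^2], closes the differential system: every later
    derivative is expressed by [g], [g1], [H] and derivatives of [H] in [v]. The bounds of (G2)
    concern derivatives in [s] and must first be converted to derivatives in [v]. *)
Lemma G1_G2_facts (g : R -> R) (q : R) : G1 g q -> G2 g ->
  let g1 := Derive g in
  let H := Hfun g in
  let K1 := fun s => Derive H s / g1 s in
  0 < q /\ (exists s0, 0 < s0 /\ forall s, s0 < s -> is_derive g s (g1 s) /\ 0 < g1 s) /\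
  (forall M, ev (fun s => M < g s)) /\
  ev (fun s => is_derive g1 s (H s / g s * g1 s ^ 2)) /\
  is_lim H p_infty (1 / q) /\ sym g g1 3 0 H /\
  ev (fun s => is_derive H s (g1 s * K1 s)) /\ sym g g1 2 1 K1 /\
  (forall d, 0 < d -> ev (fun s => Rabs (g s * K1 s) <= d)).
Proof.
  intros [[M0 hG] [hq hlim]] [C [s0 [hC [hs0 [hCk hbd]]]]] g1 H K1.
  (* Beyond [1], constant and affine upper bounds for [g] can be written as [b * x], the form
     excluded by integrability. *)
  set (s1 := Rmax 1 (Rmax s0 M0)).
  assert (hs1 : 1 <= s1 /\ s0 <= s1 /\ M0 <= s1).
  { pose proof (Rmax_l 1 (Rmax s0 M0)); pose proof (Rmax_r 1 (Rmax s0 M0)).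
    pose proof (Rmax_l s0 M0); pose proof (Rmax_r s0 M0); unfold s1; lra. }
  assert (hCk1 : Ck_beyond s1 5 g) by (intros j x hj hx; apply hCk; [assumption | lra]).
  clear hCk; rename hCk1 into hCk.
  assert (hgpos : forall s, s1 < s -> 0 < g s) by (intros s hs; apply hG; lra).
  pose proof (Ck_smooth _ _ _ hCk) as hsm.
  assert (hgs : smooth s1 5 g) by (apply (hsm 0%nat 5%nat); lia).
  assert (hdg : forall s, s1 < s -> is_derive g s (g1 s)).
  { intros s hs; apply (smooth_derive_n s1 5 g 0 s); auto; lia. }
  assert (hdg1 : forall s, s1 < s -> is_derive g1 s (Derive_n g 2 s)).
  { intros s hs; apply (smooth_derive_n s1 5 g 1 s); auto; lia. }
  (* The strict bound of (G2) with [k = 1] forces [g' / g > 0]. *)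
  assert (hg1 : forall s, s1 < s -> 0 < g1 s).
  { intros s hs.
    pose proof (hgpos s hs) as hp.
    assert (h := hbd 1%nat s ltac:(lia) ltac:(lra)); rewrite pow_1 in h.
    assert (h0 : 0 < C * (g1 s / g s)) by (eapply Rle_lt_trans; [apply Rabs_pos | exact h]).
    replace (g1 s) with (C * (g1 s / g s) * (g s / C)) by (field; lra).
    apply Rmult_lt_0_compat; [assumption | apply Rdiv_lt_0_compat; assumption]. }
  assert (hmono : forall x y, s1 < x -> x <= y -> g x <= g y).
  { intros x y hx hxy.
    enough (0 * (y - x) <= g y - g x) by lra.
    apply (increment_le g g1); auto; intros z hz; [apply hdg | apply Rlt_le, hg1]; lra. }
  assert (hnolin : forall b s2, s1 < s2 -> 0 < b -> ~ (forall x, s2 <= x -> g x <= b * x)).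
  { intros b s2 hs2 hb hle.
    apply (inv_integrable_superlinear g s2 b); [lra | assumption | |].
    - intros x hx; split; [apply hgpos; lra | auto].
    - apply hG; lra. }
  assert (hinf : forall M, ev (fun s => M < g s)).
  { intros M.
    destruct (classic (exists x, s1 < x /\ M < g x)) as [[x [hx1 hx2]] | hn].
    - exists x; intros s hs; apply Rlt_le_trans with (1 := hx2); apply hmono; lra.
    - exfalso; apply (hnolin (Rabs M + 1) (s1 + 1)); [lra | pose proof (Rabs_pos M); lra |].
      intros x hx; apply Rle_trans with M.
      + apply Rnot_lt_le; intros h; apply hn; exists x; split; [lra | assumption].
      + pose proof (Rle_abs M); pose proof (Rabs_pos M).
        nra. }
  assert (hHdef : forall s, s1 < s -> Derive_n g 2 s = H s / g s * g1 s ^ 2).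
  { intros s hs; pose proof (hgpos s hs); pose proof (hg1 s hs).
    unfold H, Hfun; fold (g1 s); field; split; apply Rgt_not_eq; assumption. }
  assert (hge1 : ev (fun s => 1 <= g s)).
  { apply (ev_imp _ _ (hinf 1)); intros; lra. }
  assert (hdgev : ev (fun s => is_derive g s (g1 s))).
  { exists s1; exact hdg. }
  assert (hHs : smooth s1 3 H).
  { unfold H, Hfun, Rdiv; apply smooth_mult; [apply smooth_mult |].
    - apply smooth_weaken, smooth_weaken, hgs.
    - apply (hsm 2%nat 3%nat); lia.
    - apply smooth_inv.
      + intros s hs; apply pow_nonzero, Rgt_not_eq, hg1, hs.
      + assert (smooth s1 3 g1) by (apply smooth_weaken, (hsm 1%nat 4%nat); lia).
        exact (smooth_mult _ _ _ _ H0 (smooth_mult _ _ _ _ H0 (smooth_const _ _ 1))). }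
  (* If [1 / q < 0], then [g] is eventually concave, so at most linear, and
     [1 / g] is not integrable. *)
  assert (hqpos : 0 < q).
  { destruct (Rlt_le_dec 0 q) as [| hneg]; [assumption | exfalso].
    assert (hk : 1 / q < 0) by (apply Rdiv_pos_neg; lra).
    assert (hH : ev (fun s => H s < 0)).
    { apply is_lim_spec in hlim.
      assert (h8 : 0 < - (1 / q)) by lra.
      destruct (hlim (mkposreal _ h8)) as [M h]; exists M; intros x hx.
      specialize (h x hx); simpl in h; apply Rabs_def2 in h; fold H in h; lra. }
    destruct (ev_choose _ s1 hH) as [s2 [hs2 hHs2]].
    assert (hg1le : forall x, s2 <= x -> g1 x <= g1 s2).
    { intros x hx; enough (g1 x - g1 s2 <= 0 * (x - s2)) by lra.
      apply (increment_ge g1 (Derive_n g 2)); auto; intros z hz; [apply hdg1; lra |].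
      rewrite hHdef by lra.
      assert (hgz : 0 < g z) by (apply hgpos; lra).
      assert (hHz : H z < 0) by (apply hHs2; lra).
      assert (h1 : H z / g z < 0) by now apply Rdiv_neg_pos.
      pose proof (pow2_ge_0 (g1 z)); nra. }
    assert (hg1s2 : 0 < g1 s2) by (apply hg1; lra).
    assert (hgs2 : 0 < g s2) by (apply hgpos; lra).
    apply (hnolin (g s2 + g1 s2) s2); [lra | lra |].
    intros x hx; enough (g x - g s2 <= g1 s2 * (x - s2)) by nra.
    apply (increment_ge g g1); auto; intros z hz; [apply hdg | apply hg1le]; lra. }
  (* [A k = H^(k) / (g')^k] differs from the [k]-th derivative of [H] in [v]
     by lower order terms only. *)
  set (h := Derive_n H).
  assert (hdh : forall k s, (k < 3)%nat -> s1 < s -> is_derive (h k) s (h (S k) s)).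
  { intros k s hk hs; now apply (smooth_derive_n s1 3). }
  set (A := fun k s => h k s / g1 s ^ k).
  assert (hA : forall k, (1 <= k <= 3)%nat -> ev_bounded g k (A k)).
  { intros k hk; exists C; split; [lra |]; exists s1; intros s hs.
    pose proof (hgpos s hs); pose proof (hg1 s hs).
    assert (hb := hbd k s hk ltac:(lra)); fold H h g1 in hb.
    assert (hp : 0 < g1 s ^ k) by now apply pow_lt.
    unfold A, Rdiv; rewrite Rabs_mult, Rabs_inv, (Rabs_pos_eq (g1 s ^ k)) by lra.
    apply Rmult_le_reg_r with (g1 s ^ k); [assumption |].
    rewrite Rmult_assoc, Rinv_l, Rmult_1_r by lra.
    apply Rlt_le, Rlt_le_trans with (1 := hb).
    unfold Rdiv; rewrite Rpow_mult_distr; lra. }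
  assert (hdA : forall k, (1 <= k <= 2)%nat ->
    ev (fun s => is_derive (A k) s (g1 s * (A (S k) s + - INR k * (A k s * (H s * / g s)))))).
  { intros k hk; exists s1; intros s hs.
    pose proof (hgpos s hs); pose proof (hg1 s hs).
    assert (hp : g1 s ^ k <> 0) by now apply pow_nonzero, Rgt_not_eq.
    assert (hd1 : is_derive g1 s (H s / g s * g1 s ^ 2)) by (rewrite <- hHdef; auto).
    assert (hd2 : is_derive (fun x => g1 x ^ k) s
      (INR k * (H s / g s * g1 s ^ 2) * g1 s ^ pred k)) by (apply is_derive_pow; auto).
    assert (hd3 := is_derive_div (h k) (fun x => g1 x ^ k) s _ _
      (hdh k s ltac:(lia) hs) hd2 hp).
    replace (g1 s * (A (S k) s + - INR k * (A k s * (H s * / g s)))) with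
      (((h (S k) s) * g1 s ^ k - h k s * (INR k * (H s / g s * g1 s ^ 2) * g1 s ^ pred k))
        / (g1 s ^ k) ^ 2); [exact hd3 |].
    unfold A; destruct k as [| k]; [lia |]; simpl pred.
    assert (g1 s ^ k <> 0) by now apply pow_nonzero, Rgt_not_eq.
    simpl pow; field; repeat split; auto using Rgt_not_eq. }
  assert (hsy0 : forall k, (1 <= k <= 3)%nat -> sym g g1 0 k (A k)).
  { intros k hk; split; [now apply hA | exact I]. }
  assert (hHb : sym g g1 0 0 H).
  { split; [| exact I]; exists (Rabs (1 / q) + 1).
    split; [pose proof (Rabs_pos (1 / q)); lra |].
    apply is_lim_spec in hlim.
    destruct (hlim (mkposreal 1 Rlt_0_1)) as [M hM]; exists M; intros s hs.
    specialize (hM s hs); simpl in hM |- *.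
    replace (H s) with (1 / q + (H s - 1 / q)) by ring.
    rewrite Rmult_1_r; apply Rabs_sum_le; [apply Rle_refl | apply Rlt_le, hM]. }
  assert (hdH : ev (fun s => is_derive H s (g1 s * K1 s))).
  { exists s1; intros s hs.
    pose proof (hg1 s hs).
    unfold K1; replace (g1 s * (Derive H s / g1 s)) with (Derive H s)
      by (field; now apply Rgt_not_eq).
    apply (hdh 0%nat s); [lia | assumption]. }
  assert (hK1A : forall s, A 1%nat s = K1 s).
  { intros s; unfold A, K1; rewrite pow_1; reflexivity. }
  (* One more derivative of [A k] costs one of [A (S k)], [A k] and [H]; one more of [H] costs one
     of [A 1]. Alternating the two rules climbs from bare bounds to one derivative of [A 2], two of
     [A 1] and three of [H]. *)
  assert (hstep : forall m k, (1 <= k <= 2)%nat -> sym g g1 m 0 H ->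
    sym g g1 m k (A k) -> sym g g1 m (S k) (A (S k)) -> sym g g1 (S m) k (A k)).
  { intros m k hk h1 h2 h3; split; [apply hA; lia |].
    exists (fun s => A (S k) s + - INR k * (A k s * (H s * / g s))); split; [now apply hdA |].
    apply sym_plus; [assumption |].
    apply sym_scal; [assumption |].
    replace (S k) with (k + (0 + 1))%nat by lia.
    apply sym_mult; [assumption |].
    apply sym_mult; [assumption |].
    now apply sym_inv_g. }
  assert (hstepH : forall m, sym g g1 m 1 (A 1%nat) -> sym g g1 (S m) 0 H).
  { intros m hm; split; [exact (sym_bounded _ _ _ _ _ hHb) |].
    exists K1; split; [assumption |].
    apply (sym_ext _ _ m 1 (A 1%nat)); [exists 0; auto | assumption]. }
  assert (sA12 : sym g g1 1 2 (A 2%nat)).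
  { apply hstep; [lia | assumption | apply hsy0; lia | apply hsy0; lia]. }
  assert (sA11 : sym g g1 1 1 (A 1%nat)).
  { apply hstep; [lia | assumption | apply hsy0; lia | apply hsy0; lia]. }
  assert (sH1 : sym g g1 1 0 H) by (apply hstepH, hsy0; lia).
  assert (sA21 : sym g g1 2 1 (A 1%nat)) by (apply hstep; [lia | assumption ..]).
  assert (sK : sym g g1 2 1 K1).
  { apply (sym_ext _ _ _ _ (A 1%nat)); [exists 0; auto | assumption]. }
  split; [assumption |].
  split; [exists s1; split; [lra | split; auto] |].
  split; [assumption |].
  split; [exists s1; intros s hs; rewrite <- hHdef; auto |].
  split; [assumption |]; split; [now apply hstepH |].
  split; [assumption |]; split; [assumption |].
  destruct sK as [_ [K2 [hK2 hs2]]].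
  destruct (sym_bounded _ _ _ _ _ hs2) as [C2 [hC2 hb2]].
  apply (landau g g1 H K1 K2 (1 / q) C2); auto.
  exists s1; auto.
Qed.

(** * The approximate solution *)

(** This is [ln (- 4 u'')] for [u = g^(-1)(t)], because there
    [u'' = - g'' / g'^3 = - H / (g g')]. *)
Definition correction (g g1 H : R -> R) (s : R) : R :=
  ln 4 + ln (H s) - ln (g s) - ln (g1 s).

(** [mu], [M1], [B], [B1] satisfy [(g - correction)' = g1 (1 + mu)],
    [mu' = g1 M1] and [B' = g1 B1]; the function [B] is the relative residual
    of the approximate solution [s = u0 t] defined by [g s - correction s = t]. *)
Record tail_at (g g1 H K1 mu M1 B B1 : R -> R) (kappa C s : R) : Prop := {
  ta_pos : 0 < s;
  ta_g : is_derive g s (g1 s);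
  ta_g1 : is_derive g1 s (H s / g s * g1 s ^ 2);
  ta_g1_pos : 0 < g1 s;
  ta_ge1 : 1 <= g s;
  ta_H_bounds : kappa / 2 <= H s <= 2 * kappa;
  ta_H_small : H s / g s <= 1 / 10;
  ta_H : is_derive H s (g1 s * K1 s);
  ta_K1 : Rabs (g s * K1 s) <= kappa / 4;
  ta_theta : is_derive (fun x => g x - correction g g1 H x) s (g1 s * (1 + mu s));
  ta_mu_small : Rabs (mu s) <= 1 / 10;
  ta_mu_bound : Rabs (mu s) <= C / g s;
  ta_mu : is_derive mu s (g1 s * M1 s);
  ta_B_eq : B s = 1 - (/ (1 + mu s)) ^ 2 - g s * M1 s / H s * (/ (1 + mu s)) ^ 3;
  ta_B_bound : Rabs (B s) <= C / g s;
  ta_B : is_derive B s (g1 s * B1 s);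
  ta_B1 : Rabs (B1 s) <= C / g s ^ 2
}.

Ltac tail_facts h :=
  destruct h as [ta_pos ta_g ta_g1 ta_g1_pos ta_ge1 ta_H_bounds ta_H_small ta_H ta_K1
    ta_theta ta_mu_small ta_mu_bound ta_mu ta_B_eq ta_B_bound ta_B ta_B1].

(** The three derivatives of [H] are exactly consumed: [K1] keeps two, hence [mu] two, [M1] one and
    [B] one, so that [B1] is still bounded by [C / g^2]. All asymptotic statements are then frozen
    into pointwise inequalities beyond one threshold. *)
Lemma G1_G2_tail (g : R -> R) (q : R) : G1 g q -> G2 g ->
  let g1 := Derive g in
  let H := Hfun g in
  let K1 := fun s => Derive H s / g1 s in
  0 < q /\
  (forall M, ev (fun s => M < g s)) /\
  exists mu M1 B B1 C, 0 < C /\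
    ev (fun s => tail_at g g1 H K1 mu M1 B B1 (1 / q) C s).
Proof.
  intros hG1 hG2 g1 H K1.
  destruct (G1_G2_facts g q hG1 hG2) as
    [hq [[s0 [hs0 hpos]] [hinf [hdg1 [hlim [hH3 [hdH [hK2 hK1]]]]]]]].
  fold g1 in hpos, hdg1, hH3, hdH, hK2, hK1; fold H in hdg1, hlim, hH3, hdH, hK2, hK1.
  fold K1 in hdH, hK2, hK1.
  set (k := 1 / q) in *.
  assert (hk : 0 < k) by (apply Rdiv_lt_0_compat; lra).
  split; [assumption |]; split; [assumption |].
  assert (hg : ev (fun s => is_derive g s (g1 s))) by (exists s0; intros; now apply hpos).
  assert (hg1 : ev (fun s => 0 < g1 s)) by (exists s0; intros; now apply hpos).
  assert (hge : ev (fun s => 1 <= g s)) by (apply (ev_imp _ _ (hinf 1)); intros; lra).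
  assert (hHb : ev (fun s => k / 2 <= H s <= 2 * k)).
  { apply is_lim_spec in hlim.
    assert (h8 : 0 < k / 2) by lra.
    destruct (hlim (mkposreal _ h8)) as [M h]; exists M; intros x hx.
    specialize (h x hx); simpl in h; apply Rabs_def2 in h; lra. }
  assert (hHi : sym g g1 3 0 (fun s => / H s)).
  { apply (sym_inv _ _ hge 3 (k / 2)); [lra | | assumption].
    apply (ev_imp _ _ hHb); intros; lra. }
  (* The logarithmic derivatives in [v] of [g], [g1] and [H], with the signs they get from
     subtracting the correction. *)
  set (mu := fun s => / g s + H s * / g s + -1 * (K1 s * / H s)).
  assert (hmu : sym g g1 2 1 mu).
  { apply sym_plus; [apply sym_plus |].
    - now apply sym_inv_g.
    - apply (sym_mult _ _ 2 0 1); [now apply sym_weaken | now apply sym_inv_g].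
    - apply sym_scal; [assumption |].
      apply (sym_mult _ _ 2 1 0); [assumption | now apply sym_weaken]. }
  assert (hmu' := hmu); destruct hmu' as [[Cm [hCm hmb]] [M1 [hdmu hM1]]].
  assert (hms : ev (fun s => Rabs (mu s) <= 1 / 10)).
  { apply (ev_imp2 _ _ _ hmb (hinf (10 * Cm + 1))); intros s h1 h2.
    apply Rle_trans with (1 := h1); rewrite pow_1.
    apply Rmult_le_reg_r with (g s); [lra |].
    rewrite Rmult_assoc, Rinv_l; lra. }
  set (i1 := fun s => / (1 + mu s)).
  assert (hi1 : sym g g1 2 0 i1).
  { apply (sym_inv _ _ hge 2 (1 / 2)); [lra | |].
    - apply (ev_imp _ _ hms); intros s h; pose proof (Rabs_maj2 (mu s)); lra.
    - apply sym_plus; [apply (sym_const _ _ hge); auto | now apply sym_lower]. }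
  apply sym_weaken in hi1.
  (* Writing [1 - i1^2] as [(2 mu + mu^2) i1^2] displays the factor of order [1 / v]. *)
  set (B := fun s => (2 * mu s + mu s * mu s) * (i1 s * i1 s)
                     + -1 * (g s * M1 s * / H s * (i1 s * (i1 s * i1 s)))).
  assert (hi2 : sym g g1 1 0 (fun s => i1 s * i1 s)) by now apply (sym_mult _ _ 1 0 0).
  assert (hB : sym g g1 1 1 B).
  { apply sym_weaken in hmu; do 2 apply sym_weaken in hHi.
    apply sym_plus.
    - apply (sym_mult _ _ 1 1 0); [| assumption].
      apply sym_plus; [now apply sym_scal |].
      apply sym_lower; [assumption |]; now apply (sym_mult _ _ 1 1 1).
    - apply sym_scal; [assumption |].
      apply (sym_mult _ _ 1 1 0); [| now apply (sym_mult _ _ 1 0 0)].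
      apply (sym_mult _ _ 1 1 0); [| assumption].
      now apply sym_scale. }
  destruct hB as [[CB [hCB hBb]] [B1 [hdB [[CB1 [hCB1 hB1]] _]]]].
  exists mu, M1, B, B1, (Cm + CB + CB1 + 1); split; [lra |].
  assert (hk4 : 0 < k / 4) by lra.
  pose proof (ev_and _ _ (ev_and _ _ hg hdg1) (ev_and _ _ hg1 hge)) as e1.
  pose proof (ev_and _ _ (ev_and _ _ hHb hdH) (ev_and _ _ (hK1 _ hk4) hmb)) as e2.
  pose proof (ev_and _ _ (ev_and _ _ hms hdmu) (ev_and _ _ hBb hdB)) as e3.
  (* Together with [H <= 2 k], [g > 20 k] yields [H / g <= 1 / 10]. *)
  pose proof (ev_and _ _ hB1 (ev_and _ _ (hinf (20 * k)) (ev_beyond 0))) as e4.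
  apply (ev_imp2 _ _ _ (ev_and _ _ e1 e2) (ev_and _ _ e3 e4)); clear e1 e2 e3 e4.
  intros s [[[d1 d2] [d3 d4]] [[d5 d6] [d7 d8]]] [[[d9 d10] [d11 d12]] [d13 [d14 d15]]].
  rewrite pow_1 in d8, d11.
  assert (hgi : 0 < / g s) by (apply Rinv_0_lt_compat; lra).
  assert (hHs : 0 < H s) by lra.
  assert (hms2 : 0 < 1 + mu s) by (pose proof (Rabs_maj2 (mu s)); lra).
  constructor; try assumption.
  - apply Rmult_le_reg_r with (g s); [lra |].
    unfold Rdiv; rewrite Rmult_assoc, Rinv_l; lra.
  - unfold correction.
    assert (d1' : ex_derive (fun x => g x) s) by (exists (g1 s); assumption).
    assert (d2' : ex_derive (fun x => g1 x) s) by (eexists; exact d2).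
    assert (d6' : ex_derive (fun x => H x) s) by (eexists; exact d6).
    auto_derive.
    { repeat split; auto; lra. }
    replace (Derive (fun x => g x) s) with (g1 s) by (symmetry; apply is_derive_unique, d1).
    replace (Derive (fun x => g1 x) s) with (H s / g s * g1 s ^ 2)
      by (symmetry; apply is_derive_unique, d2).
    replace (Derive (fun x => H x) s) with (g1 s * K1 s)
      by (symmetry; apply is_derive_unique, d6).
    unfold mu; field; lra.
  - apply Rle_trans with (1 := d8); apply Rmult_le_compat_r; lra.
  - unfold B, i1; field; lra.
  - apply Rle_trans with (1 := d11); apply Rmult_le_compat_r; lra.
  - apply Rle_trans with (1 := d13).
    unfold Rdiv; rewrite <- pow_inv; apply Rmult_le_compat_r; [| lra].
    apply pow_le; lra.
Qed.

(** The equation [u'' + F t u = 0] seen around an approximate solution [u0]: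
    [u0'' = - Q (J - p)] while [F t (u0 t) = Q J], so [- p] is the residual
    relative to the linearised frequency [Q], and [J] is the length scale on
    which [F t] varies; [G] plays the role of a clock comparable to [t]. *)
Record frame (F : R -> R -> R) (T c0 c1 Cp : R)
    (u0 v0 G G1 J Q Q1 p p1 : R -> R) : Prop := {
  fr_c0 : 0 < c0;
  fr_c1 : 0 < c1;
  fr_Cp : 0 < Cp;
  fr_u0 : forall t, T < t -> is_derive u0 t (v0 t);
  fr_v0 : forall t, T < t -> is_derive v0 t (- Q t * (J t - p t));
  fr_G : forall t, T < t -> is_derive G t (G1 t);
  fr_G1 : forall t, T < t -> 9 / 10 <= G1 t;
  fr_G_ge1 : forall t, T < t -> 1 <= G t;
  fr_J : forall t, T < t -> 0 < J t;
  fr_J_decr : forall t t', T < t -> t <= t' -> J t' <= J t;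
  fr_J_cont : forall t, T < t -> continuous J t;
  fr_Q : forall t, T < t -> is_derive Q t (Q1 t);
  fr_Q_bounds : forall t, T < t -> c0 <= Q t * G t <= c1;
  fr_Q1 : forall t, T < t -> Rabs (Q1 t) * G t <= 17 / 10 * Q t;
  fr_p : forall t, T < t -> is_derive p t (p1 t);
  fr_p_bound : forall t, T < t -> Rabs (p t) * G t <= Cp * J t;
  fr_p1_bound : forall t, T < t -> Rabs (p1 t) * G t ^ 2 <= Cp * J t;
  fr_F0 : forall t, T < t -> F t (u0 t) = Q t * J t;
  fr_F : forall t l z z', T < t -> 0 <= l <= 1 / 2 ->
    Rabs z <= l * J t -> Rabs z' <= l * J t ->
    Rabs (F t (u0 t + z) - Q t * z - (F t (u0 t + z') - Q t * z'))
      <= 4 * l * Q t * Rabs (z - z')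
}.

Ltac frame_facts h :=
  destruct h as [fr_c0 fr_c1 fr_Cp fr_u0 fr_v0 fr_G fr_G1 fr_G_ge1 fr_J fr_J_decr fr_J_cont
    fr_Q fr_Q_bounds fr_Q1 fr_p fr_p_bound fr_p1_bound fr_F0 fr_F].

Section Approx.

Variables (f g g1 H K1 mu M1 B B1 : R -> R) (kappa C s1 : R).
Hypothesis kappa_pos : 0 < kappa.
Hypothesis C_pos : 0 < C.
Hypothesis g_unbounded : forall M, ev (fun s => M < g s).
Hypothesis g_logf : forall s, g s = logf f s.
Hypothesis f_pos : forall s, 0 <= s -> 0 < f s.
Hypothesis tail : forall s, s1 <= s -> tail_at g g1 H K1 mu M1 B B1 kappa C s.

Let theta (s : R) : R := g s - correction g g1 H s.
Let J (s : R) : R := / g1 s.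
(** The margin [J s1] keeps every point within [J s / 2] of some [s >= s2] in the region where
    [tail] applies. *)
Let s2 : R := s1 + J s1.

Lemma J_pos s : s1 <= s -> 0 < J s.
Proof. intros hs; apply Rinv_0_lt_compat, (ta_g1_pos _ _ _ _ _ _ _ _ _ _ _ (tail s hs)). Qed.

Lemma J_derive s : s1 <= s -> is_derive J s (- (H s / g s)).
Proof.
  intros hs; tail_facts (tail s hs).
  replace (- (H s / g s)) with (- (H s / g s * g1 s ^ 2) / g1 s ^ 2) by (field; lra).
  apply is_derive_inv; [assumption | lra].
Qed.

Lemma H_over_g s : s1 <= s -> 0 < H s / g s <= 1 / 10.
Proof.
  intros hs; tail_facts (tail s hs); split; [| assumption].
  apply Rdiv_lt_0_compat; lra.
Qed.

Lemma J_decr s s' : s1 <= s -> s <= s' -> J s' <= J s.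
Proof.
  intros hs hs'; enough (J s' - J s <= 0 * (s' - s)) by lra.
  apply (increment_ge J (fun x => - (H x / g x))); [assumption | |];
    intros x hx; [apply J_derive; lra | pose proof (H_over_g x); lra].
Qed.

Lemma J_lipschitz s z : s1 <= s -> s1 <= s + z -> Rabs (J (s + z) - J s) <= 1 / 10 * Rabs z.
Proof.
  intros h1 h2; replace (Rabs z) with (Rabs (s + z - s)) by (f_equal; ring).
  apply (increment_abs J (fun x => - (H x / g x))); intros x hx;
    assert (hx1 : s1 <= x) by (revert hx; unfold Rmin, Rmax; destruct Rle_dec; lra).
  - now apply J_derive.
  - rewrite Rabs_Ropp; pose proof (H_over_g x hx1); rewrite Rabs_pos_eq; lra.
Qed.

(** As [|J'| = H / g <= 1 / 10], half a length scale changes [J] by at most one twentieth of itself,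
    hence the factor [20 / 19] for [g1 = / J]. *)
Lemma near_bounds s z : s2 <= s -> Rabs z <= J s / 2 ->
  s1 <= s + z /\ g1 (s + z) <= 20 / 19 * g1 s.
Proof.
  intros hs hz.
  pose proof (J_pos s1 (Rle_refl _)) as hJ1.
  assert (h1 : s1 <= s) by (unfold s2 in hs; lra).
  pose proof (J_decr s1 s (Rle_refl _) h1) as hJ.
  pose proof (Rabs_maj2 z) as hz2.
  assert (h2 : s1 <= s + z) by (unfold s2 in hs; lra).
  split; [assumption |].
  assert (h3 := J_lipschitz s z h1 h2).
  pose proof (Rabs_maj2 (J (s + z) - J s)) as h4.
  assert (h5 : 19 / 20 * J s <= J (s + z)) by lra.
  pose proof (J_pos s h1).
  rewrite <- (Rinv_inv (g1 (s + z))), <- (Rinv_inv (g1 s)).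
  fold (J s); fold (J (s + z)).
  replace (20 / 19 * / J s) with (/ (19 / 20 * J s)) by (field; lra).
  apply Rinv_le_contravar; lra.
Qed.

Lemma g_near s z : s2 <= s -> Rabs z <= J s / 2 ->
  Rabs (g (s + z) - g s) <= 20 / 19 * g1 s * Rabs z.
Proof.
  intros hs hz; replace (Rabs z) with (Rabs (s + z - s)) by (f_equal; ring).
  apply (increment_abs g g1); intros x hx;
    assert (hx1 : Rabs (x - s) <= J s / 2)
      by (revert hx hz; unfold Rmin, Rmax, Rabs; destruct Rle_dec; do 2 destruct Rcase_abs; lra);
    destruct (near_bounds s (x - s) hs hx1) as [h1 h2];
    replace (s + (x - s)) with x in h1, h2 by ring; tail_facts (tail x h1).
  - assumption.
  - rewrite Rabs_pos_eq; lra.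
Qed.

(** The derivative of [exp (g - g s) * g1] is [exp (g - g s) * g1^2 * (1 + H / g)]. Within half a
    length scale [g] moves by less than [1], so the exponential is at most [3], and the rest is at
    most [4 / 3 * g1 s ^ 2]; this is the origin of the [4]. *)
Lemma exp_g_slope s z l : s2 <= s -> 0 <= l <= 1 / 2 -> Rabs z <= l * J s ->
  Rabs (exp (g (s + z) - g s) * g1 (s + z) - g1 s) <= 4 * l * g1 s.
Proof.
  intros hs hl hz.
  assert (hs1 : s1 <= s) by (unfold s2 in hs; pose proof (J_pos s1 (Rle_refl _)); lra).
  pose proof (J_pos s hs1) as hJ.
  pose proof (ta_g1_pos _ _ _ _ _ _ _ _ _ _ _ (tail s hs1)) as hgp.
  assert (hJg : J s * g1 s = 1) by (unfold J; field; lra).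
  set (psi := fun x => exp (g x - g s) * g1 x).
  assert (h : Rabs (psi (s + z) - psi s) <= 4 * g1 s ^ 2 * Rabs (s + z - s)).
  { apply (increment_abs psi (fun x => exp (g x - g s) * (g1 x ^ 2 * (1 + H x / g x)))).
    - intros x hx.
      assert (hx1 : Rabs (x - s) <= J s / 2).
      { apply Rle_trans with (Rabs z); [| nra].
        revert hx; unfold Rmin, Rmax, Rabs; destruct Rle_dec; do 2 destruct Rcase_abs; lra. }
      destruct (near_bounds s (x - s) hs hx1) as [h1 h2].
      replace (s + (x - s)) with x in h1, h2 by ring; tail_facts (tail x h1).
      unfold psi.
      replace (exp (g x - g s) * (g1 x ^ 2 * (1 + H x / g x))) with
        ((g1 x - 0) * exp (g x - g s) * g1 x + exp (g x - g s) * (H x / g x * g1 x ^ 2)) by ring.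
      apply (is_derive_mult (fun x => exp (g x - g s)) g1);
        [| assumption | intros; apply Rmult_comm].
      apply (is_derive_comp exp (fun x => g x - g s)); [apply is_derive_exp |].
      apply (is_derive_minus g (fun _ => g s)); [assumption | apply (is_derive_const (g s) x)].
    - intros x hx.
      assert (hx1 : Rabs (x - s) <= J s / 2).
      { apply Rle_trans with (Rabs z); [| nra].
        revert hx; unfold Rmin, Rmax, Rabs; destruct Rle_dec; do 2 destruct Rcase_abs; lra. }
      destruct (near_bounds s (x - s) hs hx1) as [h1 h2].
      assert (h3 := g_near s (x - s) hs hx1).
      replace (s + (x - s)) with x in h1, h2, h3 by ring.
      destruct (H_over_g x h1) as [h4 h5].
      pose proof (ta_g1_pos _ _ _ _ _ _ _ _ _ _ _ (tail x h1)) as h6.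
      assert (hexp : 0 < exp (g x - g s) <= 3).
      { split; [apply exp_pos |]; apply Rle_trans with (exp 1); [| apply exp_le_3].
        assert (g x - g s <= 1).
        { apply Rle_trans with (1 := Rle_abs _), Rle_trans with (1 := h3).
          apply Rle_trans with (20 / 19 * g1 s * (J s / 2)); [apply Rmult_le_compat_l; lra | nra]. }
        destruct (Rle_lt_or_eq_dec _ _ H0) as [h7 | ->]; [| lra].
        now apply Rlt_le, exp_increasing. }
      assert (h8 : 0 < g1 x ^ 2 * (1 + H x / g x) <= 4 / 3 * g1 s ^ 2).
      { assert (0 < g1 x ^ 2 <= 400 / 361 * g1 s ^ 2) by nra.
        split; [apply Rmult_lt_0_compat; lra | nra]. }
      rewrite Rabs_pos_eq by (apply Rmult_le_pos; lra).
      apply Rle_trans with (3 * (4 / 3 * g1 s ^ 2)); [| lra].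
      apply Rmult_le_compat; lra. }
  unfold psi in h; replace (g s - g s) with 0 in h by ring.
  rewrite exp_0, Rmult_1_l in h; replace (s + z - s) with z in h by ring.
  apply Rle_trans with (1 := h).
  apply Rle_trans with (4 * g1 s ^ 2 * (l * J s)); [apply Rmult_le_compat_l; nra |].
  replace (4 * g1 s ^ 2 * (l * J s)) with (4 * l * g1 s * (J s * g1 s)) by ring.
  rewrite hJg; lra.
Qed.

(** [theta - g / 2] is nondecreasing since [1 + mu >= 9 / 10]. *)
Lemma theta_unbounded M : ev (fun s => M < theta s).
Proof.
  assert (h : forall s, s1 <= s -> 0 * (s - s1) <= (theta s - g s / 2) - (theta s1 - g s1 / 2)).
  { intros s hs.
    apply (increment_le (fun x => theta x - g x / 2) (fun x => g1 x * (1 + mu x) - g1 x / 2));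
      [assumption | |]; intros x hx; tail_facts (tail x (proj1 hx)).
    - apply (is_derive_minus theta (fun x => g x / 2)); [assumption |].
      apply (is_derive_ext (fun x => / 2 * g x)); [intros; apply Rmult_comm |].
      replace (g1 x / 2) with (/ 2 * g1 x) by field.
      now apply is_derive_scal.
    - pose proof (Rabs_maj2 (mu x)); nra. }
  apply (ev_imp2 _ _ _ (ev_beyond s1) (g_unbounded (2 * (M - (theta s1 - g s1 / 2))))).
  intros s hs1 hs2; specialize (h s ltac:(lra)); lra.
Qed.

(** Here the correction evaluated at [s] itself pays off: the source along [u0] is exactly [Q J],
    with no error term, and the whole residual sits in [u0'']. *)
Lemma exp_theta s : s1 <= s -> / 4 * exp (- theta s) * exp (g s) = H s / g s * J s.
Proof.
  intros hs; tail_facts (tail s hs).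
  replace (- theta s) with (ln 4 + ln (H s) + - ln (g s) + - ln (g1 s) + - g s)
    by (unfold theta, correction; ring).
  rewrite !exp_plus, !exp_Ropp, !exp_ln by lra.
  pose proof (exp_pos (g s)); unfold J; field; lra.
Qed.

Lemma source_near s z : s2 <= s -> Rabs z <= J s / 2 ->
  / 4 * exp (- theta s) * ext0 f (s + z) = H s / g s * J s * exp (g (s + z) - g s).
Proof.
  intros hs hz.
  destruct (near_bounds s z hs hz) as [h1 _].
  assert (hs1 : s1 <= s) by (unfold s2 in hs; pose proof (J_pos s1 (Rle_refl _)); lra).
  assert (h2 : 0 < s + z) by apply (ta_pos _ _ _ _ _ _ _ _ _ _ _ (tail _ h1)).
  unfold ext0; rewrite Rmax_right by lra.
  rewrite <- (exp_theta s hs1).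
  replace (f (s + z)) with (exp (g (s + z)))
    by (rewrite g_logf; apply exp_ln, f_pos; lra).
  unfold Rminus; rewrite exp_plus, (exp_Ropp (g s)).
  pose proof (exp_pos (g s)); field; lra.
Qed.

(** After removing the linear part the slope is [Q J (exp (g - g s) g1 - g1 s)], because
    [J * g1 = 1]; [exp_g_slope] makes it small in proportion to [l]. A Lipschitz bound serves both
    the remainder of one solution and the difference of two. *)
Lemma source_lipschitz s z z' l : s2 <= s -> 0 <= l <= 1 / 2 ->
  Rabs z <= l * J s -> Rabs z' <= l * J s ->
  Rabs (/ 4 * exp (- theta s) * ext0 f (s + z) - H s / g s * z
        - (/ 4 * exp (- theta s) * ext0 f (s + z') - H s / g s * z'))
  <= 4 * l * (H s / g s) * Rabs (z - z').
Proof.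
  intros hs hl hz hz'.
  assert (hs1 : s1 <= s) by (unfold s2 in hs; pose proof (J_pos s1 (Rle_refl _)); lra).
  pose proof (J_pos s hs1) as hJ.
  pose proof (H_over_g s hs1) as hQ; set (Q := H s / g s) in *.
  pose proof (ta_g1_pos _ _ _ _ _ _ _ _ _ _ _ (tail s hs1)) as hgp.
  assert (hJg : J s * g1 s = 1) by (unfold J; field; lra).
  assert (hhalf : forall x, Rabs x <= l * J s -> Rabs x <= J s / 2) by (intros; nra).
  rewrite !source_near by auto; fold Q.
  apply (increment_abs (fun x => Q * J s * exp (g (s + x) - g s) - Q * x)
    (fun x => Q * J s * (exp (g (s + x) - g s) * g1 (s + x)) - Q)); intros x hx;
    (assert (hxl : Rabs x <= l * J s)
      by (revert hx hz hz'; unfold Rmin, Rmax, Rabs; destruct Rle_dec;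
          do 3 destruct Rcase_abs; lra)).
  - destruct (near_bounds s x hs (hhalf x hxl)) as [h1 _]; tail_facts (tail _ h1).
    assert (hd : is_derive (fun y => exp (g (s + y) - g s)) x
      (exp (g (s + x) - g s) * g1 (s + x))).
    { rewrite Rmult_comm.
      apply (is_derive_comp exp (fun y => g (s + y) - g s)); [apply is_derive_exp |].
      rewrite <- (Rminus_0_r (g1 (s + x))).
      apply (is_derive_minus (fun y => g (s + y)) (fun _ => g s));
        [| apply (is_derive_const (g s) x)].
      rewrite <- (Rmult_1_l (g1 (s + x))).
      apply (is_derive_comp g (fun y => s + y)); [assumption |].
      auto_derive; [trivial | ring]. }
    apply (is_derive_minus (fun y => Q * J s * exp (g (s + y) - g s)) (fun y => Q * y)).
    + now apply is_derive_scal.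
    + auto_derive; [trivial | ring].
  - replace (Q * J s * (exp (g (s + x) - g s) * g1 (s + x)) - Q) with
      (Q * J s * (exp (g (s + x) - g s) * g1 (s + x) - g1 s))
      by (transitivity (Q * J s * (exp (g (s + x) - g s) * g1 (s + x)) - Q * (J s * g1 s));
          [ring | rewrite hJg; ring]).
    rewrite Rabs_mult, (Rabs_pos_eq (Q * J s)) by nra.
    apply Rle_trans with (Q * J s * (4 * l * g1 s)).
    + apply Rmult_le_compat_l; [nra | now apply exp_g_slope].
    + replace (Q * J s * (4 * l * g1 s)) with (4 * l * Q * (J s * g1 s)) by ring.
      rewrite hJg; lra.
Qed.

Lemma exists_frame :
  exists (T c0 c1 Cp : R) (u0 v0 G1 Q1 p p1 : R -> R),
    frame (fun t u => / 4 * exp (- t) * ext0 f u) T c0 c1 Cp u0 v0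
      (fun t => g (u0 t)) G1 (fun t => J (u0 t)) (fun t => H (u0 t) / g (u0 t)) Q1 p p1 /\
    (forall t, T < t -> s2 < u0 t /\ theta (u0 t) = t /\ 0 < v0 t).
Proof.
  assert (h12 : s1 <= s2) by (unfold s2; pose proof (J_pos s1 (Rle_refl _)); lra).
  set (i := fun s => / (1 + mu s)).
  assert (hi : forall s, s1 <= s -> 9 / 10 <= i s <= 10 / 9).
  { intros s hs; tail_facts (tail s hs); apply Rabs_le_between in ta_mu_small.
    unfold i; replace (9 / 10) with (/ (10 / 9)) by field.
    replace (10 / 9) with (/ (9 / 10)) at 2 by field.
    split; apply Rinv_le_contravar; lra. }
  destruct (inverse_beyond theta (fun s => g1 s * (1 + mu s)) s2) as [u0 hu0].
  - intros s hs; apply tail; lra.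
  - intros s hs; tail_facts (tail s ltac:(lra)).
    apply Rabs_le_between in ta_mu_small; apply Rmult_lt_0_compat; lra.
  - exact theta_unbounded.
  - set (v0 := fun t => J (u0 t) * i (u0 t)).
    assert (hs : forall t, theta s2 < t -> s1 <= u0 t).
    { intros t ht; destruct (hu0 t ht); lra. }
    assert (hv0 : forall t, theta s2 < t -> is_derive u0 t (v0 t)).
    { intros t ht; destruct (hu0 t ht) as [h1 [h2 h3]]; specialize (hs t ht).
      unfold v0, J, i; tail_facts (tail _ hs); apply Rabs_le_between in ta_mu_small.
      replace (/ g1 (u0 t) * / (1 + mu (u0 t))) with (/ (g1 (u0 t) * (1 + mu (u0 t))))
        by (field; lra); assumption. }
    (* Chain rule along [u0]: as [g1 (u0) * u0' = i (u0)], a [v]-derivative [D] becomes the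
       [t]-derivative [D * i]. Every field of [frame] thereby reduces to a statement in [s]. *)
    assert (hcomp : forall F D t, theta s2 < t ->
      (forall s, s1 <= s -> is_derive F s (g1 s * D s)) ->
      is_derive (fun x => F (u0 x)) t (D (u0 t) * i (u0 t))).
    { intros F D t ht hF; specialize (hs t ht).
      replace (D (u0 t) * i (u0 t)) with (v0 t * (g1 (u0 t) * D (u0 t)));
        [now apply (is_derive_comp F u0); auto |].
      unfold v0, J; tail_facts (tail _ hs); field; lra. }
    assert (hdJ : forall s, s1 <= s -> is_derive J s (g1 s * (- (H s / g s) * J s))).
    { intros s h; replace (g1 s * (- (H s / g s) * J s)) with (- (H s / g s));
        [now apply J_derive |]. unfold J; tail_facts (tail s h); field; lra. }
    assert (hdi : forall s, s1 <= s -> is_derive i s (g1 s * (- (M1 s * i s ^ 2)))).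
    { intros s h; specialize (hi s h); tail_facts (tail s h).
      apply Rabs_le_between in ta_mu_small.
      replace (g1 s * (- (M1 s * i s ^ 2))) with (- (0 + g1 s * M1 s) / (1 + mu s) ^ 2)
        by (unfold i; field; lra).
      apply (is_derive_inv (fun s => 1 + mu s)); [| lra].
      apply (is_derive_plus (fun _ => 1) mu); [apply (is_derive_const 1 s) | assumption]. }
    (* The last constant comes from [p1 = (- Q J B + J B1) * i]: the two terms give [2 kappa C] and
       [C], and [i <= 2]. *)
    exists (theta s2), (kappa / 2), (2 * kappa), (2 * C * (2 * kappa + 1)), u0, v0,
      (fun t => i (u0 t)),
      (fun t => (K1 (u0 t) / g (u0 t) - H (u0 t) / g (u0 t) ^ 2) * i (u0 t)),
      (fun t => J (u0 t) * B (u0 t)),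
      (fun t => (- (H (u0 t) / g (u0 t)) * J (u0 t) * B (u0 t) + J (u0 t) * B1 (u0 t))
                * i (u0 t)).
    split; [constructor |].
    + lra.
    + lra.
    + nra.
    + exact hv0.
    (* Differentiating [v0 = J i] gives [- Q J (i^2 + g M1 / H * i^3)]; [B] is what this bracket
       lacks to be [1]. *)
    + intros t ht.
      replace (- (H (u0 t) / g (u0 t)) * (J (u0 t) - J (u0 t) * B (u0 t))) with
        ((- (H (u0 t) / g (u0 t)) * J (u0 t) * i (u0 t)
          + J (u0 t) * - (M1 (u0 t) * i (u0 t) ^ 2)) * i (u0 t)).
      * apply (hcomp (fun s => J s * i s)
          (fun s => - (H s / g s) * J s * i s + J s * - (M1 s * i s ^ 2)) t ht).
        intros s h.
        replace (g1 s * (- (H s / g s) * J s * i s + J s * - (M1 s * i s ^ 2))) with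
          (g1 s * (- (H s / g s) * J s) * i s + J s * (g1 s * - (M1 s * i s ^ 2))) by ring.
        apply (is_derive_mult J i); auto; intros; apply Rmult_comm.
      * tail_facts (tail _ (hs t ht)); rewrite ta_B_eq; fold (i (u0 t)).
        field; lra.
    + intros t ht; replace (i (u0 t)) with (1 * i (u0 t)) by ring.
      apply (hcomp g (fun _ => 1) t ht); intros s h; rewrite Rmult_1_r.
      now tail_facts (tail s h).
    + intros t ht; apply hi; auto.
    + intros t ht; now tail_facts (tail _ (hs t ht)).
    + intros t ht; apply J_pos; auto.
    + intros t t' ht htt'; apply J_decr; [auto |].
      enough (0 * (t' - t) <= u0 t' - u0 t) by lra.
      apply (increment_le u0 v0); [assumption | |]; intros x hx; [apply hv0; lra |].
      assert (hx' : s1 <= u0 x) by (apply hs; lra).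
      pose proof (J_pos _ hx'); pose proof (hi _ hx'); unfold v0; nra.
    + intros t ht; apply (ex_derive_continuous (fun t => J (u0 t))).
      eexists; apply (hcomp J (fun s => - (H s / g s) * J s) t ht hdJ).
    + intros t ht.
      apply (hcomp (fun s => H s / g s) (fun s => K1 s / g s - H s / g s ^ 2) t ht).
      intros s h; tail_facts (tail s h).
      replace (g1 s * (K1 s / g s - H s / g s ^ 2)) with
        ((g1 s * K1 s * g s - H s * g1 s) / g s ^ 2) by (field; lra).
      apply is_derive_div; auto; lra.
    + intros t ht; tail_facts (tail _ (hs t ht)).
      replace (H (u0 t) / g (u0 t) * g (u0 t)) with (H (u0 t)) by (field; lra); lra.
    (* Since [|g K1| <= kappa / 4 <= H / 2], the numerator is at most [3 / 2 * H]; with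
       [i <= 10 / 9] this gives [5 / 3], below the allowed [17 / 10]. *)
    + intros t ht; specialize (hs t ht); destruct (hi _ hs) as [hi1 hi2].
      tail_facts (tail _ hs); set (s := u0 t) in *.
      replace ((K1 s / g s - H s / g s ^ 2) * i s) with
        ((g s * K1 s - H s) * (i s * / g s ^ 2)) by (field; lra).
      assert (hg2 : 0 < / g s ^ 2) by (apply Rinv_0_lt_compat, pow_lt; lra).
      rewrite Rabs_mult, (Rabs_pos_eq (i s * _)) by nra.
      assert (ha : Rabs (g s * K1 s - H s) <= 3 / 2 * H s).
      { apply Rabs_le_between in ta_K1; apply Rabs_le; lra. }
      apply Rle_trans with (3 / 2 * H s * (10 / 9 * / g s ^ 2) * g s).
      * apply Rmult_le_compat_r; [lra |].
        apply Rmult_le_compat; [apply Rabs_pos | nra | assumption |].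
        apply Rmult_le_compat_r; lra.
      * replace (3 / 2 * H s * (10 / 9 * / g s ^ 2) * g s) with (5 / 3 * (H s / g s))
          by (field; lra).
        pose proof (H_over_g s hs); lra.
    + intros t ht.
      apply (hcomp (fun s => J s * B s) (fun s => - (H s / g s) * J s * B s + J s * B1 s) t ht).
      intros s h; tail_facts (tail s h).
      replace (g1 s * (- (H s / g s) * J s * B s + J s * B1 s)) with
        (g1 s * (- (H s / g s) * J s) * B s + J s * (g1 s * B1 s)) by ring.
      apply (is_derive_mult J B); auto; intros; apply Rmult_comm.
    + intros t ht; specialize (hs t ht).
      pose proof (J_pos _ hs); tail_facts (tail _ hs); set (s := u0 t) in *.
      rewrite Rabs_mult, (Rabs_pos_eq (J s)) by lra.
      apply Rle_trans with (J s * (C / g s) * g s).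
      * apply Rmult_le_compat_r; [lra |]; apply Rmult_le_compat_l; lra.
      * replace (J s * (C / g s) * g s) with (C * J s) by (field; lra).
        apply Rmult_le_compat_r; nra.
    + intros t ht; specialize (hs t ht).
      pose proof (J_pos _ hs); pose proof (H_over_g _ hs); destruct (hi _ hs) as [hi1 hi2].
      tail_facts (tail _ hs); set (s := u0 t) in *.
      assert (hg2 : 0 < g s ^ 2) by (apply pow_lt; lra).
      rewrite Rabs_mult, (Rabs_pos_eq (i s)) by lra.
      apply Rle_trans with ((2 * kappa + 1) * C * (J s / g s ^ 2) * 2 * g s ^ 2).
      * apply Rmult_le_compat_r; [lra |].
        apply Rmult_le_compat; [apply Rabs_pos | lra | | lra].
        replace ((2 * kappa + 1) * C * (J s / g s ^ 2)) with
          (2 * kappa / g s * J s * (C / g s) + J s * (C / g s ^ 2)) by (field; lra).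
        apply Rabs_sum_le; apply Rabs_prod_le; auto.
        -- rewrite Rabs_mult, Rabs_Ropp, !Rabs_pos_eq by lra.
           apply Rmult_le_compat_r; [lra |].
           apply Rmult_le_compat_r; [apply Rlt_le, Rinv_0_lt_compat; lra | lra].
        -- rewrite Rabs_pos_eq; lra.
      * apply Req_le; field; lra.
    + intros t ht; destruct (hu0 t ht) as [h1 [h2 _]].
      assert (h := source_near (u0 t) 0); rewrite h2, Rplus_0_r, Rminus_diag, exp_0 in h.
      rewrite h; [ring | lra |].
      rewrite Rabs_R0; pose proof (J_pos _ (hs t ht)); lra.
    + intros t l z z' ht hl hz hz'; destruct (hu0 t ht) as [h1 [h2 _]].
      assert (h := source_lipschitz (u0 t) z z' l); rewrite h2 in h.
      apply h; auto; lra.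
    + intros t ht; destruct (hu0 t ht) as [h1 [h2 _]].
      split; [assumption |]; split; [assumption |].
      pose proof (J_pos _ (hs t ht)); pose proof (hi _ (hs t ht)).
      unfold v0; nra.
Qed.

End Approx.

(** * Energy estimates and the exact solution near infinity *)

Lemma abs_le_of_sq (a b : R) : 0 <= b -> a ^ 2 <= b ^ 2 -> Rabs a <= b.
Proof. intros hb h; apply Rabs_le; nra. Qed.

Lemma sq_le_of_abs (a b : R) : Rabs a <= b -> a ^ 2 <= b ^ 2.
Proof. intros h; rewrite <- (pow2_abs a); apply pow_incr; split; [apply Rabs_pos | assumption]. Qed.

(** Continuity method from [n] downwards. At the supremum [m] of the points where [phi <= 0],
    continuity gives [phi m = 0] while [phi > 0] to the right, so the improvement from [0 <= phi] to
    [0 < phi] applies at [m] and contradicts its choice. *)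
Lemma backward_bootstrap (phi : R -> R) (a n : R) :
  (forall t, a < t <= n -> continuous phi t) -> 0 < phi n ->
  (forall t0, a < t0 <= n -> (forall t, t0 <= t <= n -> 0 <= phi t) -> 0 < phi t0) ->
  forall t, a < t <= n -> 0 < phi t.
Proof.
  intros hc hn hstep t0 ht0.
  destruct (Rlt_le_dec 0 (phi t0)) as [| hle]; [assumption | exfalso].
  set (E := fun x => t0 <= x <= n /\ phi x <= 0).
  destruct (completeness E) as [m [hub hlub]].
  - exists n; intros x [hx _]; lra.
  - exists t0; split; [lra | assumption].
  - assert (hm1 : t0 <= m) by (apply hub; split; [lra | assumption]).
    assert (hm2 : m <= n) by (apply hlub; intros x [hx _]; lra).
    assert (hright : forall x, m < x <= n -> 0 < phi x).
    { intros x hx; destruct (Rlt_le_dec 0 (phi x)) as [| h]; [assumption |].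
      assert (x <= m) by (apply hub; split; [lra | assumption]); lra. }
    assert (hcm := hc m ltac:(lra)).
    assert (hmle : phi m <= 0).
    { destruct (Rlt_le_dec 0 (phi m)) as [h |]; [exfalso | assumption].
      destruct (hcm (fun y => 0 < y)) as [del hdel]; [now apply open_gt |].
      pose proof (cond_pos del).
      assert (m <= m - del / 2); [apply hlub | lra].
      intros x [hx1 hx2]; assert (x <= m) by (apply hub; split; assumption).
      destruct (Rle_dec x (m - del / 2)) as [| hn2]; [assumption |].
      enough (0 < phi x) by lra.
      apply hdel; apply Rabs_def1; unfold minus, plus, opp; simpl; lra. }
    assert (hlt : m < n) by (destruct hm2 as [| ->]; lra).
    enough (0 < phi m) by lra.
    apply hstep; [lra |]; intros t ht.
    destruct (Rlt_le_dec m t) as [h | h]; [apply Rlt_le, hright; lra |].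
    replace t with m by lra.
    destruct (Rle_lt_dec 0 (phi m)) as [| hneg]; [assumption | exfalso].
    destruct (hcm (fun y => y < 0)) as [del hdel]; [now apply open_lt |].
    pose proof (cond_pos del).
    set (x := Rmin n (m + del / 2)).
    assert (hx : m < x <= n /\ x <= m + del / 2).
    { unfold x; pose proof (Rmin_l n (m + del / 2)); pose proof (Rmin_r n (m + del / 2)).
      split; [split; [apply Rmin_glb_lt; lra | lra] | lra]. }
    assert (phi x < 0) by (apply hdel, Rabs_def1; unfold minus, plus, opp; simpl; lra).
    pose proof (hright x ltac:(lra)); lra.
Qed.

(** The mean value theorem for [a m y - be x * y] gives an increment bound uniform in [m], which
    survives [m -> oo]. *)
Lemma limit_derive (a b : nat -> R -> R) (al be : R -> R) (l r x : R) (N0 : nat) :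
  l < x < r ->
  (forall n y, (N0 <= n)%nat -> l < y < r -> is_derive (a n) y (b n y)) ->
  (forall n, (N0 <= n)%nat -> continuous (b n) x) ->
  (forall eps, 0 < eps -> exists N, forall n y, (N <= n)%nat -> l < y < r ->
     Rabs (a n y - al y) <= eps) ->
  (forall eps, 0 < eps -> exists N, forall n y, (N <= n)%nat -> l < y < r ->
     Rabs (b n y - be y) <= eps) ->
  is_derive al x (be x).
Proof.
  intros hx hd hc ha hb; apply is_derive_Reals; intros eps heps.
  destruct (hb (eps / 5)) as [N1 h1]; [lra |].
  set (N := Nat.max N0 N1).
  assert (hNc := hc N ltac:(unfold N; lia)).
  assert (h5 : 0 < eps / 5) by lra.
  destruct (hNc (ball (b N x) (mkposreal _ h5)) (locally_ball _ _)) as [d1 hd1].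
  set (d2 := Rmin d1 (Rmin (x - l) (r - x))).
  assert (hd2 : 0 < d2) by (repeat apply Rmin_glb_lt; [apply cond_pos | lra | lra]).
  exists (mkposreal _ hd2); simpl; intros h hh0 hh.
  assert (hd21 : d2 <= d1) by apply Rmin_l.
  assert (hd22 : d2 <= x - l) by (eapply Rle_trans; [apply Rmin_r | apply Rmin_l]).
  assert (hd23 : d2 <= r - x) by (eapply Rle_trans; [apply Rmin_r | apply Rmin_r]).
  assert (hbet : forall y, Rmin x (x + h) <= y <= Rmax x (x + h) ->
    Rabs (y - x) < d2 /\ l < y < r).
  { intros y hy; apply Rabs_def2 in hh.
    assert (Rabs (y - x) < d2)
      by (revert hy; unfold Rmin, Rmax; destruct Rle_dec; intros hy; apply Rabs_def1; lra).
    split; [assumption |]; apply Rabs_def2 in H; lra. }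
  (* Four errors of size [eps / 5]: convergence at [y] for the indices [m] and [N], continuity of
     the fixed [b N], and convergence at [x]. The remaining fifth makes the final inequality
     strict. *)
  assert (hmain : forall m, (N <= m)%nat ->
    Rabs (a m (x + h) - a m x - be x * h) <= 4 / 5 * eps * Rabs h).
  { intros m hm.
    replace (a m (x + h) - a m x - be x * h) with
      (a m (x + h) - be x * (x + h) - (a m x - be x * x)) by ring.
    replace (Rabs h) with (Rabs (x + h - x)) by (f_equal; ring).
    apply (increment_abs (fun y => a m y - be x * y) (fun y => b m y - be x)).
    - intros y hy; destruct (hbet y hy) as [h2 h3].
      apply (is_derive_minus (a m) (fun y => be x * y)).
      + apply hd; [unfold N in hm; lia | assumption].
      + auto_derive; [trivial | ring].
    - intros y hy; destruct (hbet y hy) as [h2 h3].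
      replace (b m y - be x) with
        ((b m y - be y) + (- (b N y - be y)) + (b N y - b N x) + (b N x - be x)) by ring.
      replace (4 / 5 * eps) with (eps / 5 + eps / 5 + eps / 5 + eps / 5) by field.
      repeat apply Rabs_sum_le.
      + apply h1; [unfold N in hm; lia | assumption].
      + rewrite Rabs_Ropp; apply h1; [unfold N; lia | assumption].
      + apply Rlt_le; apply (hd1 y); change (Rabs (y - x) < d1); lra.
      + apply h1; [unfold N; lia | lra]. }
  assert (hlim : Rabs (al (x + h) - al x - be x * h) <= 4 / 5 * eps * Rabs h).
  { apply Rnot_lt_le; intros hlt.
    set (e := (Rabs (al (x + h) - al x - be x * h) - 4 / 5 * eps * Rabs h) / 4).
    destruct (ha e) as [N2 h2]; [unfold e; lra |].
    set (m := Nat.max N N2).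
    assert (h3 := hmain m ltac:(unfold m; lia)).
    assert (h4 := h2 m (x + h) ltac:(unfold m; lia)).
    assert (h6 := h2 m x ltac:(unfold m; lia) hx).
    specialize (h4 (proj2 (hbet (x + h) (conj (Rmin_r _ _) (Rmax_r _ _))))).
    assert (h7 : Rabs (al (x + h) - al x - be x * h) <= e + 4 / 5 * eps * Rabs h + e).
    { replace (al (x + h) - al x - be x * h) with
        (- (a m (x + h) - al (x + h)) + (a m (x + h) - a m x - be x * h) + (a m x - al x)) by ring.
      repeat apply Rabs_sum_le; [rewrite Rabs_Ropp | |]; assumption. }
    unfold e in h7; lra. }
  replace ((al (x + h) - al x) / h - be x) with ((al (x + h) - al x - be x * h) * / h)
    by (field; assumption).
  assert (hhp : 0 < Rabs h) by now apply Rabs_pos_lt.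
  rewrite Rabs_mult, Rabs_inv.
  apply Rmult_lt_reg_r with (Rabs h); [assumption |].
  rewrite Rmult_assoc, Rinv_l, Rmult_1_r by lra.
  apply Rle_lt_trans with (1 := hlim); nra.
Qed.

Definition solves (F : R -> R -> R) (u v : R -> R) (t : R) : Prop :=
  is_derive u t (v t) /\ is_derive v t (- F t (u t)).

Section Energy.

Variables (F : R -> R -> R) (T c0 c1 Cp : R) (u0 v0 G G1 J Q Q1 p p1 : R -> R).
Hypothesis fr : frame F T c0 c1 Cp u0 v0 G G1 J Q Q1 p p1.

Lemma clock t t' : T < t -> t <= t' -> 9 / 10 * (t' - t) <= G t' - G t.
Proof.
  intros ht htt'; apply (increment_le G G1); [assumption | |]; intros x hx;
    [apply (fr_G _ _ _ _ _ _ _ _ _ _ _ _ _ _ fr) | apply (fr_G1 _ _ _ _ _ _ _ _ _ _ _ _ _ _ fr)]; lra.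
Qed.

(** With [z = u - u0] and [z1 = z'], the energy [X = z1^2 + Q (z + p)^2]
    satisfies [X' >= - 1.7 X / G - O(sqrt X J G^(-5/2))]; putting [p] inside the
    square is an integration by parts that costs [p'] and gains a factor
    [G^(-1/2)].  As [G' >= 0.9], the function [G sqrt X - O(J t0 / sqrt G)] is
    nondecreasing, which carries the data at [n] back to [t0].  The constant
    [C5] does not depend on [A], which makes the bootstrap in [tracking] close.
    The shift [th] keeps the square root differentiable. *)
Lemma single_bound : exists C5 C6, 0 < C5 /\ 0 < C6 /\
  forall (A t0 n : R) (u v : R -> R),
  2 <= A -> T < t0 <= n -> A ^ 2 <= sqrt (G t0) ->
  (forall t, t0 <= t <= n -> solves F u v t) -> u n = u0 n -> v n = v0 n ->
  (forall t, t0 <= t <= n -> Rabs (u t - u0 t) * G t <= A * J t) ->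
  Rabs (u t0 - u0 t0) * G t0 <= C5 * J t0 /\
  (v t0 - v0 t0) ^ 2 * G t0 ^ 3 <= C6 ^ 2 * J t0 ^ 2.
Proof.
  frame_facts fr.
  (* The two parts of [forcing] bound the nonlinear remainder and [p1]. In [C6], [sqrt c1 * Cp] is
     the energy of [p] at [n], [1] comes from the shift [th], and [3 * forcing] from the
     compensating term of [W]. In [C5], the quotient bounds [z + p], and [Cp] is added to remove
     [p]. *)
  set (forcing := 4 * c1 + sqrt c1 * Cp).
  set (C6 := sqrt c1 * Cp + 1 + 3 * forcing).
  set (C5 := C6 / sqrt c0 + Cp).
  assert (hC6 : 0 < C6).
  { pose proof (sqrt_pos c1); unfold C6, forcing; nra. }
  exists C5, C6; split; [| split; [assumption |]].
  { apply Rplus_lt_0_compat; [apply Rdiv_lt_0_compat; [| apply sqrt_lt_R0] |]; assumption. }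
  intros A t0 n u v hA ht0 hAG hsol hun hvn hboot.
  set (z := fun t => u t - u0 t).
  set (z1 := fun t => v t - v0 t).
  set (y := fun t => z t + p t).
  set (N := fun t => F t (u t) - Q t * J t - Q t * z t).
  set (a1 := sqrt c1) in *.
  assert (ha1 : 0 < a1) by now apply sqrt_lt_R0.
  assert (ha1s : a1 ^ 2 = c1) by (unfold a1; apply pow2_sqrt; lra).
  assert (hG0 : 1 <= G t0) by (apply fr_G_ge1; lra).
  assert (hmono : forall t, t0 <= t -> G t0 <= G t).
  { intros t ht; pose proof (clock t0 t ltac:(lra) ht); lra. }
  set (Rt := fun t => sqrt (G t)).
  assert (hR : forall t, t0 <= t -> 1 <= Rt t /\ Rt t ^ 2 = G t /\ Rt t0 <= Rt t).
  { intros t ht; specialize (hmono t ht); unfold Rt; split; [| split].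
    - rewrite <- sqrt_1; apply sqrt_le_1; lra.
    - apply pow2_sqrt; lra.
    - apply sqrt_le_1; lra. }
  set (J0 := J t0).
  assert (hJ0 : 0 < J0) by (apply fr_J; lra).
  assert (hforce : 0 < forcing) by (unfold forcing; fold a1; nra).
  (* Sized so that [G n * th = J0 / Rt t0], the same order as the contribution of [p n]. *)
  set (th := J0 / (G n * Rt t0)).
  destruct (hR t0 (Rle_refl _)) as [hR01 [hR02 _]].
  destruct (hR n ltac:(lra)) as [hRn1 [hRn2 hRn3]].
  assert (hGn : 1 <= G n) by (pose proof (hmono n ltac:(lra)); lra).
  assert (hth : 0 < th) by (apply Rdiv_lt_0_compat; [assumption | nra]).
  set (X := fun t => z1 t ^ 2 + Q t * y t ^ 2).
  set (S := fun t => sqrt (X t + th ^ 2)).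
  assert (hQ : forall t, t0 <= t -> 0 < Q t).
  { intros t ht; pose proof (fr_Q_bounds t ltac:(lra)).
    pose proof (fr_G_ge1 t ltac:(lra)); nra. }
  assert (hX : forall t, t0 <= t -> 0 <= X t).
  { intros t ht; specialize (hQ t ht); unfold X.
    pose proof (pow2_ge_0 (z1 t)); pose proof (pow2_ge_0 (y t)); nra. }
  assert (hS : forall t, t0 <= t -> 0 < S t /\ S t ^ 2 = X t + th ^ 2).
  { intros t ht; specialize (hX t ht).
    assert (0 < th ^ 2) by now apply pow_lt.
    split; [apply sqrt_lt_R0; lra | apply pow2_sqrt; lra]. }
  (* The two terms [2 Q y z1] cancel, since the residual is inside [y]; only its derivative [p1] is
     left. *)
  set (X1 := fun t => 2 * y t * Q t * p1 t + Q1 t * y t ^ 2 - 2 * z1 t * N t).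
  assert (hdX : forall t, t0 <= t <= n -> is_derive X t (X1 t)).
  { intros t ht; destruct (hsol t ht) as [hd1 hd2].
    assert (hdz : is_derive z t (z1 t)).
    { apply (is_derive_minus u u0); [assumption | apply fr_u0; lra]. }
    assert (hdz1 : is_derive z1 t (- Q t * y t - N t)).
    { replace (- Q t * y t - N t) with (- F t (u t) - - Q t * (J t - p t))
        by (unfold y, N; ring).
      apply (is_derive_minus v v0); [assumption | apply fr_v0; lra]. }
    assert (hdy : is_derive y t (z1 t + p1 t)).
    { apply (is_derive_plus z p); [assumption | apply fr_p; lra]. }
    assert (hdQ := fr_Q t ltac:(lra)).
    replace (X1 t) with (INR 2 * (- Q t * y t - N t) * z1 t ^ 1
      + (Q1 t * y t ^ 2 + Q t * (INR 2 * (z1 t + p1 t) * y t ^ 1)))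
      by (unfold X1; simpl; ring).
    apply (is_derive_plus (fun t => z1 t ^ 2) (fun t => Q t * y t ^ 2)).
    - now apply is_derive_pow.
    - apply (is_derive_mult Q (fun t => y t ^ 2)); [assumption | | intros; apply Rmult_comm].
      now apply is_derive_pow. }
  assert (hX1 : forall t, t0 <= t <= n ->
    - (17 / 10) * S t ^ 2 - 2 * S t * forcing * J0 * / Rt t ^ 3 <= X1 t * G t).
  { intros t ht; destruct (hS t ltac:(lra)) as [hS1 hS2].
    destruct (hR t ltac:(lra)) as [hR1 [hR2 hR3]].
    specialize (hQ t ltac:(lra)).
    pose proof (fr_J t ltac:(lra)) as hJ.
    pose proof (fr_J_decr t0 t ltac:(lra) ltac:(lra)) as hJd; fold J0 in hJd.
    pose proof (fr_G_ge1 t ltac:(lra)) as hG1.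
    destruct (fr_Q_bounds t ltac:(lra)) as [hQ0 hQ1].
    assert (hi : 0 < / Rt t) by (apply Rinv_0_lt_compat; lra).
    set (ri := / Rt t) in *.
    assert (hri : Rt t * ri = 1) by (unfold ri; field; lra).
    assert (hri3 : / Rt t ^ 3 = ri ^ 3) by (unfold ri; now rewrite pow_inv).
    rewrite hri3.
    assert (hz1 : Rabs (z1 t) <= S t).
    { apply abs_le_of_sq; [lra |]; rewrite hS2; unfold X.
      pose proof (pow2_ge_0 (y t)); pose proof (pow2_ge_0 th); nra. }
    assert (hQy2 : Q t * y t ^ 2 <= S t ^ 2).
    { rewrite hS2; unfold X; pose proof (pow2_ge_0 (z1 t)); pose proof (pow2_ge_0 th); lra. }
    assert (hQy : Rabs (Q t * y t) <= a1 * ri * S t).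
    { apply abs_le_of_sq; [apply Rmult_le_pos; nra |].
      replace ((a1 * ri * S t) ^ 2) with (c1 * ri ^ 2 * S t ^ 2) by (rewrite <- ha1s; ring).
      replace ((Q t * y t) ^ 2) with (Q t * (Q t * y t ^ 2)) by ring.
      assert (hQc : Q t <= c1 * ri ^ 2).
      { replace (Q t) with (Q t * G t * ri ^ 2)
          by (rewrite <- hR2; transitivity (Q t * (Rt t * ri) ^ 2); [ring | rewrite hri; ring]).
        apply Rmult_le_compat_r; [apply pow2_ge_0 | assumption]. }
      pose proof (pow2_ge_0 (y t)).
      apply Rmult_le_compat; try lra; nra. }
    assert (hp1 : Rabs (p1 t * G t) <= Cp * J0 * ri ^ 2).
    { specialize (fr_p1_bound t ltac:(lra)).
      rewrite Rabs_mult, (Rabs_pos_eq (G t)) by lra.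
      replace (Rabs (p1 t) * G t) with (Rabs (p1 t) * G t ^ 2 * ri ^ 2)
        by (rewrite <- hR2; transitivity (Rabs (p1 t) * Rt t ^ 2 * (Rt t * ri) ^ 2);
            [ring | rewrite hri; ring]).
      apply Rmult_le_compat_r; [apply pow2_ge_0 | nra]. }
    assert (hA4 : A ^ 2 <= Rt t) by (unfold Rt in hR3 |- *; lra).
    (* The remainder is quadratic in [A / G]; the resulting [A^2] is absorbed by one factor
       [sqrt G]. This is why the bound, and hence [C5], is free of [A]. *)
    assert (hN : Rabs (N t * G t) <= 4 * c1 * J0 * ri ^ 3).
    { assert (hzb : Rabs (z t) <= A / G t * J t).
      { specialize (hboot t ht).
        apply Rmult_le_reg_r with (G t); [lra |].
        replace (A / G t * J t * G t) with (A * J t) by (field; lra); assumption. }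
      assert (hl : 0 <= A / G t <= 1 / 2).
      { split; [apply Rlt_le, Rdiv_lt_0_compat; lra |].
        apply Rmult_le_reg_r with (G t); [lra |].
        replace (A / G t * G t) with A by (field; lra); nra. }
      assert (h := fr_F t (A / G t) (z t) 0 ltac:(lra) hl hzb).
      rewrite Rabs_R0, Rplus_0_r, fr_F0, !Rminus_0_r, Rmult_0_r, Rminus_0_r in h by lra.
      replace (u0 t + z t) with (u t) in h by (unfold z; ring).
      specialize (h ltac:(nra)).
      replace (F t (u t) - Q t * z t - Q t * J t) with (N t) in h by (unfold N; ring).
      rewrite Rabs_mult, (Rabs_pos_eq (G t)) by lra.
      apply Rle_trans with (4 * (A / G t) * Q t * (A / G t * J0) * G t).
      - apply Rmult_le_compat_r; [lra |]; apply Rle_trans with (1 := h).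
        apply Rmult_le_compat_l; [nra |].
        apply Rle_trans with (1 := hzb), Rmult_le_compat_l; lra.
      - replace (4 * (A / G t) * Q t * (A / G t * J0) * G t) with
          (A ^ 2 * (4 * (Q t * G t) * J0 / G t ^ 2)) by (field; lra).
        replace (4 * c1 * J0 * ri ^ 3) with (Rt t * (4 * c1 * J0 / G t ^ 2))
          by (rewrite <- hR2; unfold ri; field; lra).
        assert (0 < / G t ^ 2) by (apply Rinv_0_lt_compat, pow_lt; lra).
        apply Rmult_le_compat; [nra | | assumption |].
        + apply Rmult_le_pos; nra.
        + apply Rmult_le_compat_r; nra. }
    assert (hB : Rabs (Q1 t * y t ^ 2 * G t) <= 17 / 10 * S t ^ 2).
    { specialize (fr_Q1 t ltac:(lra)).
      rewrite !Rabs_mult, (Rabs_pos_eq (G t)), (Rabs_pos_eq (y t ^ 2))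
        by (lra || apply pow2_ge_0).
      pose proof (pow2_ge_0 (y t)); nra. }
    assert (hA1 := Rabs_prod_le _ _ _ _ hQy hp1).
    assert (hC := Rabs_prod_le _ _ _ _ hz1 hN).
    apply Rabs_le_between in hA1; apply Rabs_le_between in hC; apply Rabs_le_between in hB.
    replace (X1 t * G t) with (2 * (Q t * y t * (p1 t * G t)) + Q1 t * y t ^ 2 * G t
      - 2 * (z1 t * (N t * G t))) by (unfold X1; ring).
    replace (2 * S t * forcing * J0 * ri ^ 3) with
      (2 * (a1 * ri * S t * (Cp * J0 * ri ^ 2)) + 2 * (S t * (4 * c1 * J0 * ri ^ 3)))
      by (unfold forcing; fold a1; ring).
    lra. }
  (* In [W'] the term [G1 S] with [G1 >= 9/10] beats the loss [17/20 * S], and the derivative of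
     [- / Rt] is at least [9/20 * / Rt^3], so the factor [3] covers the forcing. *)
  set (W := fun t => G t * S t - 3 * forcing * J0 * / Rt t).
  assert (hW : W t0 <= W n).
  { enough (0 * (n - t0) <= W n - W t0) by lra.
    apply (increment_le W (fun t => G1 t * S t + G t * (X1 t / (2 * S t))
      + 3 * forcing * J0 * (G1 t / (2 * Rt t)) / Rt t ^ 2)); [lra | |]; intros t ht;
      destruct (hS t ltac:(lra)) as [hS1 hS2]; destruct (hR t ltac:(lra)) as [hR1 [hR2 hR3]].
    - assert (hdG := fr_G t ltac:(lra)).
      assert (hdS : is_derive S t (X1 t / (2 * S t))).
      { apply (is_derive_sqrt (fun t => X t + th ^ 2)).
        - rewrite <- (Rplus_0_r (X1 t)).
          apply (is_derive_plus X (fun _ => th ^ 2)); [now apply hdX |].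
          apply (is_derive_const (th ^ 2) t).
        - rewrite <- hS2; now apply pow_lt. }
      assert (hdR : is_derive Rt t (G1 t / (2 * Rt t))).
      { apply (is_derive_sqrt G); [assumption | rewrite <- hR2; apply pow_lt; lra]. }
      replace (G1 t * S t + G t * (X1 t / (2 * S t))
        + 3 * forcing * J0 * (G1 t / (2 * Rt t)) / Rt t ^ 2) with
        (G1 t * S t + G t * (X1 t / (2 * S t))
         - 3 * forcing * J0 * (- (G1 t / (2 * Rt t)) / Rt t ^ 2)) by (field; lra).
      apply (is_derive_minus (fun t => G t * S t) (fun t => 3 * forcing * J0 * / Rt t)).
      + apply (is_derive_mult G S); auto; intros; apply Rmult_comm.
      + apply is_derive_scal, is_derive_inv; [assumption | lra].
    - specialize (hX1 t ht).
      pose proof (fr_G1 t ltac:(lra)) as hG1.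
      assert (hri : 0 < / Rt t ^ 3) by (apply Rinv_0_lt_compat, pow_lt; lra).
      assert (h1 : - (17 / 20) * S t - forcing * J0 * / Rt t ^ 3 <= G t * (X1 t / (2 * S t))).
      { apply Rmult_le_reg_r with (2 * S t); [lra |].
        replace (G t * (X1 t / (2 * S t)) * (2 * S t)) with (X1 t * G t) by (field; lra).
        replace ((- (17 / 20) * S t - forcing * J0 * / Rt t ^ 3) * (2 * S t)) with
          (- (17 / 10) * S t ^ 2 - 2 * S t * forcing * J0 * / Rt t ^ 3) by (field; lra).
        assumption. }
      replace (3 * forcing * J0 * (G1 t / (2 * Rt t)) / Rt t ^ 2) with
        (3 / 2 * G1 t * (forcing * J0 * / Rt t ^ 3)) by (field; lra).
      assert (0 < forcing * J0 * / Rt t ^ 3) by (repeat apply Rmult_lt_0_compat; assumption).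
      nra. }
  assert (hyn : y n = p n) by (unfold y, z; rewrite hun; ring).
  assert (hz1n : z1 n = 0) by (unfold z1; rewrite hvn; ring).
  pose proof (fr_J_decr t0 n ltac:(lra) ltac:(lra)) as hJd; fold J0 in hJd.
  pose proof (fr_J n ltac:(lra)) as hJn.
  destruct (hS n ltac:(lra)) as [hSn1 hSn2].
  destruct (hS t0 ltac:(lra)) as [hS01 hS02].
  (* At [n] both [z] and [z1] vanish, so the energy there is just [Q p^2]. *)
  assert (hGn2 : G n * S n <= (a1 * Cp + 1) * (J0 * / Rt t0)).
  { assert (hi0 : 0 < / Rt t0) by (apply Rinv_0_lt_compat; lra).
    assert (hJi : 0 < J0 * / Rt t0) by nra.
    eapply Rle_trans; [apply Rle_abs |]; apply abs_le_of_sq.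
    { apply Rmult_le_pos; [assert (0 < a1 * Cp) by now apply Rmult_lt_0_compat |]; lra. }
    replace ((G n * S n) ^ 2) with (G n ^ 2 * (S n ^ 2)) by ring.
    rewrite hSn2; unfold X; rewrite hz1n, hyn.
    replace (G n ^ 2 * (0 ^ 2 + Q n * p n ^ 2 + th ^ 2)) with
      (Q n * G n * (/ G n) * (p n * G n) ^ 2 + (G n * th) ^ 2) by (field; lra).
    replace (G n * th) with (J0 * / Rt t0) by (unfold th; field; lra).
    apply Rle_trans with (c1 * / Rt t0 ^ 2 * (Cp * J0) ^ 2 + (J0 * / Rt t0) ^ 2).
    - apply Rplus_le_compat_r, Rmult_le_compat.
      + pose proof (fr_Q_bounds n ltac:(lra)).
        apply Rmult_le_pos; [lra | apply Rlt_le, Rinv_0_lt_compat; lra].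
      + apply pow2_ge_0.
      + apply Rmult_le_compat; [pose proof (fr_Q_bounds n ltac:(lra)); lra | | |].
        * apply Rlt_le, Rinv_0_lt_compat; lra.
        * apply fr_Q_bounds; lra.
        * rewrite hR02; apply Rinv_le_contravar; [lra | apply hmono; lra].
      + apply sq_le_of_abs.
        specialize (fr_p_bound n ltac:(lra)).
        rewrite Rabs_mult, (Rabs_pos_eq (G n)) by lra; nra.
    - replace (((a1 * Cp + 1) * (J0 * / Rt t0)) ^ 2) with
        (a1 ^ 2 * / Rt t0 ^ 2 * (Cp * J0) ^ 2 + (J0 * / Rt t0) ^ 2
         + 2 * a1 * Cp * (J0 * / Rt t0) ^ 2) by (field; lra).
      rewrite ha1s; pose proof (pow2_ge_0 (J0 * / Rt t0)).
      assert (0 <= a1 * Cp) by nra; nra. }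
  assert (hmain : G t0 * S t0 <= C6 * (J0 * / Rt t0)).
  { unfold W in hW.
    assert (0 < / Rt n) by (apply Rinv_0_lt_compat; lra).
    assert (0 < 3 * forcing * J0 * / Rt n) by (repeat apply Rmult_lt_0_compat; lra).
    unfold C6; fold a1; lra. }
  assert (hfin : X t0 * G t0 ^ 3 <= C6 ^ 2 * J0 ^ 2).
  { assert (h := sq_le_of_abs (G t0 * S t0) (C6 * (J0 * / Rt t0))).
    rewrite Rabs_pos_eq in h by nra; specialize (h hmain).
    replace ((G t0 * S t0) ^ 2) with (G t0 ^ 2 * S t0 ^ 2) in h by ring.
    rewrite hS02 in h.
    replace ((C6 * (J0 * / Rt t0)) ^ 2) with (C6 ^ 2 * J0 ^ 2 / Rt t0 ^ 2) in h by (field; lra).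
    rewrite hR02 in h.
    apply Rmult_le_compat_r with (r := G t0) in h; [| lra].
    replace (C6 ^ 2 * J0 ^ 2 / G t0 * G t0) with (C6 ^ 2 * J0 ^ 2) in h by (field; lra).
    assert (0 <= th ^ 2 * G t0 ^ 3) by (apply Rmult_le_pos; apply pow_le; lra).
    nra. }
  assert (hG3 : 0 < G t0 ^ 3) by (apply pow_lt; lra).
  destruct (fr_Q_bounds t0 ltac:(lra)) as [hQ0 _].
  split.
  - set (a0 := sqrt c0).
    assert (ha0 : 0 < a0) by now apply sqrt_lt_R0.
    assert (ha0s : a0 ^ 2 = c0) by (unfold a0; apply pow2_sqrt; lra).
    assert (hy : Rabs (y t0 * G t0) <= C6 / a0 * J0).
    { apply abs_le_of_sq; [apply Rmult_le_pos; [apply Rlt_le, Rdiv_lt_0_compat |]; lra |].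
      apply Rmult_le_reg_l with c0; [assumption |].
      replace (c0 * (C6 / a0 * J0) ^ 2) with (C6 ^ 2 * J0 ^ 2)
        by (rewrite <- ha0s; field; lra).
      apply Rle_trans with (2 := hfin); unfold X.
      apply Rle_trans with (Q t0 * G t0 * (y t0 * G t0) ^ 2).
      - apply Rmult_le_compat_r; [apply pow2_ge_0 | assumption].
      - pose proof (pow2_ge_0 (z1 t0)); nra. }
    fold (z t0); replace (z t0) with (y t0 + - p t0) by (unfold y; ring).
    rewrite <- (Rabs_pos_eq (G t0)) at 1 by lra; rewrite <- Rabs_mult.
    replace ((y t0 + - p t0) * G t0) with (y t0 * G t0 + - p t0 * G t0) by ring.
    replace (C5 * J0) with (C6 / a0 * J0 + Cp * J0) by (unfold C5; fold a0; ring).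
    apply Rabs_sum_le; [assumption |].
    rewrite Rabs_mult, Rabs_Ropp, (Rabs_pos_eq (G t0)) by lra.
    apply fr_p_bound; lra.
  - fold (z1 t0); apply Rle_trans with (2 := hfin).
    apply Rmult_le_compat_r; [lra |]; unfold X.
    specialize (hQ t0 ltac:(lra)); pose proof (pow2_ge_0 (y t0)); nra.
Qed.

End Energy.

Section Energy.

Variables (F : R -> R -> R) (T c0 c1 Cp : R) (u0 v0 G G1 J Q Q1 p p1 : R -> R).
Hypothesis fr : frame F T c0 c1 Cp u0 v0 G G1 J Q Q1 p p1.

Lemma clock_large M : exists T1, T < T1 /\ forall t, T1 < t -> M <= G t.
Proof.
  exists (T + 1 + 2 * Rabs M); pose proof (Rabs_pos M); split; [lra |].
  intros t ht.
  assert (h := clock _ _ _ _ _ _ _ _ _ _ _ _ _ _ fr (T + 1) t ltac:(lra) ltac:(lra)).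
  pose proof (fr_G_ge1 _ _ _ _ _ _ _ _ _ _ _ _ _ _ fr (T + 1) ltac:(lra)).
  pose proof (Rle_abs M); lra.
Qed.

(** Assuming the bound with [A = C5 + 2], [single_bound] returns it with the smaller [C5], so the
    bootstrap is strict. The half-line is fixed before [n], [u] and [v]. *)
Lemma tracking : exists A C6 T1, 2 <= A /\ 0 < C6 /\ T < T1 /\
  (forall t, T1 < t -> A <= G t / 2 /\ 80 * A * sqrt c1 <= sqrt (G t)) /\
  forall n u v, (forall t, T1 < t <= n -> solves F u v t) -> u n = u0 n -> v n = v0 n ->
  forall t, T1 < t <= n ->
    Rabs (u t - u0 t) * G t <= A * J t /\ (v t - v0 t) ^ 2 * G t ^ 3 <= C6 ^ 2 * J t ^ 2.
Proof.
  destruct (single_bound _ _ _ _ _ _ _ _ _ _ _ _ _ _ fr) as [C5 [C6 [hC5 [hC6 hsb]]]].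
  set (A := C5 + 2).
  assert (hA : 2 <= A) by (unfold A; lra).
  pose proof (sqrt_pos c1) as hc1.
  (* The first square ensures [A^2 <= sqrt G], as [single_bound] requires. The second ensures
     [4 A sqrt c1 <= sqrt G / 20], the smallness of the nonlinear term in [difference_bound]. *)
  destruct (clock_large ((A ^ 2) ^ 2 + (80 * A * sqrt c1) ^ 2)) as [T1 [hT1 hG]].
  assert (hA2 : forall t, T1 < t -> A ^ 2 <= sqrt (G t)).
  { intros t ht; specialize (hG t ht).
    rewrite <- (sqrt_pow2 (A ^ 2)) by nra.
    apply sqrt_le_1_alt; pose proof (pow2_ge_0 (80 * A * sqrt c1)); lra. }
  exists A, C6, T1; split; [assumption |]; split; [assumption |]; split; [assumption |]; split.
  { intros t ht; split.
    - specialize (hG t ht); pose proof (pow2_ge_0 (80 * A * sqrt c1)).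
      assert (h8 : 2 ^ 3 <= A ^ 3) by (apply pow_incr; lra).
      assert (A * 2 ^ 3 <= (A ^ 2) ^ 2).
      { replace ((A ^ 2) ^ 2) with (A * A ^ 3) by ring; apply Rmult_le_compat_l; lra. }
      lra.
    - specialize (hG t ht).
      rewrite <- (sqrt_pow2 (80 * A * sqrt c1)) by (apply Rmult_le_pos; lra).
      apply sqrt_le_1_alt; pose proof (pow2_ge_0 (A ^ 2)); lra. }
  intros n u v hsol hun hvn.
  assert (hb : forall t0, T1 < t0 <= n ->
    (forall t, t0 <= t <= n -> Rabs (u t - u0 t) * G t <= A * J t) ->
    Rabs (u t0 - u0 t0) * G t0 <= C5 * J t0 /\
    (v t0 - v0 t0) ^ 2 * G t0 ^ 3 <= C6 ^ 2 * J t0 ^ 2).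
  { intros t0 ht0 h; apply (hsb A t0 n u v); auto; [lra | apply hA2; lra |].
    intros t ht; apply hsol; lra. }
  frame_facts fr.
  assert (hboot : forall t, T1 < t <= n -> 0 < A * J t - Rabs (u t - u0 t) * G t).
  { destruct (Rlt_le_dec T1 n) as [hn | hn]; [| intros; lra].
    apply (backward_bootstrap (fun t => A * J t - Rabs (u t - u0 t) * G t)).
    - intros t ht.
      apply (continuous_minus (fun t => A * J t) (fun t => Rabs (u t - u0 t) * G t)).
      + apply (continuous_scal_r A J), fr_J_cont; lra.
      + apply (continuous_mult (fun t => Rabs (u t - u0 t)) G).
        * apply (continuous_comp (fun t => u t - u0 t) Rabs); [| apply continuous_Rabs].
          apply (continuous_minus u u0); apply (ex_derive_continuous (V := R_NormedModule)).
          -- exists (v t); exact (proj1 (hsol t ht)).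
          -- eexists; apply fr_u0; lra.
        * apply (ex_derive_continuous G); eexists; apply fr_G; lra.
    - rewrite hun, Rminus_diag, Rabs_R0.
      pose proof (fr_J n ltac:(lra)); nra.
    - intros t0 ht0 h.
      destruct (hb t0 ht0) as [h1 _].
      + intros t ht; specialize (h t ht); lra.
      + pose proof (fr_J t0 ltac:(lra)).
        assert (C5 * J t0 < A * J t0) by (apply Rmult_lt_compat_r; unfold A; lra); lra. }
  intros t ht; split.
  - specialize (hboot t ht); lra.
  - apply hb; [assumption |]; intros t' ht'; specialize (hboot t' ltac:(lra)); lra.
Qed.

(** Backwards in [t] the energy of the difference of two solutions grows at
    most like [G^(-2)]; the errors at [n] bounded in [tracking] are smaller, by
    a factor [1 / G n], than what this growth can compensate. *)
Lemma difference_bound (A t0 n : R) (u v u' v' : R -> R) :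
  0 < A -> T < t0 <= n ->
  (forall t, t0 <= t <= n -> A <= G t / 2 /\ 80 * A * sqrt c1 <= sqrt (G t)) ->
  (forall t, t0 <= t <= n -> solves F u v t /\ solves F u' v' t /\
     Rabs (u t - u0 t) * G t <= A * J t /\ Rabs (u' t - u0 t) * G t <= A * J t) ->
  G t0 ^ 2 * ((v t0 - v' t0) ^ 2 + Q t0 * (u t0 - u' t0) ^ 2)
  <= G n ^ 2 * ((v n - v' n) ^ 2 + Q n * (u n - u' n) ^ 2).
Proof.
  intros hA ht0 hAG hsol; frame_facts fr.
  set (d := fun t => u t - u' t); set (d1 := fun t => v t - v' t).
  set (M := fun t => F t (u t) - F t (u' t) - Q t * d t).
  set (X := fun t => d1 t ^ 2 + Q t * d t ^ 2).
  change (G t0 ^ 2 * X t0 <= G n ^ 2 * X n).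
  enough (0 * (n - t0) <= G n ^ 2 * X n - G t0 ^ 2 * X t0) by lra.
  apply (increment_le (fun t => G t ^ 2 * X t)
    (fun t => INR 2 * G1 t * G t ^ 1 * X t + G t ^ 2 * (Q1 t * d t ^ 2 - 2 * d1 t * M t)));
    [lra | |]; intros t ht; destruct (hsol t ht) as [[hu hv] [[hu' hv'] [hb hb']]].
  - apply (is_derive_mult (fun t => G t ^ 2) X); [| | intros; apply Rmult_comm].
    + apply is_derive_pow, fr_G; lra.
    + assert (hd : is_derive d t (d1 t)) by now apply (is_derive_minus u u').
      assert (hd1 : is_derive d1 t (- Q t * d t - M t)).
      { replace (- Q t * d t - M t) with (- F t (u t) - - F t (u' t)) by (unfold M; ring).
        now apply (is_derive_minus v v'). }
      replace (Q1 t * d t ^ 2 - 2 * d1 t * M t) with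
        (INR 2 * (- Q t * d t - M t) * d1 t ^ 1
         + (Q1 t * d t ^ 2 + Q t * (INR 2 * d1 t * d t ^ 1))) by (simpl; ring).
      apply (is_derive_plus (fun t => d1 t ^ 2) (fun t => Q t * d t ^ 2)).
      * now apply is_derive_pow.
      * apply (is_derive_mult Q (fun t => d t ^ 2)); [apply fr_Q; lra | | intros; apply Rmult_comm].
        now apply is_derive_pow.
  - destruct (hAG t ht) as [hA1 hA2].
    pose proof (fr_G_ge1 t ltac:(lra)) as hG.
    pose proof (fr_G1 t ltac:(lra)) as hG1.
    destruct (fr_Q_bounds t ltac:(lra)) as [hQ0 hQ1].
    pose proof (fr_J t ltac:(lra)) as hJ.
    assert (hQ : 0 < Q t) by nra.
    set (r := sqrt (G t)) in *.
    assert (hr2 : r ^ 2 = G t) by (apply pow2_sqrt; lra).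
    assert (hr : 1 <= r) by (unfold r; rewrite <- sqrt_1; apply sqrt_le_1; lra).
    set (a1 := sqrt c1) in *.
    assert (ha1 : 0 < a1) by now apply sqrt_lt_R0.
    assert (ha1s : a1 ^ 2 = c1) by (unfold a1; apply pow2_sqrt; lra).
    assert (hM : Rabs (M t) * G t <= 4 * A * Q t * Rabs (d t)).
    { assert (hx : forall x, Rabs x * G t <= A * J t -> Rabs x <= A / G t * J t).
      { intros x h; apply Rmult_le_reg_r with (G t); [lra |].
        replace (A / G t * J t * G t) with (A * J t) by (field; lra); assumption. }
      assert (hl : 0 <= A / G t <= 1 / 2).
      { split; [apply Rlt_le, Rdiv_lt_0_compat; lra |].
        apply Rmult_le_reg_r with (G t); [lra |].
        replace (A / G t * G t) with A by (field; lra); lra. }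
      assert (h := fr_F t (A / G t) _ _ ltac:(lra) hl (hx _ hb) (hx _ hb')).
      replace (u0 t + (u t - u0 t)) with (u t) in h by ring.
      replace (u0 t + (u' t - u0 t)) with (u' t) in h by ring.
      replace (u t - u0 t - (u' t - u0 t)) with (d t) in h by (unfold d; ring).
      replace (F t (u t) - Q t * (u t - u0 t) - (F t (u' t) - Q t * (u' t - u0 t)))
        with (M t) in h by (unfold M, d; ring).
      apply Rmult_le_compat_r with (r := G t) in h; [| lra].
      replace (4 * (A / G t) * Q t * Rabs (d t) * G t) with (4 * A * Q t * Rabs (d t)) in h
        by (field; lra); assumption. }
    assert (hQa : Q t ^ 2 * r ^ 2 <= Q t * a1 ^ 2).
    { rewrite hr2, ha1s; nra. }
    (* Young's inequality weighted by [sqrt c1 / sqrt G], the bound for [sqrt Q]: the mixed product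
       is controlled by the energy with a gain of [/ sqrt G]. *)
    assert (hcross : 2 * (Q t * Rabs (d t)) * Rabs (d1 t) * r <= a1 * X t).
    { assert (hs : 0 <= (a1 * Rabs (d1 t) - r * Q t * Rabs (d t)) ^ 2) by apply pow2_ge_0.
      pose proof (pow2_abs (d t)) as e1; pose proof (pow2_abs (d1 t)) as e2.
      assert (h1 : 2 * (Q t * Rabs (d t)) * Rabs (d1 t) * r * a1 <=
        a1 ^ 2 * Rabs (d1 t) ^ 2 + Q t ^ 2 * r ^ 2 * Rabs (d t) ^ 2) by lra.
      rewrite e1, e2 in h1.
      assert (h2 : Q t ^ 2 * r ^ 2 * d t ^ 2 <= Q t * a1 ^ 2 * d t ^ 2)
        by (apply Rmult_le_compat_r; [apply pow2_ge_0 | assumption]).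
      apply Rmult_le_reg_r with a1; [assumption |]; unfold X.
      apply Rle_trans with (1 := h1); apply Req_le in e1; lra. }
    assert (hX : 0 <= X t).
    { unfold X; pose proof (pow2_ge_0 (d t)); pose proof (pow2_ge_0 (d1 t)); nra. }
    assert (hterm1 : Rabs (Q1 t * d t ^ 2 * G t) <= 17 / 10 * X t).
    { specialize (fr_Q1 t ltac:(lra)).
      rewrite !Rabs_mult, (Rabs_pos_eq (G t)), (Rabs_pos_eq (d t ^ 2))
        by (lra || apply pow2_ge_0).
      unfold X; pose proof (pow2_ge_0 (d t)); pose proof (pow2_ge_0 (d1 t)); nra. }
    assert (hterm2 : Rabs (2 * d1 t * M t * G t) <= 1 / 20 * X t).
    { rewrite !Rabs_mult, (Rabs_pos_eq 2), (Rabs_pos_eq (G t)) by lra.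
      apply Rle_trans with (2 * Rabs (d1 t) * (4 * A * Q t * Rabs (d t))).
      - rewrite Rmult_assoc; apply Rmult_le_compat_l; [pose proof (Rabs_pos (d1 t)); lra | assumption].
      - apply Rmult_le_reg_r with r; [lra |].
        apply Rle_trans with (4 * A * (a1 * X t)).
        + apply Rle_trans with (4 * A * (2 * (Q t * Rabs (d t)) * Rabs (d1 t) * r)).
          * apply Req_le; ring.
          * apply Rmult_le_compat_l; lra.
        + apply Rle_trans with (80 * A * a1 / 20 * X t); [lra |].
          apply Rle_trans with (r / 20 * X t); [apply Rmult_le_compat_r; lra | lra]. }
    apply Rabs_le_between in hterm1; apply Rabs_le_between in hterm2.
    replace (INR 2 * G1 t * G t ^ 1 * X t + G t ^ 2 * (Q1 t * d t ^ 2 - 2 * d1 t * M t)) with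
      (G t * (2 * G1 t * X t + Q1 t * d t ^ 2 * G t - 2 * d1 t * M t * G t)) by (simpl; ring).
    apply Rmult_le_pos; [lra |].
    (* The balance is [2 * 9/10 - 17/10 - 1/20 > 0]. *)
    assert (9 / 10 * X t <= G1 t * X t) by (apply Rmult_le_compat_r; lra).
    lra.
Qed.

End Energy.

(** [D k] is where the [k]-th function is under control; it is allowed to grow with [k] as long as
    each point of [E] eventually belongs to it. The second index of the Cauchy condition is sent to
    infinity. *)
Lemma Lim_seq_uniform (w : nat -> R -> R) (E : R -> Prop) (D : nat -> R -> Prop) :
  (forall t, E t -> exists N, forall k, (N <= k)%nat -> D k t) ->
  (forall eps, 0 < eps -> exists N, forall k l t, (N <= k)%nat -> (N <= l)%nat ->
     E t -> D k t -> D l t -> Rabs (w k t - w l t) <= eps) ->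
  forall eps, 0 < eps -> exists N, forall k t, (N <= k)%nat ->
     E t -> D k t -> Rabs (w k t - Lim_seq (fun k => w k t)) <= eps.
Proof.
  intros hb hC.
  assert (hlim : forall t, E t -> is_lim_seq (fun k => w k t) (real (Lim_seq (fun k => w k t)))).
  { intros t ht; apply Lim_seq_correct', ex_lim_seq_cauchy_corr; intros eps.
    pose proof (cond_pos eps).
    destruct (hC (eps / 2) ltac:(lra)) as [N1 h1]; destruct (hb t ht) as [N2 h2].
    exists (Nat.max N1 N2); intros k l hk hl.
    apply Rle_lt_trans with (eps / 2); [| lra].
    apply h1; [lia | lia | assumption | apply h2; lia | apply h2; lia]. }
  intros eps heps; destruct (hC eps heps) as [N h]; exists N; intros k t hk ht hD.
  apply le_epsilon; intros e he.
  pose proof (hlim t ht) as hl; apply is_lim_seq_spec in hl.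
  destruct (hl (mkposreal e he)) as [N1 h1]; destruct (hb t ht) as [N2 h2]; simpl in h1.
  set (l := Nat.max N (Nat.max N1 N2)).
  replace (w k t - Lim_seq (fun k => w k t)) with
    (w k t - w l t + (w l t - Lim_seq (fun k => w k t))) by ring.
  apply Rabs_sum_le; [| apply Rlt_le, h1; unfold l; lia].
  apply h; auto; [unfold l; lia | apply h2; unfold l; lia].
Qed.

Section Limit.

Variables (F : R -> R -> R) (T c0 c1 Cp : R) (u0 v0 G G1 J Q Q1 p p1 : R -> R).
Hypothesis fr : frame F T c0 c1 Cp u0 v0 G G1 J Q Q1 p p1.
Hypothesis F_continuous : forall (u : R -> R) t,
  continuous u t -> continuous (fun x => F x (u x)) t.
Hypothesis shooting : forall n, T < n ->
  exists u v, u n = u0 n /\ v n = v0 n /\ forall t, T < t <= n -> solves F u v t.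

(** At [b k] the [k]-th solution agrees with [u0], and a later one is close to [u0] by [tracking].
    [difference_bound] carries this discrepancy back, so the sequence is uniformly Cauchy with rate
    [1 / G (b k)] for the squares. *)
Lemma tracking_solution : exists A T1 u v, 0 < A /\ T <= T1 /\ forall t, T1 < t ->
  solves F u v t /\ Rabs (u t - u0 t) * G t <= A * J t /\ A <= G t / 2.
Proof.
  destruct (tracking _ _ _ _ _ _ _ _ _ _ _ _ _ _ fr)
    as [A [C6 [T1 [hA [hC6 [hT1 [hAG htr]]]]]]].
  set (T2 := T1 + 1).
  set (b := fun k => T2 + INR k).
  assert (hb0 : forall k, T2 <= b k) by (intros k; unfold b; pose proof (pos_INR k); lra).
  assert (hch : forall k, exists uv : (R -> R) * (R -> R), fst uv (b k) = u0 (b k) /\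
    snd uv (b k) = v0 (b k) /\ forall t, T < t <= b k -> solves F (fst uv) (snd uv) t).
  { intros k; destruct (shooting (b k)) as [u [v h]]; [specialize (hb0 k); unfold T2 in hb0; lra |].
    now exists (u, v). }
  set (uv := fun k => proj1_sig (constructive_indefinite_description _ (hch k))).
  set (uu := fun k => fst (uv k)); set (vv := fun k => snd (uv k)).
  assert (huv : forall k, uu k (b k) = u0 (b k) /\ vv k (b k) = v0 (b k) /\
    forall t, T < t <= b k -> solves F (uu k) (vv k) t).
  { intros k; exact (proj2_sig (constructive_indefinite_description _ (hch k))). }
  clearbody uu vv; clear uv hch.
  assert (hbd : forall k t, T1 < t <= b k -> Rabs (uu k t - u0 t) * G t <= A * J t /\
    (vv k t - v0 t) ^ 2 * G t ^ 3 <= C6 ^ 2 * J t ^ 2).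
  { intros k t ht; destruct (huv k) as [h1 [h2 h3]].
    apply (htr (b k) (uu k) (vv k)); auto; intros x hx; apply h3; lra. }
  (* [K / G n] bounds the weighted energy of the discrepancy at [n]: [C6] accounts for slopes, [A]
     for positions with [Q G <= c1]. In [K2], the part [K / c0] serves positions and [K] slopes. *)
  set (K := (C6 ^ 2 + c1 * A ^ 2) * J T2 ^ 2).
  set (K2 := K + K / c0).
  assert (hfr := fr); frame_facts hfr.
  assert (hJ2 : 0 < J T2) by (apply fr_J; unfold T2; lra).
  assert (hK : 0 < K).
  { apply Rmult_lt_0_compat; [| now apply pow_lt].
    apply Rplus_lt_0_compat; [| apply Rmult_lt_0_compat; [assumption |]]; apply pow_lt; lra. }
  assert (hKc : 0 < K / c0) by now apply Rdiv_lt_0_compat.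
  assert (hdiff : forall k l t, (k <= l)%nat -> T2 <= t <= b k ->
    (uu k t - uu l t) ^ 2 <= K2 / G (b k) /\ (vv k t - vv l t) ^ 2 <= K2 / G (b k)).
  { intros k l t hkl ht.
    assert (hbkl : b k <= b l) by (unfold b; apply le_INR in hkl; lra).
    assert (hT : T1 < t) by (unfold T2 in ht; lra).
    assert (h := difference_bound _ _ _ _ _ _ _ _ _ _ _ _ _ _ fr A t (b k)
      (uu k) (vv k) (uu l) (vv l) ltac:(lra) ltac:(lra)).
    assert (h1 : G t ^ 2 * ((vv k t - vv l t) ^ 2 + Q t * (uu k t - uu l t) ^ 2) <=
      G (b k) ^ 2 * ((vv k (b k) - vv l (b k)) ^ 2 + Q (b k) * (uu k (b k) - uu l (b k)) ^ 2)).
    { apply h; [intros x hx; apply hAG; lra |]; intros x hx.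
      split; [apply huv; lra |]; split; [apply huv; lra |].
      split; apply hbd; lra. }
    clear h; destruct (huv k) as [e1 [e2 _]]; rewrite e1, e2 in h1.
    destruct (hbd l (b k)) as [h2 h3]; [lra |].
    set (n := b k) in *.
    assert (hGn : 1 <= G n) by (apply fr_G_ge1; lra).
    assert (hGt : 1 <= G t) by (apply fr_G_ge1; lra).
    assert (hJn : 0 < J n <= J T2).
    { split; [apply fr_J; lra | apply fr_J_decr; unfold T2 in *; lra]. }
    assert (hJn2 : J n ^ 2 <= J T2 ^ 2) by (apply pow_incr; lra).
    destruct (fr_Q_bounds n ltac:(lra)) as [_ hQn].
    destruct (fr_Q_bounds t ltac:(lra)) as [hQt _].
    assert (hrhs : G n ^ 2 * ((v0 n - vv l n) ^ 2 + Q n * (u0 n - uu l n) ^ 2) <= K / G n).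
    { apply Rmult_le_reg_r with (G n); [lra |].
      replace (K / G n * G n) with K by (field; lra).
      assert (h4 : (Rabs (uu l n - u0 n) * G n) ^ 2 <= (A * J n) ^ 2).
      { apply pow_incr; split; [apply Rmult_le_pos; [apply Rabs_pos | lra] | assumption]. }
      rewrite Rpow_mult_distr, pow2_abs in h4.
      replace (G n ^ 2 * ((v0 n - vv l n) ^ 2 + Q n * (u0 n - uu l n) ^ 2) * G n) with
        ((vv l n - v0 n) ^ 2 * G n ^ 3 + Q n * G n * ((uu l n - u0 n) ^ 2 * G n ^ 2)) by ring.
      unfold K; rewrite Rmult_plus_distr_r; apply Rplus_le_compat.
      - apply Rle_trans with (1 := h3); apply Rmult_le_compat_l; [apply pow2_ge_0 | assumption].
      - rewrite (Rmult_assoc c1).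
        apply Rmult_le_compat; [destruct (fr_Q_bounds n ltac:(lra)); lra | | assumption |].
        + apply Rmult_le_pos; apply pow2_ge_0.
        + apply Rle_trans with (1 := h4); rewrite Rpow_mult_distr.
          apply Rmult_le_compat_l; [apply pow2_ge_0 | assumption]. }
    assert (h5 := Rle_trans _ _ _ h1 hrhs).
    pose proof (pow2_ge_0 (vv k t - vv l t)) as hv; pose proof (pow2_ge_0 (uu k t - uu l t)) as hu.
    assert (hG2 : 1 <= G t ^ 2) by nra.
    assert (hQp : 0 <= Q t) by (apply Rmult_le_reg_r with (G t); lra).
    (* The weight [G^2] more than compensates the decay of [Q]: [G^2 Q >= c0 G >= c0]. *)
    assert (h6 : c0 * (uu k t - uu l t) ^ 2 + (vv k t - vv l t) ^ 2 <= K / G n).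
    { apply Rle_trans with (2 := h5).
      replace (G t ^ 2 * ((vv k t - vv l t) ^ 2 + Q t * (uu k t - uu l t) ^ 2)) with
        (G t ^ 2 * (vv k t - vv l t) ^ 2 + (Q t * G t) * G t * (uu k t - uu l t) ^ 2) by ring.
      rewrite Rplus_comm; apply Rplus_le_compat.
      - rewrite <- (Rmult_1_l ((vv k t - vv l t) ^ 2)) at 1; now apply Rmult_le_compat_r.
      - apply Rmult_le_compat_r; [assumption | nra]. }
    assert (hc : 0 <= c0 * (uu k t - uu l t) ^ 2) by (apply Rmult_le_pos; lra).
    assert (hkg : 0 < / G n) by (apply Rinv_0_lt_compat; lra).
    assert (e3 : K2 / G n = K / G n + K / G n / c0) by (unfold K2; field; lra).
    assert (e4 : 0 < K / G n) by (apply Rdiv_lt_0_compat; lra).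
    assert (e5 : 0 < K / G n / c0) by (apply Rdiv_lt_0_compat; lra).
    rewrite e3; split; [| lra].
    apply Rle_trans with (K / G n / c0); [| lra].
    apply Rmult_le_reg_l with c0; [assumption |].
    replace (c0 * (K / G n / c0)) with (K / G n) by (field; lra); lra. }
  assert (hcauchy : forall eps, 0 < eps -> exists N, forall k l t, (N <= k)%nat -> (N <= l)%nat ->
    T2 <= t -> t <= b k -> t <= b l ->
    Rabs (uu k t - uu l t) <= eps /\ Rabs (vv k t - vv l t) <= eps).
  { intros eps heps.
    destruct (INR_unbounded (2 * K2 / eps ^ 2)) as [N hN].
    assert (he2 : 0 < eps ^ 2) by now apply pow_lt.
    assert (hK2 : 0 < K2) by (unfold K2; lra).
    assert (hsmall : forall k, (N <= k)%nat -> K2 / G (b k) <= eps ^ 2).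
    { intros k hk; apply le_INR in hk.
      assert (hG := clock _ _ _ _ _ _ _ _ _ _ _ _ _ _ fr T2 (b k) ltac:(unfold T2; lra) (hb0 k)).
      assert (hGT := fr_G_ge1 T2 ltac:(unfold T2; lra)).
      assert (hbk : b k - T2 = INR k) by (unfold b; ring); rewrite hbk in hG.
      assert (hp : 0 < 2 * K2 / eps ^ 2) by (apply Rdiv_lt_0_compat; lra).
      apply Rmult_le_reg_r with (G (b k)); [lra |].
      replace (K2 / G (b k) * G (b k)) with K2 by (field; lra).
      replace K2 with (eps ^ 2 * (2 * K2 / eps ^ 2 / 2)) by (field; lra).
      apply Rmult_le_compat_l; lra. }
    assert (hle : forall k l t, (N <= k)%nat -> (k <= l)%nat -> T2 <= t <= b k ->
      Rabs (uu k t - uu l t) <= eps /\ Rabs (vv k t - vv l t) <= eps).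
    { intros k l t hk hkl ht; destruct (hdiff k l t hkl ht) as [h1 h2].
      specialize (hsmall k hk); split; apply abs_le_of_sq; lra. }
    exists N; intros k l t hk hl ht htk htl.
    destruct (Nat.le_ge_cases k l) as [h | h]; [apply hle; auto |].
    rewrite (Rabs_minus_sym (uu k t)), (Rabs_minus_sym (vv k t)); apply hle; auto. }
  assert (hbinf : forall t, exists N, forall k, (N <= k)%nat -> t <= b k).
  { intros t; destruct (INR_unbounded (t - T2)) as [N hN]; exists N; intros k hk.
    apply le_INR in hk; unfold b; lra. }
  set (u := fun t => real (Lim_seq (fun k => uu k t))).
  set (v := fun t => real (Lim_seq (fun k => vv k t))).
  assert (hu : forall eps, 0 < eps -> exists N, forall k t, (N <= k)%nat ->
    T2 <= t -> t <= b k -> Rabs (uu k t - u t) <= eps).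
  { apply (Lim_seq_uniform uu (fun t => T2 <= t) (fun k t => t <= b k)); [auto |].
    intros eps heps; destruct (hcauchy eps heps) as [N h]; exists N; intros; now apply h. }
  assert (hv : forall eps, 0 < eps -> exists N, forall k t, (N <= k)%nat ->
    T2 <= t -> t <= b k -> Rabs (vv k t - v t) <= eps).
  { apply (Lim_seq_uniform vv (fun t => T2 <= t) (fun k t => t <= b k)); [auto |].
    intros eps heps; destruct (hcauchy eps heps) as [N h]; exists N; intros; now apply h. }
  assert (hbdu : forall t, T2 < t -> Rabs (u t - u0 t) * G t <= A * J t).
  { intros t ht; apply le_epsilon; intros e he.
    assert (hG : 1 <= G t) by (apply fr_G_ge1; unfold T2 in ht; lra).
    destruct (hu (e / G t)) as [N1 h1]; [apply Rdiv_lt_0_compat; lra |].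
    destruct (hbinf t) as [N2 h2]; set (k := Nat.max N1 N2).
    assert (hk : t <= b k) by (apply h2; unfold k; lia).
    specialize (h1 k t ltac:(unfold k; lia) ltac:(lra) hk).
    destruct (hbd k t ltac:(unfold T2 in ht; lra)) as [h3 _].
    replace (u t - u0 t) with (uu k t - u0 t + - (uu k t - u t)) by ring.
    apply Rle_trans with ((Rabs (uu k t - u0 t) + e / G t) * G t).
    - apply Rmult_le_compat_r; [lra |]; apply Rabs_sum_le; [lra | now rewrite Rabs_Ropp].
    - rewrite Rmult_plus_distr_r; replace (e / G t * G t) with e by (field; lra); lra. }
  exists A, T2, u, v; split; [lra |]; split; [unfold T2; lra |]; intros t ht.
  assert (htT : T1 < t) by (unfold T2 in ht; lra).
  split; [| split; [now apply hbdu | apply hAG; assumption]].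
  destruct (hbinf (t + 1)) as [N0 hN0].
  assert (hloc : forall w W : _, (forall eps, 0 < eps -> exists N, forall k t, (N <= k)%nat ->
     T2 <= t -> t <= b k -> Rabs (w k t - W t) <= eps) ->
    forall eps, 0 < eps -> exists N, forall n y, (N <= n)%nat -> T2 < y < t + 1 ->
      Rabs (w n y - W y) <= eps).
  { intros w W h eps heps; destruct (h eps heps) as [N h1]; exists (Nat.max N N0).
    intros n y hn hy; apply h1; [lia | lra |].
    specialize (hN0 n ltac:(lia)); lra. }
  assert (hsolk : forall k y, (N0 <= k)%nat -> T2 < y < t + 1 -> solves F (uu k) (vv k) y).
  { intros k y hk hy; apply huv; specialize (hN0 k hk); unfold T2 in hy; lra. }
  split.
  - apply (limit_derive uu vv u v T2 (t + 1) t N0); [lra | | | exact (hloc _ _ hu) | exact (hloc _ _ hv)].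
    + intros k y hk hy; exact (proj1 (hsolk k y hk hy)).
    + intros k hk; apply (ex_derive_continuous (vv k)).
      eexists; exact (proj2 (hsolk k t hk ltac:(lra))).
  - apply (limit_derive vv (fun k y => - F y (uu k y)) v (fun y => - F y (u y))
      T2 (t + 1) t N0); [lra | | | exact (hloc _ _ hv) |].
    + intros k y hk hy; exact (proj2 (hsolk k y hk hy)).
    + intros k hk; apply (continuous_opp (fun y => F y (uu k y))), F_continuous.
      apply (ex_derive_continuous (uu k)).
      eexists; exact (proj1 (hsolk k t hk ltac:(lra))).
    + intros eps heps.
      (* With [l = 1 / 2] the nonlinear part of [F] has Lipschitz constant [2 Q]; adding the linear
         part gives [3 Q <= 3 c1]. *)
      destruct (hloc _ _ hu (eps / (3 * c1))) as [N h]; [apply Rdiv_lt_0_compat; lra |].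
      exists (Nat.max N N0); intros k y hk hy.
      specialize (h k y ltac:(lia) hy).
      assert (hyT : T1 < y) by (unfold T2 in hy; lra).
      assert (hG : 1 <= G y) by (apply fr_G_ge1; lra).
      destruct (hAG y hyT) as [hAy _].
      pose proof (fr_J y ltac:(lra)) as hJ.
      assert (hx : forall x, Rabs x * G y <= A * J y -> Rabs x <= 1 / 2 * J y).
      { intros x hx; apply Rmult_le_reg_r with (G y); [lra |].
        apply Rle_trans with (1 := hx); nra. }
      assert (hyk : y <= b k) by (specialize (hN0 k ltac:(lia)); lra).
      destruct (hbd k y ltac:(lra)) as [hk1 _].
      assert (h1 := fr_F y (1 / 2) _ _ ltac:(lra) ltac:(lra) (hx _ hk1) (hx _ (hbdu y ltac:(lra)))).
      replace (u0 y + (uu k y - u0 y)) with (uu k y) in h1 by ring.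
      replace (u0 y + (u y - u0 y)) with (u y) in h1 by ring.
      set (d := uu k y - u y) in *.
      replace (uu k y - u0 y - (u y - u0 y)) with d in h1 by (unfold d; ring).
      replace (- F y (uu k y) - - F y (u y)) with
        (- (F y (uu k y) - Q y * (uu k y - u0 y) - (F y (u y) - Q y * (u y - u0 y))) + - Q y * d)
        by (unfold d; ring).
      destruct (fr_Q_bounds y ltac:(lra)) as [hQ0 hQ1].
      assert (hQ : 0 <= Q y) by (apply Rmult_le_reg_r with (G y); lra).
      assert (hQc : Q y <= c1) by nra.
      apply Rle_trans with (4 * (1 / 2) * Q y * Rabs d + Q y * Rabs d).
      * apply Rabs_sum_le; [now rewrite Rabs_Ropp |].
        rewrite Rabs_mult, Rabs_Ropp, (Rabs_pos_eq (Q y)); lra.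
      * apply Rle_trans with (3 * c1 * (eps / (3 * c1))); [| apply Req_le; field; lra].
        replace (4 * (1 / 2) * Q y * Rabs d + Q y * Rabs d) with (3 * Q y * Rabs d) by field.
        apply Rmult_le_compat; [lra | apply Rabs_pos | lra | assumption].
Qed.

End Limit.

(** * Backward global existence *)

Lemma is_derive_primitive (h : R -> R) (T t : R) :
  (forall x, continuous h x) -> is_derive (fun x => RInt h T x) t (h t).
Proof.
  intros hc; apply is_derive_RInt with (a := T); [| apply hc].
  exists (mkposreal 1 Rlt_0_1); intros y _.
  apply RInt_correct, ex_RInt_continuous; intros; apply hc.
Qed.

Lemma continuous_bounded (h : R -> R) (a b : R) :
  (forall x, continuous h x) -> exists M, 0 <= M /\ forall x, a <= x <= b -> Rabs (h x) <= M.
Proof.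
  intros hc; destruct (Rle_dec a b) as [hab | hab].
  - destruct (continuity_ab_maj (fun x => Rabs (h x)) a b hab) as [m [hm _]].
    + intros x _; apply continuity_pt_filterlim.
      apply (continuous_comp h Rabs); [apply hc | apply continuous_Rabs].
    + exists (Rabs (h m)); split; [apply Rabs_pos | exact hm].
  - exists 0; split; [lra | intros; lra].
Qed.

(** In the weight [exp (lam |t - T|)], integration from [T] gains a factor [1 / lam], on an interval
    of any length. The signs [s = 1] and [s = -1] treat the two sides and avoid differentiating
    [Rabs] at [T]. *)
Lemma primitive_exp_upper (P h : R -> R) (T X c lam : R) :
  0 < lam -> 0 <= c -> P T = 0 -> (forall t, is_derive P t (h t)) ->
  (forall t, Rabs (t - T) <= X -> Rabs (h t) <= c * exp (lam * Rabs (t - T))) ->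
  forall t, Rabs (t - T) <= X -> P t <= c / lam * exp (lam * Rabs (t - T)).
Proof.
  intros hlam hc hPT hP hh t ht.
  assert (h0 : 0 <= c / lam) by (apply Rmult_le_pos; [assumption | now apply Rlt_le, Rinv_0_lt_compat]).
  assert (hd : forall s x, is_derive (fun x => c / lam * exp (lam * (s * (x - T)))) x
    (s * (c * exp (lam * (s * (x - T)))))).
  { intros s x; auto_derive; [trivial |]; unfold Rminus; field; lra. }
  destruct (Rle_dec T t) as [hTt | hTt].
  - rewrite Rabs_pos_eq in ht |- * by lra.
    assert (hi := increment_le (fun x => c / lam * exp (lam * (1 * (x - T))) - P x)
      (fun x => 1 * (c * exp (lam * (1 * (x - T)))) - h x) T t 0 hTt); cbv beta in hi.
    replace (1 * (t - T)) with (t - T) in hi by ring; replace (1 * (T - T)) with 0 in hi by ring.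
    rewrite Rmult_0_r, exp_0, hPT in hi.
    enough (0 * (t - T) <= c / lam * exp (lam * (t - T)) - P t - (c / lam * 1 - 0)) by lra.
    apply hi.
    + intros x hx; apply (is_derive_minus (fun x => c / lam * exp (lam * (1 * (x - T)))) P); auto.
    + intros x hx; assert (h1 := hh x); rewrite Rabs_pos_eq in h1 by lra.
      specialize (h1 ltac:(lra)); rewrite !Rmult_1_l; pose proof (Rle_abs (h x)); lra.
  - rewrite Rabs_left in ht |- * by lra.
    assert (hi := increment_ge (fun x => c / lam * exp (lam * (-1 * (x - T))) - P x)
      (fun x => -1 * (c * exp (lam * (-1 * (x - T)))) - h x) t T 0 ltac:(lra)); cbv beta in hi.
    replace (-1 * (T - T)) with 0 in hi by ring; rewrite Rmult_0_r, exp_0, hPT in hi.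
    replace (- (t - T)) with (-1 * (t - T)) by ring.
    enough (c / lam * 1 - 0 - (c / lam * exp (lam * (-1 * (t - T))) - P t) <= 0 * (T - t)) by lra.
    apply hi.
    + intros x hx; apply (is_derive_minus (fun x => c / lam * exp (lam * (-1 * (x - T)))) P); auto.
    + intros x hx; assert (h1 := hh x); rewrite Rabs_left1 in h1 by lra.
      specialize (h1 ltac:(lra)); replace (-1 * (x - T)) with (- (x - T)) by ring.
      pose proof (Rabs_maj2 (h x)); lra.
Qed.

Lemma primitive_exp_bound (P h : R -> R) (T X c lam : R) :
  0 < lam -> 0 <= c -> P T = 0 -> (forall t, is_derive P t (h t)) ->
  (forall t, Rabs (t - T) <= X -> Rabs (h t) <= c * exp (lam * Rabs (t - T))) ->
  forall t, Rabs (t - T) <= X -> Rabs (P t) <= c / lam * exp (lam * Rabs (t - T)).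
Proof.
  intros hlam hc hPT hP hh t ht; apply Rabs_le; split.
  - enough (- P t <= c / lam * exp (lam * Rabs (t - T))) by lra.
    apply (primitive_exp_upper (fun t => - P t) (fun t => - h t) T X); auto.
    + lra.
    + intros x; apply (is_derive_opp P), hP.
    + intros x hx; rewrite Rabs_Ropp; auto.
  - apply (primitive_exp_upper P h T X); auto.
Qed.

(** * Picard iteration for a globally Lipschitz nonlinearity *)

Section Picard.

Variables (w phi : R -> R) (L T a b : R).
Hypothesis w_continuous : forall t, continuous w t.
Hypothesis L_pos : 0 <= L.
Hypothesis phi_lipschitz : forall x y, Rabs (phi x - phi y) <= L * Rabs (x - y).

Let slope (u : R -> R) (t : R) : R := b - RInt (fun s => w s * phi (u s)) T t.

Fixpoint picard (k : nat) : R -> R :=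
  match k with
  | O => fun _ => a
  | S k' => fun t => a + RInt (slope (picard k')) T t
  end.

Lemma phi_continuous x : continuous phi x.
Proof.
  intros P [eps hP].
  assert (hd : 0 < eps / (L + 1)) by (apply Rdiv_lt_0_compat; [apply cond_pos | lra]).
  exists (mkposreal _ hd); intros y hy; apply hP.
  change (Rabs (y - x) < eps / (L + 1)) in hy; change (Rabs (phi y - phi x) < eps).
  apply Rle_lt_trans with (1 := phi_lipschitz y x).
  apply Rle_lt_trans with ((L + 1) * Rabs (y - x)); [pose proof (Rabs_pos (y - x)); lra |].
  apply Rmult_lt_reg_r with (/ (L + 1)); [apply Rinv_0_lt_compat; lra |].
  replace ((L + 1) * Rabs (y - x) * / (L + 1)) with (Rabs (y - x)) by (field; lra).
  exact hy.
Qed.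

Lemma slope_derive u t : (forall x, continuous u x) ->
  is_derive (slope u) t (- (w t * phi (u t))).
Proof.
  intros hu; rewrite <- (Rplus_0_l (- (w t * phi (u t)))).
  apply (is_derive_minus (fun _ => b) (fun t => RInt (fun s => w s * phi (u s)) T t));
    [apply (is_derive_const b t) |].
  apply (is_derive_primitive (fun s => w s * phi (u s))); intros x.
  apply (continuous_mult w (fun s => phi (u s))); [apply w_continuous |].
  apply (continuous_comp u phi); [apply hu | apply phi_continuous].
Qed.

Lemma picard_continuous k : forall x, continuous (picard k) x.
Proof.
  induction k as [| k IH]; intros x; [apply continuous_const |].
  apply (ex_derive_continuous (picard (S k))); simpl.
  apply (ex_derive_plus (fun _ => a) (fun t => RInt (slope (picard k)) T t));
    [apply ex_derive_const |].
  eexists; apply is_derive_primitive; intros y.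
  apply (ex_derive_continuous (slope (picard k))).
  eexists; now apply slope_derive.
Qed.

Lemma picard_derive k t : is_derive (picard (S k)) t (slope (picard k) t).
Proof.
  simpl; rewrite <- (Rplus_0_l (slope (picard k) t)).
  apply (is_derive_plus (fun _ => a) (fun t => RInt (slope (picard k)) T t));
    [apply (is_derive_const a t) |].
  apply is_derive_primitive; intros y.
  apply (ex_derive_continuous (slope (picard k))).
  eexists; apply slope_derive, picard_continuous.
Qed.

Lemma slope_contract (u u' : R -> R) (X W c lam : R) :
  (forall x, continuous u x) -> (forall x, continuous u' x) ->
  0 < lam -> 0 <= c -> 0 <= W ->
  (forall t, Rabs (t - T) <= X -> Rabs (w t) <= W) ->
  (forall t, Rabs (t - T) <= X -> Rabs (u t - u' t) <= c * exp (lam * Rabs (t - T))) ->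
  forall t, Rabs (t - T) <= X ->
    Rabs (slope u t - slope u' t) <= W * L * c / lam * exp (lam * Rabs (t - T)).
Proof.
  intros hu hu' hlam hc hW0 hW hd t ht.
  apply (primitive_exp_bound (fun t => slope u t - slope u' t)
    (fun t => - (w t * phi (u t)) - - (w t * phi (u' t))) T X); auto.
  - repeat apply Rmult_le_pos; assumption.
  - unfold slope; rewrite !RInt_point; apply Rminus_diag.
  - intros x; apply (is_derive_minus (slope u) (slope u')); now apply slope_derive.
  - intros x hx.
    replace (- (w x * phi (u x)) - - (w x * phi (u' x))) with
      (- w x * (phi (u x) - phi (u' x))) by ring.
    replace (W * L * c * exp (lam * Rabs (x - T))) with
      (W * (L * (c * exp (lam * Rabs (x - T))))) by ring.
    apply Rabs_prod_le; [rewrite Rabs_Ropp; auto |].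
    apply Rle_trans with (1 := phi_lipschitz _ _), Rmult_le_compat_l; auto.
Qed.

(** The first integration contracts by [W * L / lam <= 1 / 2]; the second costs [1 / lam <= 1].
    Slopes and iterates are bounded together because both must converge. *)
Lemma picard_step (X W c lam : R) (k l : nat) :
  0 < lam -> 0 <= c -> 0 <= W -> 2 * (W * L) <= lam -> 1 <= lam ->
  (forall t, Rabs (t - T) <= X -> Rabs (w t) <= W) ->
  (forall t, Rabs (t - T) <= X ->
    Rabs (picard k t - picard l t) <= c * exp (lam * Rabs (t - T))) ->
  forall t, Rabs (t - T) <= X ->
    Rabs (slope (picard k) t - slope (picard l) t) <= c / 2 * exp (lam * Rabs (t - T)) /\
    Rabs (picard (S k) t - picard (S l) t) <= c / 2 * exp (lam * Rabs (t - T)).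
Proof.
  intros hlam hc hW0 hWL hlam1 hW hd.
  assert (hs : forall t, Rabs (t - T) <= X ->
    Rabs (slope (picard k) t - slope (picard l) t) <= c / 2 * exp (lam * Rabs (t - T))).
  { intros t ht.
    apply Rle_trans with (W * L * c / lam * exp (lam * Rabs (t - T))).
    - apply (slope_contract _ _ X W c lam); auto using picard_continuous.
    - apply Rmult_le_compat_r; [apply Rlt_le, exp_pos |].
      apply Rmult_le_reg_r with lam; [assumption |].
      replace (W * L * c / lam * lam) with (W * L * c) by (field; lra); nra. }
  intros t ht; split; [now apply hs |].
  apply Rle_trans with (c / 2 / lam * exp (lam * Rabs (t - T))).
  - apply (primitive_exp_bound (fun t => picard (S k) t - picard (S l) t)
      (fun t => slope (picard k) t - slope (picard l) t) T X); auto; [lra | |].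
    + simpl; rewrite !RInt_point; unfold zero; simpl; ring.
    + intros x; apply (is_derive_minus (picard (S k)) (picard (S l))); apply picard_derive.
  - apply Rmult_le_compat_r; [apply Rlt_le, exp_pos |].
    apply Rmult_le_reg_r with lam; [assumption |].
    replace (c / 2 / lam * lam) with (c / 2) by (field; lra); nra.
Qed.

Lemma picard_uniform_cauchy (X : R) : 0 <= X -> forall eps, 0 < eps ->
  exists N, forall k l t, (N <= k)%nat -> (N <= l)%nat -> Rabs (t - T) <= X ->
    Rabs (picard k t - picard l t) <= eps /\
    Rabs (slope (picard k) t - slope (picard l) t) <= eps.
Proof.
  intros hX.
  assert (hX' : forall t, Rabs (t - T) <= X -> T - X <= t <= T + X).
  { intros t ht; apply Rabs_le_between in ht; lra. }
  destruct (continuous_bounded w (T - X) (T + X) w_continuous) as [W [hW0 hW]].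
  destruct (continuous_bounded (fun t => picard 1 t - picard 0 t) (T - X) (T + X)) as [c [hc0 hc]].
  { intros x; apply (continuous_minus (picard 1) (picard 0)); apply picard_continuous. }
  set (lam := 1 + 2 * (W * L)).
  assert (hWL : 0 <= W * L) by now apply Rmult_le_pos.
  assert (hstep : forall k c', 0 <= c' -> (forall t, Rabs (t - T) <= X ->
    Rabs (picard (S k) t - picard k t) <= c' * exp (lam * Rabs (t - T))) ->
    forall t, Rabs (t - T) <= X ->
    Rabs (picard (S (S k)) t - picard (S k) t) <= c' / 2 * exp (lam * Rabs (t - T))).
  { intros k c' hc' h t ht.
    apply (picard_step X W c' lam (S k) k); auto; unfold lam; lra. }
  assert (hgeom : forall k, 0 <= c * (/ 2) ^ k /\ forall t, Rabs (t - T) <= X ->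
    Rabs (picard (S k) t - picard k t) <= c * (/ 2) ^ k * exp (lam * Rabs (t - T))).
  { induction k as [| k [IH1 IH2]].
    - split; [simpl; lra |]; intros t ht.
      apply Rle_trans with (1 := hc t (hX' t ht)).
      replace (c * (/ 2) ^ 0) with c by (simpl; ring).
      rewrite <- (Rmult_1_r c) at 1.
      apply Rmult_le_compat_l; [assumption |].
      pose proof (exp_ineq1_le (lam * Rabs (t - T))); pose proof (Rabs_pos (t - T)).
      assert (0 <= lam * Rabs (t - T)) by (apply Rmult_le_pos; unfold lam; lra); lra.
    - replace (c * (/ 2) ^ S k) with (c * (/ 2) ^ k / 2) by (simpl; field).
      split; [lra | apply hstep; auto]. }
  set (E := exp (lam * X)).
  assert (hE : 0 < E) by apply exp_pos.
  assert (hexp : forall t, Rabs (t - T) <= X -> exp (lam * Rabs (t - T)) <= E).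
  { intros t ht; assert (hle : lam * Rabs (t - T) <= lam * X)
      by (apply Rmult_le_compat_l; unfold lam; lra).
    destruct hle as [hlt | ->]; [now apply Rlt_le, exp_increasing | apply Rle_refl]. }
  (* The exact geometric partial sum is kept, so that the induction on [m] closes; the negative term
     is dropped afterwards. *)
  assert (hsum : forall k m t, Rabs (t - T) <= X -> Rabs (picard (m + k) t - picard k t) <=
    (2 * c * (/ 2) ^ k - 2 * c * (/ 2) ^ (m + k)) * exp (lam * Rabs (t - T))).
  { intros k m t ht; induction m as [| m IH].
    - simpl; rewrite !Rminus_diag, Rabs_R0; lra.
    - replace (picard (S m + k) t - picard k t) with
        ((picard (S (m + k)) t - picard (m + k) t) + (picard (m + k) t - picard k t))
        by (simpl; ring).
      replace ((2 * c * (/ 2) ^ k - 2 * c * (/ 2) ^ (S m + k)) * exp (lam * Rabs (t - T))) with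
        (c * (/ 2) ^ (m + k) * exp (lam * Rabs (t - T))
         + (2 * c * (/ 2) ^ k - 2 * c * (/ 2) ^ (m + k)) * exp (lam * Rabs (t - T)))
        by (simpl; field).
      apply Rabs_sum_le; [now apply hgeom | assumption]. }
  assert (hcauchy : forall k l t, (k <= l)%nat -> Rabs (t - T) <= X ->
    Rabs (picard l t - picard k t) <= 2 * c * (/ 2) ^ k * exp (lam * Rabs (t - T))).
  { intros k l t hkl ht; replace l with ((l - k) + k)%nat by lia.
    apply Rle_trans with (1 := hsum k (l - k)%nat t ht).
    apply Rmult_le_compat_r; [apply Rlt_le, exp_pos |].
    destruct (hgeom (l - k + k)%nat); lra. }
  assert (hboth : forall k l t, (k <= l)%nat -> Rabs (t - T) <= X ->
    Rabs (picard l t - picard k t) <= 2 * c * (/ 2) ^ k * E /\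
    Rabs (slope (picard l) t - slope (picard k) t) <= 2 * c * (/ 2) ^ k * E).
  { intros k l t hkl ht; destruct (hgeom k) as [hk _].
    split.
    - apply Rle_trans with (1 := hcauchy k l t hkl ht), Rmult_le_compat_l; [lra | auto].
    - destruct (picard_step X W (2 * c * (/ 2) ^ k) lam l k ltac:(unfold lam; lra) ltac:(lra)
        hW0 ltac:(unfold lam; lra) ltac:(unfold lam; lra)
        (fun t h => hW t (hX' t h)) (fun t h => hcauchy k l t hkl h) t ht) as [h1 _].
      apply Rle_trans with (1 := h1), Rmult_le_compat; [lra | apply Rlt_le, exp_pos | lra | auto]. }
  intros eps heps.
  destruct (pow_lt_1_zero (/ 2) ltac:(rewrite Rabs_pos_eq; lra) (eps / (2 * c * E + 1))) as [N hN].
  { apply Rdiv_lt_0_compat; [assumption |].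
    assert (0 <= 2 * c * E) by (apply Rmult_le_pos; lra); lra. }
  assert (hsmall : forall k, (N <= k)%nat -> 2 * c * (/ 2) ^ k * E <= eps).
  { intros k hk; specialize (hN k hk).
    assert (hp : 0 < (/ 2) ^ k) by (apply pow_lt; lra).
    rewrite Rabs_pos_eq in hN by lra.
    assert (h0 : 0 <= 2 * c * E) by (apply Rmult_le_pos; lra).
    apply Rmult_lt_compat_r with (r := 2 * c * E + 1) in hN; [| lra].
    replace (eps / (2 * c * E + 1) * (2 * c * E + 1)) with eps in hN by (field; lra).
    nra. }
  exists N; intros k l t hk hl ht.
  destruct (Nat.le_ge_cases k l) as [h | h].
  - rewrite (Rabs_minus_sym (picard k t)), (Rabs_minus_sym (slope (picard k) t)).
    destruct (hboth k l t h ht); specialize (hsmall k hk); lra.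
  - destruct (hboth l k t h ht); specialize (hsmall l hl); lra.
Qed.

Lemma picard_solution : exists u v : R -> R, u T = a /\ v T = b /\
  forall t, is_derive u t (v t) /\ is_derive v t (- (w t * phi (u t))).
Proof.
  (* The shift makes [vk k] the exact derivative of [uk k]. The derivative of [vk (S k)] in turn
     involves [uk k], hence the shifted sequence in the second use of [limit_derive]. *)
  set (uk := fun k => picard (S k)); set (vk := fun k => slope (picard k)).
  set (u := fun t => real (Lim_seq (fun k => uk k t))).
  set (v := fun t => real (Lim_seq (fun k => vk k t))).
  assert (hunif : forall X, 0 <= X -> forall eps, 0 < eps -> exists N, forall k t,
    (N <= k)%nat -> Rabs (t - T) <= X ->
    Rabs (uk k t - u t) <= eps /\ Rabs (vk k t - v t) <= eps).
  { intros X hX eps heps.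
    destruct (Lim_seq_uniform uk (fun t => Rabs (t - T) <= X) (fun _ _ => True)) with (eps := eps)
      as [N1 h1]; auto.
    { now exists O. }
    { intros e he; destruct (picard_uniform_cauchy X hX e he) as [N h]; exists N.
      intros k l t hk hl ht _ _; apply h; auto; lia. }
    destruct (Lim_seq_uniform vk (fun t => Rabs (t - T) <= X) (fun _ _ => True)) with (eps := eps)
      as [N2 h2]; auto.
    { now exists O. }
    { intros e he; destruct (picard_uniform_cauchy X hX e he) as [N h]; exists N.
      intros k l t hk hl ht _ _; apply h; auto. }
    exists (Nat.max N1 N2); intros k t hk ht; split; [apply h1 | apply h2]; auto; lia. }
  exists u, v; split; [| split].
  - unfold u, uk; rewrite (Lim_seq_ext _ (fun _ => a)); [now rewrite Lim_seq_const |].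
    intros k; simpl; rewrite RInt_point; unfold zero; simpl; ring.
  - unfold v, vk, slope; rewrite (Lim_seq_ext _ (fun _ => b)); [now rewrite Lim_seq_const |].
    intros k; rewrite RInt_point; unfold zero; simpl; ring.
  - intros t; set (X := Rabs (t - T) + 1).
    assert (hX : 0 <= X) by (unfold X; pose proof (Rabs_pos (t - T)); lra).
    assert (hin : forall y, t - 1 < y < t + 1 -> Rabs (y - T) <= X).
    { intros y hy; unfold X; replace (y - T) with (t - T + (y - t)) by ring.
      apply Rabs_sum_le; [apply Rle_refl | apply Rabs_le; lra]. }
    assert (hu : forall eps, 0 < eps -> exists N, forall n y, (N <= n)%nat ->
      t - 1 < y < t + 1 -> Rabs (uk n y - u y) <= eps).
    { intros eps heps; destruct (hunif X hX eps heps) as [N h]; exists N.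
      intros n y hn hy; apply h; auto. }
    assert (hv : forall eps, 0 < eps -> exists N, forall n y, (N <= n)%nat ->
      t - 1 < y < t + 1 -> Rabs (vk n y - v y) <= eps).
    { intros eps heps; destruct (hunif X hX eps heps) as [N h]; exists N.
      intros n y hn hy; apply h; auto. }
    assert (hdv : forall k x, is_derive (vk k) x (- (w x * phi (picard k x)))).
    { intros k x; apply slope_derive, picard_continuous. }
    split.
    + apply (limit_derive uk vk u v (t - 1) (t + 1) t 0); auto; [lra | |].
      * intros n y _ _; apply picard_derive.
      * intros n _; apply (ex_derive_continuous (vk n)); eexists; apply hdv.
    + apply (limit_derive (fun k => vk (S k)) (fun k x => - (w x * phi (uk k x)))
        v (fun x => - (w x * phi (u x))) (t - 1) (t + 1) t 0); [lra | | | |].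
      * intros n y _ _; apply hdv.
      * intros n _; apply (continuous_opp (fun x => w x * phi (uk n x))).
        apply (continuous_mult w (fun x => phi (uk n x))); [apply w_continuous |].
        apply (continuous_comp (uk n) phi); [apply picard_continuous | apply phi_continuous].
      * intros eps heps; destruct (hv eps heps) as [N h]; exists N.
        intros n y hn hy; apply h; [lia | assumption].
      * intros eps heps.
        destruct (continuous_bounded w (t - 1) (t + 1) w_continuous) as [W [hW0 hW]].
        assert (hWL : 0 <= W * L) by now apply Rmult_le_pos.
        destruct (hu (eps / (W * L + 1))) as [N h]; [apply Rdiv_lt_0_compat; lra |].
        exists N; intros n y hn hy; specialize (h n y hn hy).
        replace (- (w y * phi (uk n y)) - - (w y * phi (u y))) with
          (- w y * (phi (uk n y) - phi (u y))) by ring.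
        apply Rle_trans with (W * (L * (eps / (W * L + 1)))).
        -- apply Rabs_prod_le; [rewrite Rabs_Ropp; apply hW; lra |].
           apply Rle_trans with (1 := phi_lipschitz _ _), Rmult_le_compat_l; assumption.
        -- apply Rmult_le_reg_r with (W * L + 1); [lra |].
           replace (W * (L * (eps / (W * L + 1))) * (W * L + 1)) with (W * L * eps) by (field; lra).
           nra.
Qed.

End Picard.

(** * The nonlinearity continued to negative arguments *)

Lemma Rmax_lipschitz (a x y : R) : Rabs (Rmax a x - Rmax a y) <= Rabs (x - y).
Proof. unfold Rmax, Rabs; repeat destruct Rle_dec; repeat destruct Rcase_abs; lra. Qed.

Lemma Rmin_lipschitz (a x y : R) : Rabs (Rmin a x - Rmin a y) <= Rabs (x - y).
Proof. unfold Rmin, Rabs; repeat destruct Rle_dec; repeat destruct Rcase_abs; lra. Qed.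

Lemma within_eps (D : R -> Prop) (h : R -> R) (x l : R) :
  filterlim h (within D (locally x)) (locally l) ->
  forall eps, 0 < eps -> exists del, 0 < del /\
    forall y, Rabs (y - x) < del -> D y -> Rabs (h y - l) < eps.
Proof.
  intros hl eps heps.
  destruct (hl (ball l (mkposreal eps heps)) (locally_ball _ _)) as [del hdel].
  exists del; split; [apply cond_pos |]; intros y hy hD; exact (hdel y hy hD).
Qed.

Lemma continuous_eps (h : R -> R) (x : R) :
  (forall eps, 0 < eps -> exists del, 0 < del /\
     forall y, Rabs (y - x) < del -> Rabs (h y - h x) < eps) -> continuous h x.
Proof.
  intros hh P [eps hP]; destruct (hh eps (cond_pos eps)) as [del [hdel hd]].
  exists (mkposreal del hdel); intros y hy; apply hP, hd, hy.
Qed.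

Section Nonlinearity.

Variable f : R -> R.
Hypothesis f_C1 : C1_nonneg f.

(** The difference quotient of [f] is bounded near [Rmax 0 x] within the half-line, and the
    projection [Rmax 0] is 1-Lipschitz; this also covers the one-sided point [0]. *)
Lemma ext0_continuous x : continuous (ext0 f) x.
Proof.
  destruct f_C1 as [df hdf].
  set (x' := Rmax 0 x); assert (hx' : 0 <= x') by apply Rmax_l.
  destruct (hdf x' hx') as [hq _].
  destruct (within_eps _ _ _ _ hq 1 Rlt_0_1) as [d [hd h]].
  apply continuous_eps; intros eps heps.
  set (K := Rabs (df x') + 1); assert (hK : 0 < K) by (unfold K; pose proof (Rabs_pos (df x')); lra).
  exists (Rmin d (eps / K)); split.
  { apply Rmin_glb_lt; [assumption | now apply Rdiv_lt_0_compat]. }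
  intros y hy; unfold ext0; fold x'; set (y' := Rmax 0 y).
  assert (hyx : Rabs (y' - x') <= Rabs (y - x)) by apply Rmax_lipschitz.
  assert (hy1 : Rabs (y' - x') < d) by (pose proof (Rmin_l d (eps / K)); lra).
  assert (hy2 : Rabs (y' - x') < eps / K) by (pose proof (Rmin_r d (eps / K)); lra).
  destruct (Req_dec y' x') as [-> | hne]; [rewrite Rminus_diag, Rabs_R0; assumption |].
  assert (hqy : Rabs ((f y' - f x') / (y' - x')) <= K).
  { specialize (h y' hy1 (conj (Rmax_l _ _) hne)).
    replace ((f y' - f x') / (y' - x')) with (df x' + ((f y' - f x') / (y' - x') - df x')) by ring.
    apply Rabs_sum_le; lra. }
  replace (f y' - f x') with ((f y' - f x') / (y' - x') * (y' - x')) by (field; lra).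
  rewrite Rabs_mult.
  apply Rle_lt_trans with (K * Rabs (y' - x')).
  - apply Rmult_le_compat_r; [apply Rabs_pos | assumption].
  - apply Rmult_lt_compat_l with (r := K) in hy2; [| assumption].
    replace (K * (eps / K)) with eps in hy2 by (field; lra); assumption.
Qed.

(** Intermediate points of the mean value theorem are positive, where [ext0 f] is locally [f]; the
    derivative is bounded because [df (Rmax 0 x)] is continuous on the whole line. *)
Lemma ext0_lipschitz M : exists L, 0 <= L /\ forall x y, 0 <= x <= M -> 0 <= y <= M ->
  Rabs (ext0 f x - ext0 f y) <= L * Rabs (x - y).
Proof.
  destruct f_C1 as [df hdf].
  destruct (continuous_bounded (fun x => df (Rmax 0 x)) 0 M) as [L [hL hb]].
  { intros x; apply continuous_eps; intros eps heps.
    destruct (hdf (Rmax 0 x) (Rmax_l _ _)) as [_ hc].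
    destruct (within_eps _ _ _ _ hc eps heps) as [d [hd h]].
    exists d; split; [assumption |]; intros y hy; apply h; [| apply Rmax_l].
    apply Rle_lt_trans with (1 := Rmax_lipschitz 0 y x), hy. }
  exists L; split; [assumption |]; intros x y hx hy.
  destruct (MVT_gen (ext0 f) y x (fun x => df (Rmax 0 x))) as [z [hz ->]].
  - intros z hz.
    assert (hz0 : 0 < z) by (revert hz; unfold Rmin; destruct Rle_dec; lra).
    rewrite Rmax_right by lra.
    apply (is_derive_ext_loc f).
    { apply (filter_imp (fun t => 0 < t)); [| now apply open_gt].
      intros t ht; unfold ext0; rewrite Rmax_right; lra. }
    apply is_derive_Reals; intros eps heps.
    destruct (hdf z ltac:(lra)) as [hq _].
    destruct (within_eps _ _ _ _ hq eps heps) as [d [hd h]].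
    assert (hm : 0 < Rmin d z) by (apply Rmin_glb_lt; assumption).
    exists (mkposreal _ hm); simpl; intros e he0 he.
    pose proof (Rmin_l d z); pose proof (Rmin_r d z).
    apply Rabs_def2 in he.
    assert (h1 := h (z + e)); replace (z + e - z) with e in h1 by ring.
    apply h1; [apply Rabs_def1 |]; lra.
  - intros z _; apply continuity_pt_filterlim, ext0_continuous.
  - rewrite Rabs_mult; apply Rmult_le_compat_r; [apply Rabs_pos |].
    apply hb; revert hz; unfold Rmin, Rmax; destruct Rle_dec; lra.
Qed.

Hypothesis f_pos : forall s, 0 <= s -> 0 < f s.

(** With [u T = a] and [u' T >= 0], concavity gives [u <= a] for [t <= T], so
    that replacing [f s] by [f (min a s)] does not affect the solution there. *)
Lemma backward_solution (T a b : R) : 0 <= a -> 0 <= b -> exists u v : R -> R,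
  u T = a /\ v T = b /\
  forall t, t <= T -> solves (fun t u => / 4 * exp (- t) * ext0 f u) u v t.
Proof.
  intros ha hb.
  destruct (ext0_lipschitz a) as [L [hL hlip]].
  (* Clipping to the compact interval [[0, a]] turns the local Lipschitz bound into a global one for
     [ext0 f (Rmin a x)]. *)
  assert (hclip : forall x, 0 <= Rmax 0 (Rmin a x) <= a).
  { intros x; split; [apply Rmax_l |]; apply Rmax_lub; [assumption | apply Rmin_l]. }
  assert (hext : forall x, ext0 f (Rmax 0 x) = ext0 f x).
  { intros x; unfold ext0; now rewrite (Rmax_right 0 (Rmax 0 x)) by apply Rmax_l. }
  destruct (picard_solution (fun t => / 4 * exp (- t)) (fun x => ext0 f (Rmin a x)) L T a b)
    as [u [v [huT [hvT hd]]]].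
  - intros t; apply (ex_derive_continuous (fun t => / 4 * exp (- t))); auto_derive; trivial.
  - assumption.
  - intros x y; rewrite <- (hext (Rmin a x)), <- (hext (Rmin a y)).
    apply Rle_trans with (1 := hlip _ _ (hclip x) (hclip y)).
    apply Rmult_le_compat_l; [assumption |].
    apply Rle_trans with (1 := Rmax_lipschitz _ _ _), Rmin_lipschitz.
  - exists u, v; split; [assumption |]; split; [assumption |].
    assert (hv : forall t, t <= T -> 0 <= v t).
    { intros t ht; enough (v T - v t <= 0 * (T - t)) by lra.
      apply (increment_ge v (fun t => - (/ 4 * exp (- t) * ext0 f (Rmin a (u t)))));
        [assumption | intros x _; apply hd |]; intros x _.
      pose proof (exp_pos (- x)).
      assert (0 < ext0 f (Rmin a (u x))) by apply f_pos, Rmax_l.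
      assert (0 < / 4 * exp (- x) * ext0 f (Rmin a (u x))) by (repeat apply Rmult_lt_0_compat; lra).
      lra. }
    intros t ht.
    assert (hu : u t <= a).
    { enough (0 * (T - t) <= u T - u t) by lra.
      apply (increment_le u v); [assumption | intros x _; apply hd |].
      intros x hx; apply hv; lra. }
    destruct (hd t) as [h1 h2]; rewrite Rmin_right in h2 by assumption; now split.
Qed.

Lemma source_continuous (u : R -> R) t :
  continuous u t -> continuous (fun x => / 4 * exp (- x) * ext0 f (u x)) t.
Proof.
  intros hu; apply (continuous_mult (fun x => / 4 * exp (- x)) (fun x => ext0 f (u x))).
  - apply (ex_derive_continuous (fun t => / 4 * exp (- t))); auto_derive; trivial.
  - apply (continuous_comp u (ext0 f)); [assumption | apply ext0_continuous].
Qed.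

End Nonlinearity.

(** * Radial functions *)

Lemma Derive_n_2_unique (h h1 : R -> R) (x l : R) :
  locally x (fun t => is_derive h t (h1 t)) -> is_derive h1 x l ->
  is_derive (Derive h) x l.
Proof.
  intros hl hd; apply (is_derive_ext_loc h1); [| assumption].
  apply (filter_imp _ _ (fun t ht => eq_sym (is_derive_unique h t (h1 t) ht)) hl).
Qed.

Section Radial.

Variables U U1 U2 : R -> R.
Hypothesis U_derive : forall r, 0 < r -> is_derive U r (U1 r).
Hypothesis U1_derive : forall r, 0 < r -> is_derive U1 r (U2 r).

Lemma radius_derive (x y : R) : 0 < x ^ 2 + y ^ 2 ->
  is_derive (fun t => sqrt (t ^ 2 + y ^ 2)) x (x / sqrt (x ^ 2 + y ^ 2)).
Proof.
  intros h; pose proof (sqrt_lt_R0 _ h).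
  replace (x / sqrt (x ^ 2 + y ^ 2)) with (2 * x / (2 * sqrt (x ^ 2 + y ^ 2))) by (field; lra).
  apply (is_derive_sqrt (fun t => t ^ 2 + y ^ 2)); [| assumption].
  auto_derive; [trivial | ring].
Qed.

Lemma radial_derive_2 (x y : R) : 0 < x ^ 2 + y ^ 2 ->
  let r := sqrt (x ^ 2 + y ^ 2) in
  Derive_n (fun t => radial U t y) 2 x
  = U2 r * (x ^ 2 / r ^ 2) + U1 r * (/ r - x ^ 2 / r ^ 3).
Proof.
  intros h r.
  assert (hr : 0 < r) by now apply sqrt_lt_R0.
  apply (is_derive_unique (Derive (fun t => radial U t y))).
  apply (Derive_n_2_unique _ (fun t => t / sqrt (t ^ 2 + y ^ 2) * U1 (sqrt (t ^ 2 + y ^ 2)))).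
  - assert (hc : continuous (fun t => t ^ 2 + y ^ 2) x).
    { apply (ex_derive_continuous (fun t => t ^ 2 + y ^ 2)); auto_derive; trivial. }
    apply (filter_imp (fun t => 0 < t ^ 2 + y ^ 2)).
    + intros t ht; apply (is_derive_comp U (fun t => sqrt (t ^ 2 + y ^ 2))).
      * now apply U_derive, sqrt_lt_R0.
      * now apply radius_derive.
    + apply (hc (fun z => 0 < z)); now apply open_gt.
  - assert (hd := radius_derive x y h); fold r in hd.
    replace (U2 r * (x ^ 2 / r ^ 2) + U1 r * (/ r - x ^ 2 / r ^ 3)) with
      ((1 * r - x * (x / r)) / r ^ 2 * U1 r + x / r * (x / r * U2 r)) by (field; lra).
    apply (is_derive_mult (fun t => t / sqrt (t ^ 2 + y ^ 2)) (fun t => U1 (sqrt (t ^ 2 + y ^ 2))));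
      [| | intros; apply Rmult_comm].
    + apply (is_derive_div (fun t => t) (fun t => sqrt (t ^ 2 + y ^ 2)));
        [apply (is_derive_id x) | assumption | fold r; lra].
    + apply (is_derive_comp U1 (fun t => sqrt (t ^ 2 + y ^ 2))); [| assumption].
      now apply U1_derive.
Qed.

Lemma laplacian_radial (x y : R) : (x, y) <> (0, 0) ->
  let r := sqrt (x ^ 2 + y ^ 2) in
  0 < r /\ laplacian2 (radial U) x y = U2 r + U1 r / r.
Proof.
  intros hne r.
  assert (h : 0 < x ^ 2 + y ^ 2).
  { destruct (Req_dec x 0) as [-> | hx].
    - assert (y <> 0) by (intros ->; now apply hne).
      pose proof (pow2_gt_0 y H); lra.
    - pose proof (pow2_gt_0 x hx); pose proof (pow2_ge_0 y); lra. }
  assert (hr : 0 < r) by now apply sqrt_lt_R0.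
  split; [assumption |].
  unfold laplacian2; rewrite (radial_derive_2 x y h).
  rewrite (Derive_n_ext (fun t => radial U x t) (fun t => radial U t x))
    by (intros t; unfold radial; now rewrite Rplus_comm).
  rewrite (radial_derive_2 y x) by lra.
  rewrite (Rplus_comm (y ^ 2)); fold r.
  assert (hr2 : x ^ 2 = r ^ 2 - y ^ 2) by (unfold r; rewrite pow2_sqrt; lra).
  rewrite hr2; field; lra.
Qed.

End Radial.

(** * Return to the radial variable *)

Section EmdenFowler.

Variables (f u v : R -> R).
Hypothesis f_continuous : forall x, continuous (ext0 f) x.
Hypothesis u_solves : forall t, solves (fun t u => / 4 * exp (- t) * ext0 f u) u v t.

Let U (r : R) : R := u (- 2 * ln r).
Let U1 (r : R) : R := - 2 / r * v (- 2 * ln r).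
(** The second derivative is prescribed by the radial equation and verified afterwards:
    [(2 / r)^2 u''] equals [- ext0 f (U r)] because [exp (- t) = r^2]. *)
Let U2 (r : R) : R := - ext0 f (U r) - U1 r / r.

Lemma neg2ln_derive r : 0 < r -> is_derive (fun r => - 2 * ln r) r (- 2 / r).
Proof. intros hr; auto_derive; [assumption | field; lra]. Qed.

Lemma Emden_derive r : 0 < r -> is_derive U r (U1 r).
Proof.
  intros hr; apply (is_derive_comp u (fun r => - 2 * ln r)); [| now apply neg2ln_derive].
  apply u_solves.
Qed.

Lemma Emden_derive1 r : 0 < r -> is_derive U1 r (U2 r).
Proof.
  intros hr; unfold U2, U1.
  destruct (u_solves (- 2 * ln r)) as [_ hv].
  replace (- ext0 f (U r) - - 2 / r * v (- 2 * ln r) / r) with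
    (2 / r ^ 2 * v (- 2 * ln r)
     + - 2 / r * (- 2 / r * - (/ 4 * exp (- (- 2 * ln r)) * ext0 f (U r)))).
  - apply (is_derive_mult (fun r => - 2 / r) (fun r => v (- 2 * ln r)));
      [| | intros; apply Rmult_comm].
    + auto_derive; [lra | field; lra].
    + apply (is_derive_comp v (fun r => - 2 * ln r)); [exact hv | now apply neg2ln_derive].
  - replace (- (- 2 * ln r)) with (ln r + ln r) by ring.
    rewrite exp_plus, exp_ln by assumption; field; lra.
Qed.

Lemma Emden_C2 : Ck_beyond 0 2 U.
Proof.
  assert (hloc : forall r, 0 < r -> locally r (fun t => is_derive U t (U1 t))).
  { intros r hr; apply (filter_imp (fun t => 0 < t)); [exact Emden_derive | now apply open_gt]. }
  assert (hd2 : forall r, 0 < r -> is_derive (Derive U) r (U2 r)).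
  { intros r hr; apply (Derive_n_2_unique U U1); [now apply hloc | now apply Emden_derive1]. }
  intros j r hj hr.
  destruct j as [| [| [| j]]]; [| | | lia].
  - split; [exact I |].
    apply (ex_derive_continuous U); eexists; now apply Emden_derive.
  - split; [eexists; now apply Emden_derive |].
    apply (ex_derive_continuous (Derive U)); eexists; now apply hd2.
  - split; [eexists; now apply hd2 |].
    apply (continuous_ext_loc _ U2).
    + apply (filter_imp (fun t => 0 < t)); [| now apply open_gt].
      intros t ht; symmetry; apply is_derive_unique; now apply hd2.
    + assert (hcU : continuous U r).
      { apply (ex_derive_continuous U); eexists; now apply Emden_derive. }
      apply (continuous_minus (fun r => - ext0 f (U r)) (fun r => U1 r / r)).
      * apply (continuous_opp (fun r => ext0 f (U r))).
        apply (continuous_comp U (ext0 f)); auto.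
      * apply (ex_derive_continuous (fun r => U1 r / r)).
        apply ex_derive_div; [eexists; now apply Emden_derive1 | apply ex_derive_id | lra].
Qed.

Lemma Emden_singular_solution :
  (forall M, ev (fun t => M < u t)) -> radial_singular_solution f U.
Proof.
  intros hinf; split; [exact Emden_C2 |]; split.
  - intros x y hne.
    destruct (laplacian_radial U U1 U2 Emden_derive Emden_derive1 x y hne) as [hr ->].
    unfold U2, radial; ring.
  - intros P [M hM].
    destruct (hinf M) as [N hN].
    exists (mkposreal _ (exp_pos (- (N / 2)))); intros r hr hr0.
    apply hM, hN.
    change (Rabs (r - 0) < exp (- (N / 2))) in hr; rewrite Rminus_0_r in hr.
    apply Rabs_def2 in hr.
    assert (ln r < - (N / 2)) by (rewrite <- (ln_exp (- (N / 2))); apply ln_increasing; lra).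
    lra.
Qed.

End EmdenFowler.

(** * The expansion *)

(** With [y = x^(eps/2)] one has [ln x = 2 / eps * ln y <= 2 / eps * y], so the left side is linear
    in [y] while the right side is [d y^2]; [Y] is where the latter takes over. *)
Lemma log_negligible (K d eps : R) : 0 <= K -> 0 < d -> 0 < eps ->
  ev (fun x => 1 < x /\ K * (ln x + 2) <= d * Rpower x eps).
Proof.
  intros hK hd heps.
  set (Y := 1 + K * (2 / eps + 2) / d).
  assert (he : 0 < 2 / eps) by (apply Rdiv_lt_0_compat; lra).
  assert (hY : 1 <= Y).
  { unfold Y; assert (0 <= K * (2 / eps + 2) / d); [| lra].
    apply Rmult_le_pos; [apply Rmult_le_pos; lra | apply Rlt_le, Rinv_0_lt_compat, hd]. }
  exists (Rmax 1 (Rpower Y (2 / eps))); intros x hx.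
  assert (hx1 : 1 < x) by (eapply Rle_lt_trans; [apply Rmax_l | exact hx]).
  assert (hx2 : Rpower Y (2 / eps) < x) by (eapply Rle_lt_trans; [apply Rmax_r | exact hx]).
  split; [assumption |].
  set (y := Rpower x (eps / 2)).
  assert (hy0 : 0 < y) by apply exp_pos.
  assert (hyY : Y <= y).
  { assert (hln : ln (Rpower Y (2 / eps)) < ln x) by (apply ln_increasing; [apply exp_pos | assumption]).
    unfold Rpower in hln; rewrite ln_exp in hln.
    apply Rlt_le; rewrite <- (exp_ln Y) by lra; apply exp_increasing.
    apply Rmult_lt_compat_l with (r := eps / 2) in hln; [| lra].
    replace (eps / 2 * (2 / eps * ln Y)) with (ln Y) in hln by (field; lra); assumption. }
  assert (hy2 : Rpower x eps = y * y).
  { unfold y; rewrite <- Rpower_plus; f_equal; field. }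
  assert (hlny : ln x <= 2 / eps * y).
  { assert (ln y <= y) by (pose proof (exp_ineq1_le (ln y)); rewrite exp_ln in H by assumption; lra).
    replace (ln x) with (2 / eps * ln y) by (unfold y, Rpower; rewrite ln_exp; field; lra).
    apply Rmult_le_compat_l; lra. }
  rewrite hy2.
  apply Rle_trans with (K * (2 / eps + 2) * y).
  - rewrite Rmult_assoc; apply Rmult_le_compat_l; [assumption | nra].
  - rewrite <- Rmult_assoc; apply Rmult_le_compat_r; [lra |].
    replace (K * (2 / eps + 2)) with (d * (Y - 1)) by (unfold Y; field; lra).
    apply Rmult_le_compat_l; lra.
Qed.

Lemma ln_diff_le (x y : R) : 0 < x -> 0 < y -> ln x - ln y <= (x - y) / y.
Proof.
  intros hx hy.
  pose proof (exp_ineq1_le (ln x - ln y)) as h.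
  unfold Rminus in h; rewrite exp_plus, exp_Ropp, !exp_ln in h by assumption.
  replace ((x - y) / y) with (x * / y - 1) by (field; lra); lra.
Qed.

Lemma Rabs_ln_diff_le (x y m : R) : 0 < m -> m <= x -> m <= y ->
  Rabs (ln x - ln y) <= Rabs (x - y) / m.
Proof.
  intros hm hx hy.
  assert (h : forall a b, m <= a -> m <= b -> ln a - ln b <= Rabs (a - b) / m).
  { intros a b ha hb; apply Rle_trans with (1 := ln_diff_le a b ltac:(lra) ltac:(lra)).
    apply Rle_trans with (Rabs (a - b) / b).
    - apply Rmult_le_compat_r; [apply Rlt_le, Rinv_0_lt_compat; lra | apply Rle_abs].
    - apply Rmult_le_compat_l; [apply Rabs_pos | apply Rinv_le_contravar; lra]. }
  apply Rabs_le; split; [| now apply h].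
  pose proof (h y x hy hx) as h1; rewrite Rabs_minus_sym in h1; lra.
Qed.

Section Asymptotics.

Variables (g g1 H K1 mu M1 B B1 : R -> R) (kappa C s1 : R).
Hypothesis kappa_pos : 0 < kappa.
Hypothesis C_pos : 0 < C.
Hypothesis g_unbounded : forall M, ev (fun s => M < g s).
Hypothesis g_bounded : exists M, forall s, 0 <= s <= s1 -> g s <= M.
Hypothesis tail : forall s, s1 <= s -> tail_at g g1 H K1 mu M1 B B1 kappa C s.

Lemma g_increasing s s' : s1 <= s -> s < s' -> g s < g s'.
Proof.
  intros hs hs'.
  destruct (MVT_gen g s s' g1) as [x [hx heq]].
  - intros x hx; rewrite Rmin_left in hx by lra; apply tail; lra.
  - intros x hx; rewrite Rmin_left in hx by lra.
    apply continuity_pt_filterlim, (ex_derive_continuous g); exists (g1 x); apply tail; lra.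
  - rewrite Rmin_left in hx by lra; tail_facts (tail x ltac:(lra)).
    assert (0 < g1 x * (s' - s)) by (apply Rmult_lt_0_compat; lra); lra.
Qed.

(** For [t] above the bound of [g] on [[0, s1]], every nonnegative preimage lies beyond [s1], where
    [g] is strictly increasing; [iota] then has a unique candidate. *)
Lemma ginv_spec : ev (fun t => s1 < ginv g t /\ g (ginv g t) = t).
Proof.
  destruct g_bounded as [M hM].
  pose proof (ta_pos _ _ _ _ _ _ _ _ _ _ _ (tail s1 (Rle_refl _))) as hs1.
  exists (Rmax M (g s1)); intros t ht.
  assert (ht1 : M < t) by (eapply Rle_lt_trans; [apply Rmax_l | exact ht]).
  assert (ht2 : g s1 < t) by (eapply Rle_lt_trans; [apply Rmax_r | exact ht]).
  destruct (ev_choose _ s1 (g_unbounded t)) as [s2 [h1 h2]].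
  destruct (IVT_value g s1 s2 t) as [x [hx hgx]]; [assumption | | split; [lra | apply h2; lra] |].
  { intros x hx; apply (ex_derive_continuous g); exists (g1 x); apply tail; lra. }
  assert (he : ginv g t = x).
  { apply (iota_unique (V := R_CompleteNormedModule) (fun s => 0 <= s /\ g s = t) x);
      [| split; [lra | assumption]].
    intros y [hy0 hgy].
    assert (hy : s1 < y).
    { apply Rnot_le_lt; intros hle; specialize (hM y (conj hy0 hle)); lra. }
    destruct (Rtotal_order y x) as [hlt | [heq | hgt]]; [| assumption |].
    - pose proof (g_increasing y x ltac:(lra) hlt); lra.
    - pose proof (g_increasing x y ltac:(lra) hgt); lra. }
  rewrite he; split; [lra | assumption].
Qed.

(** The correction has derivative [- g1 mu] with [|mu| <= C / g], so it varies no faster than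
    [C ln g]. *)
Lemma correction_increment s s' : s1 <= s -> s1 <= s' ->
  Rabs (correction g g1 H s - correction g g1 H s') <= C * Rabs (ln (g s) - ln (g s')).
Proof.
  set (N := correction g g1 H).
  assert (hN : forall x, s1 <= x -> is_derive N x (- (g1 x * mu x))).
  { intros x hx; tail_facts (tail x hx).
    assert (hext : forall y, g y - (g y - correction g g1 H y) = N y)
      by (intros y; unfold N; ring).
    apply (is_derive_ext _ _ _ _ hext).
    replace (- (g1 x * mu x)) with (g1 x - g1 x * (1 + mu x)) by ring.
    now apply (is_derive_minus g (fun x => g x - correction g g1 H x)). }
  assert (hln : forall x, s1 <= x -> is_derive (fun x => C * ln (g x)) x (C * (g1 x / g x))).
  { intros x hx; tail_facts (tail x hx); apply is_derive_scal.
    apply (is_derive_comp ln g); [apply is_derive_ln; lra | assumption]. }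
  assert (hmu : forall x, s1 <= x -> Rabs (g1 x * mu x) <= C * (g1 x / g x)).
  { intros x hx; tail_facts (tail x hx).
    rewrite Rabs_mult, (Rabs_pos_eq (g1 x)) by lra.
    replace (C * (g1 x / g x)) with (g1 x * (C / g x)) by (field; lra).
    apply Rmult_le_compat_l; lra. }
  assert (h : forall a b, s1 <= a -> a <= b -> Rabs (N b - N a) <= C * (ln (g b) - ln (g a))).
  { intros a b ha hab; apply Rabs_le; split.
    - enough (0 * (b - a) <= (N b + C * ln (g b)) - (N a + C * ln (g a))) by lra.
      apply (increment_le (fun x => N x + C * ln (g x))
        (fun x => - (g1 x * mu x) + C * (g1 x / g x))); [assumption | |]; intros x hx.
      + apply (is_derive_plus N (fun x => C * ln (g x))); [apply hN | apply hln]; lra.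
      + pose proof (Rle_abs (g1 x * mu x)); pose proof (hmu x ltac:(lra)); lra.
    - enough ((N b - C * ln (g b)) - (N a - C * ln (g a)) <= 0 * (b - a)) by lra.
      apply (increment_ge (fun x => N x - C * ln (g x))
        (fun x => - (g1 x * mu x) - C * (g1 x / g x))); [assumption | |]; intros x hx.
      + apply (is_derive_minus N (fun x => C * ln (g x))); [apply hN | apply hln]; lra.
      + pose proof (Rabs_maj2 (g1 x * mu x)); pose proof (hmu x ltac:(lra)); lra. }
  intros hs hs'; destruct (Rle_dec s s') as [hle | hle].
  - rewrite (Rabs_minus_sym (N s)), (Rabs_minus_sym (ln (g s))).
    apply Rle_trans with (1 := h s s' hs hle), Rmult_le_compat_l; [lra | apply Rle_abs].
  - apply Rle_trans with (1 := h s' s hs' ltac:(lra)), Rmult_le_compat_l; [lra | apply Rle_abs].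
Qed.

(** Two errors are added. Tracking within [A J / g] changes [g] by [O(1 / t)]. Moving the correction
    from [u0] to [ginv g t] costs [C |ln g(u0) - ln t|], which is [O(ln t / t)] because [g(u0) - t]
    is the correction itself, of size [O(ln t)]. The base [t / 2] is [- ln r]. *)
Lemma expansion_error (A T1 : R) (u u0 : R -> R) : 0 < A ->
  (forall M, ev (fun t => M < g (u0 t))) ->
  (forall t, T1 < t -> s1 + / g1 s1 <= u0 t /\
     g (u0 t) - correction g g1 H (u0 t) = t /\
     Rabs (u t - u0 t) * g (u0 t) <= A * / g1 (u0 t) /\ A <= g (u0 t) / 2) ->
  forall d eps, 0 < d -> 0 < eps ->
  ev (fun t => Rabs (g (u t) - (t + correction g g1 H (ginv g t))) <= d * Rpower (t / 2) (-1 + eps)).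
Proof.
  intros hA hG hT d eps hd heps.
  set (N := correction g g1 H) in *.
  set (C' := Rabs (N s1) + 1).
  assert (hC' : 0 < C') by (unfold C'; pose proof (Rabs_pos (N s1)); lra).
  pose proof (ta_ge1 _ _ _ _ _ _ _ _ _ _ _ (tail s1 (Rle_refl _))) as hg1.
  set (K := 6 * A + 4 * C * (C + C')).
  assert (hK : 0 <= K) by (unfold K; nra).
  (* Exponent [1] expresses that the correction is at most half of [g]; this makes [g (u0 t)] and
     [t] comparable. *)
  assert (e1 : ev (fun x => 1 < x /\ (C + C') * (ln x + 2) <= / 2 * Rpower x 1))
    by (apply log_negligible; lra).
  assert (e2 : ev (fun t => 1 < t / 2 /\ K * (ln (t / 2) + 2) <= d * Rpower (t / 2) eps)).
  { destruct (log_negligible K d eps hK hd heps) as [M h].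
    exists (2 * M); intros t ht; apply h; lra. }
  assert (e3 : ev (fun t => 1 < g (u0 t) /\
    (C + C') * (ln (g (u0 t)) + 2) <= / 2 * Rpower (g (u0 t)) 1)).
  { destruct e1 as [M h]; apply (ev_imp _ _ (hG M)); intros t ht; now apply h. }
  apply (ev_imp2 _ _ _ (ev_and _ _ (ev_beyond T1) ginv_spec) (ev_and _ _ e2 e3)).
  clear e1 e2 e3; intros t [ht [hsig hgsig]] [[ht2 hKt] [hG1 hGC]].
  destruct (hT t ht) as [hu0 [hth [hz hAG]]].
  set (s := u0 t) in *; set (sg := ginv g t) in *.
  assert (hJ1 : 0 < / g1 s1) by (apply Rinv_0_lt_compat, (tail s1 (Rle_refl _))).
  assert (hs : s1 <= s) by lra.
  destruct (tail s hs) as [_ _ _ hg1s _ _ _ _ _ _ _ _ _ _ _ _ _].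
  rewrite Rpower_1 in hGC by lra.
  assert (hlnG : 0 <= ln (g s)) by (rewrite <- ln_1; apply ln_le; lra).
  assert (hNs : Rabs (g s - t) <= (C + C') * (ln (g s) + 1)).
  { replace (g s - t) with ((N s - N s1) + N s1) by lra.
    apply Rle_trans with (C * Rabs (ln (g s) - ln (g s1)) + Rabs (N s1)).
    - apply Rabs_sum_le; [now apply correction_increment; auto; lra | apply Rle_refl].
    - assert (0 <= ln (g s1)) by (rewrite <- ln_1; apply ln_le; lra).
      assert (g s1 <= g s).
      { destruct hs as [hs | <-]; [apply Rlt_le, g_increasing; lra | lra]. }
      assert (ln (g s1) <= ln (g s)) by (apply ln_le; lra).
      rewrite Rabs_pos_eq by lra; unfold C'; pose proof (Rabs_pos (N s1)); nra. }
  assert (hhalf : Rabs (g s - t) <= g s / 2) by nra.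
  apply Rabs_le_between in hhalf.
  assert (hln : Rabs (ln (g s) - ln (g sg)) <= Rabs (g s - t) / (t / 2)).
  { rewrite hgsig; apply Rabs_ln_diff_le; lra. }
  (* From [g s <= 2 t = 4 * (t / 2)] and [4 <= exp 2]. *)
  assert (hlnt : ln (g s) <= ln (t / 2) + 2).
  { apply Rle_trans with (ln (t / 2 * exp 2)).
    - apply ln_le; [lra |].
      assert (4 <= exp 2).
      { replace 2 with (1 + 1) by ring; rewrite exp_plus.
        pose proof (exp_ineq1_le 1); nra. }
      nra.
    - rewrite ln_mult, ln_exp by (lra || apply exp_pos); lra. }
  assert (hgz : Rabs (g (u t) - g s) <= 6 * A / t).
  { replace (u t) with (s + (u t - s)) by ring.
    assert (hzJ : Rabs (u t - s) <= A / g s * / g1 s).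
    { apply Rmult_le_reg_r with (g s); [lra |].
      replace (A / g s * / g1 s * g s) with (A * / g1 s) by (field; lra); assumption. }
    assert (hJs : 0 < / g1 s) by now apply Rinv_0_lt_compat.
    assert (hAs : A / g s <= 1 / 2).
    { apply Rmult_le_reg_r with (g s); [lra |].
      replace (A / g s * g s) with A by (field; lra); lra. }
    assert (hz2 : Rabs (u t - s) <= / g1 s / 2).
    { apply Rle_trans with (1 := hzJ).
      apply Rle_trans with (1 / 2 * / g1 s); [apply Rmult_le_compat_r; lra | lra]. }
    apply Rle_trans with (1 := g_near _ _ _ _ _ _ _ _ _ _ _ kappa_pos tail s _ hu0 hz2).
    - apply Rle_trans with (20 / 19 * g1 s * (A / g s * / g1 s)).
      + apply Rmult_le_compat_l; lra.
      + replace (20 / 19 * g1 s * (A / g s * / g1 s)) with (20 / 19 * A * / g s) by (field; lra).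
        apply Rle_trans with (20 / 19 * A * / (t / 2)).
        * apply Rmult_le_compat_l; [lra | apply Rinv_le_contravar; lra].
        * assert (0 < / t) by (apply Rinv_0_lt_compat; lra).
          replace (20 / 19 * A * / (t / 2)) with (40 / 19 * A * / t) by (field; lra).
          unfold Rdiv at 2; apply Rmult_le_compat_r; lra. }
  replace (g (u t) - (t + N sg)) with (g (u t) - g s + (N s - N sg)) by lra.
  assert (hNN : Rabs (N s - N sg) <= C * (Rabs (g s - t) / (t / 2))).
  { apply Rle_trans with (C * Rabs (ln (g s) - ln (g sg))).
    - apply correction_increment; lra.
    - apply Rmult_le_compat_l; lra. }
  apply Rle_trans with (1 := Rabs_sum_le _ _ _ _ hgz hNN).
  replace (-1 + eps) with (eps + - (1)) by ring.
  rewrite Rpower_plus, Rpower_Ropp, Rpower_1 by lra.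
  apply Rmult_le_reg_r with (t / 2); [lra |].
  replace (d * (Rpower (t / 2) eps * / (t / 2)) * (t / 2)) with (d * Rpower (t / 2) eps)
    by (field; lra).
  replace ((6 * A / t + C * (Rabs (g s - t) / (t / 2))) * (t / 2)) with
    (3 * A + C * Rabs (g s - t)) by (field; lra).
  apply Rle_trans with (2 := hKt).
  assert (hl0 : 0 <= ln (t / 2)) by (rewrite <- ln_1; apply ln_le; lra).
  apply Rle_trans with (3 * A + C * ((C + C') * (ln (t / 2) + 3))).
  - apply Rplus_le_compat_l, Rmult_le_compat_l; [lra |].
    apply Rle_trans with (1 := hNs), Rmult_le_compat_l; lra.
  - assert (0 < C * (C + C')) by (apply Rmult_lt_0_compat; lra).
    unfold K; nra.
Qed.

End Asymptotics.

(** * Extension to all [t] and the zero *)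

Lemma is_derive_glue (h1 h2 : R -> R) (T t l : R) : h1 T = h2 T ->
  (t <= T -> is_derive h1 t l) -> (T <= t -> is_derive h2 t l) ->
  is_derive (fun x => if Rle_dec x T then h1 x else h2 x) t l.
Proof.
  intros heq hd1 hd2.
  destruct (Rtotal_order t T) as [hlt | [-> | hgt]].
  - apply (is_derive_ext_loc h1); [| apply hd1; lra].
    apply (filter_imp (fun x => x < T)); [| now apply open_lt].
    intros x hx; destruct Rle_dec; [reflexivity | lra].
  - specialize (hd1 (Rle_refl _)); specialize (hd2 (Rle_refl _)).
    apply is_derive_Reals in hd1; apply is_derive_Reals in hd2; apply is_derive_Reals.
    intros eps heps; destruct (hd1 eps heps) as [d1 h3], (hd2 eps heps) as [d2 h4].
    exists (mkposreal _ (Rmin_stable_in_posreal d1 d2)); simpl; intros e he0 he.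
    pose proof (Rmin_l d1 d2); pose proof (Rmin_r d1 d2).
    destruct (Rle_dec T T) as [_ |]; [| lra].
    destruct (Rle_dec (T + e) T); [apply h3 | rewrite heq; apply h4]; auto; lra.
  - apply (is_derive_ext_loc h2); [| apply hd2; lra].
    apply (filter_imp (fun x => T < x)); [| now apply open_gt].
    intros x hx; destruct Rle_dec; [lra | reflexivity].
Qed.

Section Global.

Variable f : R -> R.
Hypothesis f_C1 : C1_nonneg f.
Hypothesis f_pos : forall s, 0 <= s -> 0 < f s.

Let F (t u : R) : R := / 4 * exp (- t) * ext0 f u.

Lemma source_pos t u : 0 < F t u.
Proof.
  pose proof (exp_pos (- t)).
  assert (0 < ext0 f u) by apply f_pos, Rmax_l.
  unfold F; repeat apply Rmult_lt_0_compat; lra.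
Qed.

Lemma slope_decreasing u v a b : a <= b -> (forall t, a <= t <= b -> solves F u v t) -> v b <= v a.
Proof.
  intros hab hs; enough (v b - v a <= 0 * (b - a)) by lra.
  apply (increment_ge v (fun t => - F t (u t))); [assumption | intros t ht; apply hs, ht |].
  intros t _; pose proof (source_pos t (u t)); lra.
Qed.

Lemma global_solution (T1 : R) (u v : R -> R) :
  (forall t, T1 < t -> solves F u v t) -> (forall M, ev (fun t => M < u t)) ->
  exists u' v' : R -> R, (forall t, solves F u' v' t) /\ ev (fun t => u' t = u t) /\
    exists t0, u' t0 = 0.
Proof.
  intros hs hinf.
  destruct (ev_choose _ T1 (hinf 0)) as [T [hT hTpos]].
  pose proof (hTpos T (Rle_refl _)) as huT.
  (* Otherwise concavity would make [u] nonincreasing after [T], against [u -> +oo]. *)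
  assert (hvT : 0 < v T).
  { apply Rnot_le_lt; intros hle.
    destruct (ev_choose _ T (hinf (u T))) as [t [ht1 ht2]].
    specialize (ht2 t (Rle_refl _)).
    assert (hs' : forall x, T <= x <= t -> solves F u v x) by (intros; apply hs; lra).
    enough (u t - u T <= 0 * (t - T)) by lra.
    apply (increment_ge u v); [lra | intros x hx; apply hs', hx |].
    intros x hx; apply Rle_trans with (2 := hle).
    apply (slope_decreasing u v); [lra |]; intros y hy; apply hs'; lra. }
  destruct (backward_solution f f_C1 f_pos T (u T) (v T)) as [ub [vb [hu [hv hsb]]]]; [lra | lra |].
  set (u' := fun t => if Rle_dec t T then ub t else u t).
  set (v' := fun t => if Rle_dec t T then vb t else v t).
  assert (hs' : forall t, solves F u' v' t).
  { intros t; split.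
    - unfold v' at 1; apply is_derive_glue; [assumption | |]; intros ht.
      + destruct Rle_dec as [h | h]; [apply hsb, ht | lra].
      + destruct Rle_dec as [h | h]; [| apply hs; lra].
        replace t with T in * by lra; rewrite hv; apply hs; lra.
    - unfold u' at 1; apply is_derive_glue; [assumption | |]; intros ht.
      + destruct Rle_dec as [h | h]; [apply hsb, ht | lra].
      + destruct Rle_dec as [h | h]; [| apply hs; lra].
        replace t with T in * by lra; rewrite hu; apply hs; lra. }
  exists u', v'; split; [assumption |]; split.
  { exists T; intros t ht; unfold u'; destruct Rle_dec; [lra | reflexivity]. }
  assert (hvT' : v' T = v T) by (unfold v'; destruct Rle_dec; lra).
  assert (huT' : u' T = u T) by (unfold u'; destruct Rle_dec; lra).
  (* One unit to the left of the zero of the tangent at [T]: the tangent there has value [- v T < 0]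
     and lies above the solution. *)
  set (t := T - u T / v T - 1).
  assert (hquot : 0 < u T / v T) by now apply Rdiv_lt_0_compat.
  assert (hneg : u' t < 0).
  { assert (h : v T * (T - t) <= u' T - u' t).
    { apply (increment_le u' v'); [unfold t; lra | intros x _; apply hs' |].
      intros x hx; rewrite <- hvT'.
      apply (slope_decreasing u' v'); [lra | auto]. }
    replace (v T * (T - t)) with (u T + v T) in h by (unfold t; field; lra); lra. }
  destruct (IVT_value u' t T 0) as [t0 [_ ht0]].
  - unfold t; lra.
  - intros x _; apply (ex_derive_continuous u'); exists (v' x); exact (proj1 (hs' x)).
  - lra.
  - now exists t0.
Qed.

End Global.

Lemma ev_at_right (P : R -> Prop) : ev P -> at_right 0 (fun r => P (- 2 * ln r)).
Proof.
  intros [N hN]; exists (mkposreal _ (exp_pos (- (N / 2)))); intros r hr hr0; apply hN.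
  change (Rabs (r - 0) < exp (- (N / 2))) in hr; rewrite Rminus_0_r in hr.
  apply Rabs_def2 in hr.
  assert (ln r < - (N / 2)) by (rewrite <- (ln_exp (- (N / 2))); apply ln_increasing; lra).
  lra.
Qed.

(* [is_domin F a b] is Coquelicot's [b = o(a)] along the filter [F]. *)
Theorem theorem1p1 (f : R -> R) (q : R)
    (hf1 : C1_nonneg f) (hf0 : forall s : R, 0 <= s -> 0 < f s)
    (hG1 : G1 (logf f) q) (hG2 : G2 (logf f))
    (eps : R) (heps : 0 < eps <= 1 / 2) :
  exists U : R -> R,
    radial_singular_solution f U /\
    is_domin (at_right 0)
      (fun r : R => Rpower (- ln r) (- 1 + eps))
      (fun r : R => logf f (U r) - expansion (logf f) q r) /\
    exists r0 : R, 0 < r0 /\ U r0 = 0.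
Proof.
  set (g := logf f) in *.
  destruct (G1_G2_tail g q hG1 hG2) as [hq [hinf [mu [M1 [B [B1 [C [hC htail]]]]]]]].
  set (g1 := Derive g) in *; set (H := Hfun g) in *.
  set (K1 := fun s => Derive H s / g1 s) in *.
  destruct (ev_choose _ 0 htail) as [s1 [hs1 tail]]; clear htail.
  assert (hk : 0 < 1 / q) by (apply Rdiv_lt_0_compat; lra).
  destruct (exists_frame f g g1 H K1 mu M1 B B1 (1 / q) C s1 hk hC hinf (fun _ => eq_refl) hf0 tail)
    as [T [c0 [c1 [Cp [u0 [v0 [G1' [Q1 [p [p1 [fr hu0]]]]]]]]]]].
  cbv beta in fr, hu0.
  assert (hJ1 : 0 < / g1 s1) by (apply Rinv_0_lt_compat, (tail s1 (Rle_refl _))).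
  assert (hfc : forall x, continuous (ext0 f) x) by (intros; now apply ext0_continuous).
  destruct (tracking_solution _ _ _ _ _ _ _ _ _ _ _ _ _ _ fr) as [A [T1 [u [v [hA [hT1 htr]]]]]].
  { intros w t hw; now apply source_continuous. }
  (* Positivity of [u0 n] and [v0 n] supplies the sign conditions of the backward problem. *)
  { intros n hn; destruct (hu0 n hn) as [h1 [_ h2]].
    destruct (backward_solution f hf1 hf0 n (u0 n) (v0 n)) as [u [v [e1 [e2 h]]]]; [lra | lra |].
    exists u, v; split; [assumption |]; split; [assumption |]; intros t ht; apply h; lra. }
  assert (hGinf : forall M, ev (fun t => M < g (u0 t))).
  { intros M; destruct (clock_large _ _ _ _ _ _ _ _ _ _ _ _ _ _ fr (M + 1)) as [T2 [_ h]].
    exists T2; intros t ht; specialize (h t ht); cbv beta in h; lra. }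
  assert (hu0inf : forall M, ev (fun t => M < u0 t)).
  { intros M; set (m := Rmax M s1).
    apply (ev_imp2 _ _ _ (hGinf (g m)) (ev_beyond T)); intros t h ht.
    destruct (hu0 t ht) as [h1 _].
    pose proof (Rmax_l M s1); pose proof (Rmax_r M s1); fold m in H0, H1.
    apply Rnot_le_lt; intros hle.
    assert (hle2 : u0 t <= m) by lra.
    destruct hle2 as [hlt | heq]; [| rewrite heq in h; lra].
    pose proof (g_increasing _ _ _ _ _ _ _ _ _ _ _ tail (u0 t) m ltac:(lra) hlt); lra. }
  (* The distance from [u] to [u0] is at most [J], which is nonincreasing in [t], hence bounded by
     its value at [T2]. *)
  assert (huinf : forall M, ev (fun t => M < u t)).
  { intros M.
    set (T2 := T1 + 1).
    apply (ev_imp2 _ _ _ (hu0inf (M + / g1 (u0 T2))) (ev_beyond T2)); intros t h ht.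
    destruct (htr t ltac:(unfold T2 in ht; lra)) as [_ [hz hAG]].
    assert (hJ := fr_J_decr _ _ _ _ _ _ _ _ _ _ _ _ _ _ fr T2 t
      ltac:(unfold T2; lra) ltac:(lra)); cbv beta in hJ.
    assert (hJp := fr_J _ _ _ _ _ _ _ _ _ _ _ _ _ _ fr t ltac:(unfold T2 in ht; lra)); cbv beta in hJp.
    assert (hG := fr_G_ge1 _ _ _ _ _ _ _ _ _ _ _ _ _ _ fr t ltac:(unfold T2 in ht; lra)); cbv beta in hG.
    assert (hle : Rabs (u t - u0 t) <= / g1 (u0 t)).
    { apply Rmult_le_reg_r with (g (u0 t)); [lra |].
      apply Rle_trans with (1 := hz); rewrite (Rmult_comm A); apply Rmult_le_compat_l; lra. }
    pose proof (Rabs_maj2 (u t - u0 t)); lra. }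
  destruct (global_solution f hf1 hf0 T1 u v) as [U [V [hsol [hUu [t0 ht0]]]]].
  { intros t ht; apply htr, ht. }
  { assumption. }
  assert (hUinf : forall M, ev (fun t => M < U t)).
  { intros M; apply (ev_imp2 _ _ _ hUu (huinf M)); intros t ->; auto. }
  exists (fun r => U (- 2 * ln r)); split; [| split].
  - now apply (Emden_singular_solution f U V).
  - intros d.
    assert (hgb : exists M, forall s, 0 <= s <= s1 -> g s <= M).
    { destruct (continuous_bounded (fun s => ln (ext0 f s)) 0 s1) as [M [_ hM]].
      - intros x; apply (continuous_comp (ext0 f) ln); [apply hfc |].
        apply (ex_derive_continuous ln); exists (/ ext0 f x).
        apply is_derive_ln, hf0, Rmax_l.
      - exists M; intros s hs; specialize (hM s hs); unfold ext0 in hM.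
        rewrite Rmax_right in hM by lra; pose proof (Rle_abs (ln (f s))).
        unfold g, logf; lra. }
    assert (herr := expansion_error g g1 H K1 mu M1 B B1 (1 / q) C s1 hk hC hinf hgb tail
      A (Rmax T T1) u u0 hA hGinf).
    assert (hpre := ginv_spec g g1 H K1 mu M1 B B1 (1 / q) C s1 hinf hgb tail).
    assert (hmain : ev (fun t => 0 < t /\ U t = u t /\
      (s1 < ginv g t /\ g (ginv g t) = t) /\
      Rabs (g (u t) - (t + correction g g1 H (ginv g t))) <= d * Rpower (t / 2) (-1 + eps))).
    { apply ev_and; [apply ev_beyond |]; apply ev_and; [assumption |].
      apply ev_and; [assumption |].
      apply herr; [| apply cond_pos | lra].
      intros t ht; pose proof (Rmax_l T T1); pose proof (Rmax_r T T1).
      destruct (hu0 t ltac:(lra)) as [h1 [h2 _]], (htr t ltac:(lra)) as [_ [h3 h4]].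
      repeat split; auto; lra. }
    generalize (ev_at_right _ hmain); apply filter_imp; intros r.
    set (t := - 2 * ln r); intros [ht [hU [[hs hgs] hb]]].
    unfold norm; simpl; unfold abs; simpl.
    rewrite hU.
    (* As [g (ginv g t) = t], the terms [- 2 ln t + ln g] combine to [- ln g], and [- ln q] cancels
       inside [ln (q H)]. *)
    assert (hexp : expansion g q r = t + correction g g1 H (ginv g t)).
    { unfold expansion, correction; fold t; fold H; fold g1.
      tail_facts (tail (ginv g t) ltac:(lra)).
      rewrite hgs; unfold Rdiv at 1.
      rewrite !ln_mult, ln_Rinv by (try apply Rinv_0_lt_compat; lra); ring. }
    rewrite hexp, (Rabs_pos_eq (Rpower _ _)) by (apply Rlt_le, exp_pos).
    replace (- ln r) with (t / 2) by (unfold t; field); exact hb.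
  - exists (exp (- t0 / 2)); split; [apply exp_pos |].
    rewrite ln_exp; replace (- 2 * (- t0 / 2)) with t0 by field; assumption.
Qed.
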